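(* Consider the spatial factor model $\mathbf{y}_t=\mathbf{D}(\boldsymbol\rho)\mathbf{W}\mathbf{y}_t+\mathbf{B}\mathbf{f}_t+\boldsymbol\varepsilon_t$, $t=1,\dots,T$, with latent $K$-dimensional factors $\mathbf{f}_t$, equivalently $\mathbf{y}_t=\boldsymbol\Lambda\mathbf{f}_t+\boldsymbol\xi_t$, and let $\widehat{\mathbf{f}}_t=\frac1N\widehat{\boldsymbol\Lambda}'\mathbf{y}_t$ be the estimated factors, where $\widehat{\boldsymbol\Lambda}$ is the autocovariance-based eigenanalysis estimator (defined in the context). Assume: (1) $\{(\mathbf{y}_t,\mathbf{f}_t)\}$ is strictly stationary and $\alpha$-mixing with mixing coefficients satisfying $\sum_{k=1}^\infty\alpha_N(k)^{1-2/\gamma}<\infty$ for some $\gamma>2$, where $\alpha_N(k)=\sup_i\sup_{A\in\mathcal{F}_{-\infty}^i,\,B\in\mathcal{F}_{i+k}^\infty}|P(A\cap B)-P(A)P(B)|$ and $\mathcal{F}_i^j$ is the $\sigma$-field generated by $\{(\mathbf{y}_t,\mathbf{f}_t):i\le t\le j\}$. (2) $\mathbf{W}$ is known with zero main diagonal, $\mathbf{S}_N(\boldsymbol\rho):=\mathbf{I}_N-\mathbf{D}(\boldsymbol\rho)\mathbf{W}$ is invertible, and the row and column sums of $|\mathbf{W}|$ and $|\mathbf{S}_N(\boldsymbol\rho)^{-1}|$ (entrywise absolute values) are bounded uniformly in $N$. (3) $\{\boldsymbol\varepsilon_t\}$ is a white noise process with $\mathrm{Cov}(\mathbf{y}_{t-j},\boldsymbol\varepsilon_t)=\mathbf{0}$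 for $j\ge1$ and $\mathrm{Cov}(\mathbf{f}_{t-k},\boldsymbol\varepsilon_t)=\mathbf{0}$ for $k\ge0$. (4) $\mathbf{B}$ is of full rank and $\frac1N\mathbf{B}'\mathbf{S}_N'(\boldsymbol\rho)^{-1}\mathbf{S}_N(\boldsymbol\rho)^{-1}\mathbf{B}=\mathbf{I}_K$. (5) $E|f_{j,t}|^{2\gamma}<C$ and $E|\varepsilon_{k,t}|^{2\gamma}<C$ for $1\le j\le K$, $1\le k\le N$, with $\gamma$ as in (1). (6) For $i=1,\dots,N$ and any $\lambda>0$, the matrix $\mathbf{X}_i'\mathbf{X}_i+\lambda\mathbf{I}_{K+1}$ has rank $K+1$. Then (as $N,T\to\infty$): (i) If $\mathbf{f}_t$ and $\boldsymbol\varepsilon_t$ are sub-exponentially distributed in the sense that $P(|\mathbf{v}_1'\mathbf{f}_t|>x)\le C\exp(-Cx)$ and $P(|\mathbf{v}_2'\boldsymbol\varepsilon_t|>x)\le C\exp(-Cx)$ for any $x>0$ and any constant vectors with $\|\mathbf{v}_1\|_2=\|\mathbf{v}_2\|_2=1$, then there exists an invertible matrix $\mathbf{K}_{NT}\in\mathbb{R}^{K\times K}$ such that \[\max_{1\le t\le T}\|\widehat{\mathbf{f}}_t-\mathbf{K}_{NT}\mathbf{f}_t\|_2=O_p\Big\{\Big(\frac1{\sqrt N}+\frac1{\sqrt T}\Big)\log(T)\Big\}.\] (ii) Let $\mathbf{p}_i$ be the $i$-th column of $\boldsymbol\Lambda'(\mathbf{I}_N-\mathbf{D}(\boldsymbol\rho)\mathbf{W})^{-1}$,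 and assume also that for each $t=1,\dots,T$, as $N\to\infty$, $\frac1{\sqrt N}\sum_{i=1}^N\mathbf{p}_i\varepsilon_{i,t}\longrightarrow_d N(0,\boldsymbol\Gamma_t)$, where $\boldsymbol\Gamma_t=\lim_{N\to\infty}\frac1N\sum_{i=1}^N\sum_{j=1}^N\mathbf{p}_i\mathbf{p}_j'E(\varepsilon_{i,t}\varepsilon_{j,t})$ in probability. If $N=o(T)$, then there exist an invertible matrix $\mathbf{K}_{NT}\in\mathbb{R}^{K\times K}$ and its limit $\mathbf{H}\in\mathbb{R}^{K\times K}$ such that \[\sqrt N(\widehat{\mathbf{f}}_t-\mathbf{K}_{NT}\mathbf{f}_t)=\mathbf{H}\frac1{\sqrt N}\sum_{i=1}^N\mathbf{p}_i\varepsilon_{i,t}+o_p(1)\longrightarrow_d N(0,\mathbf{H}\boldsymbol\Gamma_t\mathbf{H}'),\] where $\mathbf{H}$ is also the limit (in probability) of the matrix $\mathbf{H}_{NT}$ defined in the context.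
   Context: Setting: for each $N$, $\mathbf{y}_t$ is an $N$-dimensional zero-mean panel, $\mathbf{f}_t\in\mathbb{R}^K$ is a zero-mean factor process with $K$ a fixed known integer, $\mathbf{W}$ is an $N\times N$ spatial weight matrix with rows $\mathbf{w}_1',\dots,\mathbf{w}_N'$, $\mathbf{D}(\boldsymbol\rho)=\mathrm{diag}(\rho_1,\dots,\rho_N)$, $\mathbf{B}$ is the $N\times K$ loading matrix, $\boldsymbol\varepsilon_t=(\varepsilon_{1,t},\dots,\varepsilon_{N,t})'$. $C$ is a generic positive constant whose value may change from place to place. Put $\boldsymbol\Lambda=(\mathbf{I}_N-\mathbf{D}(\boldsymbol\rho)\mathbf{W})^{-1}\mathbf{B}$ and $\boldsymbol\xi_t=(\mathbf{I}_N-\mathbf{D}(\boldsymbol\rho)\mathbf{W})^{-1}\boldsymbol\varepsilon_t$, so $\boldsymbol\Lambda'\boldsymbol\Lambda/N=\mathbf{I}_K$. With $\boldsymbol\Sigma_{yf}(k)=\mathrm{Cov}(\mathbf{y}_t,\mathbf{f}_{t-k})$, $\boldsymbol\Sigma_f(k)=\mathrm{Cov}(\mathbf{f}_t,\mathbf{f}_{t-k})$ (argument omitted when $k=0$), \[\mathbf{X}_i=\begin{pmatrix}\boldsymbol\Sigma_{yf}'\mathbf{w}_i&\boldsymbol\Sigma_f'\\ \boldsymbol\Sigma_{yf}'(1)\mathbf{w}_i&\boldsymbol\Sigma_f'(1)\end{pmatrix}.\] Eigenanalysis: let $k_0\ge1$ be a fixed integer, $\boldsymbol\Sigma_y(k)=\mathrm{Cov}(\mathbf{y}_t,\mathbf{y}_{t-k})$,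 $\mathbf{M}=\sum_{k=1}^{k_0}\boldsymbol\Sigma_y(k)\boldsymbol\Sigma_y'(k)$; it is understood that $\mathbf{M}$ has $K$ non-zero eigenvalues. Let $\widehat{\boldsymbol\Sigma}_y(k)=\frac1T\sum_{t=k+1}^T\mathbf{y}_t\mathbf{y}_{t-k}'$ and $\widehat{\mathbf{M}}=\sum_{k=1}^{k_0}\widehat{\boldsymbol\Sigma}_y(k)\widehat{\boldsymbol\Sigma}_y'(k)$. $\widehat{\boldsymbol\Lambda}$ is the $N\times K$ matrix whose columns are $\sqrt N$ times orthonormal eigenvectors of $\widehat{\mathbf{M}}$ corresponding to its $K$ largest eigenvalues. Rotation matrix: $\mathbf{H}_{NT}$ is defined by $\mathbf{H}_{NT}'=\sum_{k=1}^{k_0}\mathbf{G}_{1,k}\mathbf{G}_{1,k}'\boldsymbol\Lambda'\widehat{\boldsymbol\Lambda}\widehat{\mathbf{V}}_{NT}^{-1}$, where $\mathbf{G}_{1,k}=\frac1T\sum_{t=k+1}^T(\mathbf{f}_t\mathbf{f}_{t-k}'\boldsymbol\Lambda'+\mathbf{f}_t\boldsymbol\xi_{t-k}')$ and $\widehat{\mathbf{V}}_{NT}$ is the $K\times K$ diagonal matrix of the top $K$ eigenvalues of $\widehat{\mathbf{M}}$.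
   Formalization: Mended by adding: mixing sums are bounded uniformly in N; the K nonzero eigenvalues of M are at least cN^2; in (ii), Λ'MΛ/N^3 converges to a matrix with distinct eigenvalues and the column signs of Λ̂ are suitably chosen. Without these the rates or the limit H can fail. *)

(* Defs.v *)
From HB Require Import structures.
From mathcomp Require Export all_boot all_order all_algebra.
From mathcomp Require Export all_classical all_reals all_analysis.

Set Implicit Arguments.
Unset Strict Implicit.
Unset Printing Implicit Defensive.

Export Order.TTheory GRing.Theory Num.Theory.
Export numFieldNormedType.Exports.

Local Open Scope classical_set_scope.
Local Open Scope ring_scope.

Section probability_notions.
Context {R : realType} {d : measure_display} {Om : measurableType d}.
Variable P : probability Om R.

Definition norm2 n (v : 'cV[R]_n) : R := Num.sqrt (\sum_(i < n) v i 0 ^+ 2).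

(* Borel sigma-algebra of the matrix space, generated by its open sets. *)
Definition borel_mx m n := g_sigma_algebraType (@open 'M[R]_(m, n)).

Definition random_mx m n (X : Om -> 'M[R]_(m, n)) : Prop :=
  forall i j, measurable_fun [set: Om] (fun w => X w i j).

Definition mean_zero n (X : Om -> 'cV[R]_n) : Prop :=
  forall i, ('E_P[fun w => X w i 0%R] = 0)%E.

Definition covmx m n (X : Om -> 'cV[R]_m) (Y : Om -> 'cV[R]_n) : 'M[R]_(m, n) :=
  \matrix_(i, j) fine (covariance P (fun w => X w i 0) (fun w => Y w j 0)).

Definition stack n (Z : int -> Om -> 'cV[R]_n) m (ts : 'I_m -> int) (w : Om) :
  'M[R]_(n, m) := \matrix_(a, l) Z (ts l) w a 0.

Definition strictly_stationary n (Z : int -> Om -> 'cV[R]_n) : Prop :=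
  forall m (ts : 'I_m -> int) (h : int) (A : set (borel_mx n m)),
    measurable A ->
    P (stack Z ts @^-1` A) = P (stack Z (fun l => ts l + h) @^-1` A).

Definition sigma_field n (Z : int -> Om -> 'cV[R]_n) (D : set int) :
    set (set Om) :=
  <<s [set E | exists2 t, D t &
       exists2 A : set (borel_mx n 1), measurable A & E = Z t @^-1` A] >>.

Definition alpha_coef n (Z : int -> Om -> 'cV[R]_n) (k : nat) : \bar R :=
  ereal_sup [set a | exists (i : int) (A B : set Om),
    [/\ sigma_field Z [set t | (t <= i)%R] A,
        sigma_field Z [set t | (i + k%:Z <= t)%R] B &
        a = `| P (A `&` B) - P A * P B |%E]].

Definition white_noise n (e : int -> Om -> 'cV[R]_n) : Prop :=
  [/\ forall t, mean_zero (e t),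
      forall s t, s != t -> covmx (e s) (e t) = 0 &
      forall s t, covmx (e s) (e s) = covmx (e t) (e t)].

(* X = O_p(r) along F *)
Definition bigO_prob I (F : set_system I) (X : I -> Om -> R) (r : I -> R) : Prop :=
  forall e : R, 0 < e -> exists2 C : R, 0 < C &
    \forall i \near F, (P [set w | (C * r i < `|X i w|)%R] <= e%:E)%E.

Definition cvg_prob I (F : set_system I) m n (X : I -> Om -> 'M[R]_(m, n))
    (L : 'M[R]_(m, n)) : Prop :=
  forall e : R, 0 < e ->
    P [set w | exists i j, e < `|X x w i j - L i j|] @[x --> F] --> 0%E.

(* [normal_prob] is not a point mass when the standard deviation is 0, hence
   the separate case. *)
Definition normal_law0 (v : R) (A : set R) : \bar R :=
  if v == 0 then \d_(0 : R) A else normal_prob 0 (Num.sqrt v) A.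

(* mu = N(0, G), with G possibly singular: all linear forms are normal. *)
Definition is_mvnormal0 n (G : 'M[R]_n) (mu : probability (borel_mx n 1) R) :
    Prop :=
  forall (u : 'cV[R]_n) (A : set R), measurable A ->
    mu [set x | A ((u^T *m x) 0 0)] = normal_law0 ((u^T *m G *m u) 0 0) A.

Definition cvg_dist_normal I (F : set_system I) n (X : I -> Om -> 'cV[R]_n)
    (G : 'M[R]_n) : Prop :=
  exists2 mu : probability (borel_mx n 1) R, is_mvnormal0 G mu &
    forall g : 'cV[R]_n -> R, continuous g -> (exists M : R, forall x, `|g x| <= M) ->
      ('E_P[fun w => g (X x w)] @[x --> F] --> \int[mu]_x (g x)%:E)%E.

End probability_notions.

(* Joint limits of (N, T): N, T -> oo, respectively N -> oo with N = o(T). A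
   family converges along [oT_filter] iff it converges along every sequence
   (N_n, T_n) with N_n -> oo and N_n / T_n -> 0. *)
Definition oo_filter : set_system (nat * nat) := filter_prod \oo \oo.

Definition oT_filter : set_system (nat * nat) :=
  [set A | exists c : nat, forall N T : nat,
     (c <= N)%N -> (c * N <= T)%N -> A (N, T)].

#[global] Instance oT_filter_proper : ProperFilter oT_filter.
Proof.
apply: Build_ProperFilter.
  by move=> [c /(_ c (c * c)%N)]; apply.
split.
- by exists 0%N.
- move=> A B [a aA] [b bB]; exists (maxn a b) => N T.
  rewrite geq_max => /andP[aN bN] abT; split.
    by apply: aA => //; apply: leq_trans abT; rewrite leq_mul2r leq_maxl orbT.
  by apply: bB => //; apply: leq_trans abT; rewrite leq_mul2r leq_maxr orbT.
- by move=> A B AB [c cA]; exists c => N T cN cT; apply: AB; exact: cA.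
Qed.

Section eigen.
Context {R : realType}.

(* s lists the eigenvalues of A with their multiplicities *)
Definition spectrum n (A : 'M[R]_n) (s : seq R) : Prop :=
  char_poly A = \prod_(x <- s) ('X - x%:P).

(* v holds the K largest eigenvalues of A; the columns of L are sqrt N times
   corresponding orthonormal eigenvectors. *)
Definition top_eigenpairs N K (A : 'M[R]_N) (v : 'rV[R]_K) (L : 'M[R]_(N, K)) :
    Prop :=
  (exists s, [/\ spectrum A s, sorted >=%R s & forall j : 'I_K, v 0 j = s`_j]) /\
  (exists U : 'M[R]_(N, K),
     [/\ L = Num.sqrt N%:R *: U, U^T *m U = 1%:M & A *m U = U *m diag_mx v]).

End eigen.

Record panel (R : realType) d (Om : measurableType d) (N K : nat) := Panel {
  obs : int -> Om -> 'cV[R]_N ;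
  factor : int -> Om -> 'cV[R]_K ;
  noise : int -> Om -> 'cV[R]_N ;
  rho : 'rV[R]_N ;
  weight : 'M[R]_N ;
  load : 'M[R]_(N, K) }.

Section model.
Context {R : realType} {d : measure_display} {Om : measurableType d}.
Context {N K : nat}.
Variables (P : probability Om R) (k0 : nat) (m : panel R Om N K).

Let y := obs m.
Let f := factor m.
Let eps := noise m.
Let W := weight m.
Let B := load m.

Definition spatial_factor_model : Prop :=
  [/\ forall t, [/\ random_mx (y t), random_mx (f t) & random_mx (eps t)],
      forall t, mean_zero P (y t),
      forall t, mean_zero P (f t) &
      forall t w, y t w = diag_mx (rho m) *m W *m y t w + B *m f t w + eps t w].

Definition joint (t : int) (w : Om) : 'cV[R]_(N + K) := col_mx (y t w) (f t w).

Definition Smx : 'M[R]_N := 1%:M - diag_mx (rho m) *m W.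
Definition Lam : 'M[R]_(N, K) := invmx Smx *m B.
Definition xi (t : int) (w : Om) : 'cV[R]_N := invmx Smx *m eps t w.

(* By stationarity the lag-k covariances do not depend on t; t = 0 is used. *)
Definition Sigma_yf (k : nat) : 'M[R]_(N, K) := covmx P (y 0) (f (- k%:Z)).
Definition Sigma_f (k : nat) : 'M[R]_K := covmx P (f 0) (f (- k%:Z)).
Definition Sigma_y (k : nat) : 'M[R]_N := covmx P (y 0) (y (- k%:Z)).

Definition Xmx (i : 'I_N) : 'M[R]_(K + K, 1 + K) :=
  let w_i := (row i W)^T in
  block_mx ((Sigma_yf 0)^T *m w_i) (Sigma_f 0)^T
           ((Sigma_yf 1)^T *m w_i) (Sigma_f 1)^T.

Definition Mmx : 'M[R]_N :=
  \sum_(1 <= k < k0.+1) Sigma_y k *m (Sigma_y k)^T.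

Definition Sigma_y_hat (T k : nat) (w : Om) : 'M[R]_N :=
  T%:R^-1 *: \sum_(k.+1 <= t < T.+1) y t%:Z w *m (y (t%:Z - k%:Z) w)^T.

Definition Mhat (T : nat) (w : Om) : 'M[R]_N :=
  \sum_(1 <= k < k0.+1) Sigma_y_hat T k w *m (Sigma_y_hat T k w)^T.

Definition G1 (T k : nat) (w : Om) : 'M[R]_(K, N) :=
  T%:R^-1 *: \sum_(k.+1 <= t < T.+1)
    (f t%:Z w *m (f (t%:Z - k%:Z) w)^T *m Lam^T
     + f t%:Z w *m (xi (t%:Z - k%:Z) w)^T).

(* H_NT for the eigenvalues v and the loading estimate L *)
Definition HNT (T : nat) (v : 'rV[R]_K) (L : 'M[R]_(N, K)) (w : Om) : 'M[R]_K :=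
  (\sum_(1 <= k < k0.+1)
     (G1 T k w *m (G1 T k w)^T *m Lam^T *m L *m invmx (diag_mx v)))^T.

Definition fhat (L : 'M[R]_(N, K)) (t : int) (w : Om) : 'cV[R]_K :=
  N%:R^-1 *: (L^T *m y t w).

Definition pvec (i : 'I_N) : 'cV[R]_K := col i (Lam^T *m invmx Smx).

Definition score (t : int) (w : Om) : 'cV[R]_K :=
  (Num.sqrt N%:R)^-1 *: \sum_(i < N) eps t w i 0 *: pvec i.

Definition score_var (t : int) : 'M[R]_K :=
  N%:R^-1 *: \sum_(i < N) \sum_(j < N)
    fine ('E_P[fun w => (eps t w i 0 * eps t w j 0)%R])%E *: (pvec i *m (pvec j)^T).

End model.

(* In the conditions below [forall N, K <= N] is the range of cross-section
   sizes for which a loading matrix with Lam' Lam / N = I_K can exist. *)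
Section assumptions.
Context {R : realType} {d : measure_display} {Om : measurableType d} {K : nat}.
Variables (P : probability Om R) (k0 : nat) (gamma : R).
Variable m : forall N, panel R Om N K.

(* As with every bound below, the bound on the mixing sums is uniform in N. *)
Definition mixing_condition : Prop :=
  (forall N, (K <= N)%N -> strictly_stationary P (joint (m N))) /\
  (exists C : R, forall N, (K <= N)%N ->
     (\sum_(1 <= k <oo) alpha_coef P (joint (m N)) k `^ (1 - 2 / gamma)%R
        <= C%:E)%E).

Definition abs_sums_le n (C : R) (A : 'M[R]_n) : Prop :=
  forall i, \sum_j `|A i j| <= C /\ \sum_j `|A j i| <= C.

Definition weight_condition : Prop :=
  (forall N, (K <= N)%N ->
     (forall i, weight (m N) i i = 0) /\ Smx (m N) \in unitmx) /\
  (exists C : R, forall N, (K <= N)%N ->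
     abs_sums_le C (weight (m N)) /\ abs_sums_le C (invmx (Smx (m N)))).

Definition noise_condition : Prop :=
  forall N, (K <= N)%N ->
    [/\ white_noise P (noise (m N)),
        forall (t : int) (j : nat), (0 < j)%N ->
          covmx P (obs (m N) (t - j%:Z)) (noise (m N) t) = 0 &
        forall (t : int) (k : nat),
          covmx P (factor (m N) (t - k%:Z)) (noise (m N) t) = 0].

Definition loading_condition : Prop :=
  forall N, (K <= N)%N ->
    let B := load (m N) in let S := Smx (m N) in
    \rank B = K /\
    N%:R^-1 *: (B^T *m invmx S^T *m invmx S *m B) = 1%:M.

Definition moment_condition : Prop :=
  exists C : R, forall N, (K <= N)%N -> forall t : int,
    (forall j, ('E_P[fun w => (`|factor (m N) t w j 0| `^ (2 * gamma))%R] < C%:E)%E)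
    /\
    (forall i, ('E_P[fun w => (`|noise (m N) t w i 0| `^ (2 * gamma))%R] < C%:E)%E).

Definition rank_condition : Prop :=
  forall N, (K <= N)%N -> forall (i : 'I_N) (lambda : R), 0 < lambda ->
    let X := Xmx P (m N) i in \rank (X^T *m X + lambda%:M) = (1 + K)%N.

(* M has K non-zero eigenvalues, which stay non-zero as N -> oo on the scale
   N^2 of M (recall that Lam' Lam = N I_K). *)
Definition eigenvalue_condition : Prop :=
  exists2 c : R, 0 < c & forall N, (K <= N)%N ->
    exists s : seq R,
      [/\ spectrum (Mmx P k0 (m N)) s,
          count (fun x => x != 0) s = K &
          forall x, x \in s -> x != 0 -> c * N%:R ^+ 2 <= x].

(* In the orthonormal basis Lam / sqrt N of the range of M, the matrix M / N^2
   reads Lam' M Lam / N^3. It converges to a K x K matrix with K distinct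
   eigenvalues (positive under [eigenvalue_condition]). *)
Definition eigen_limit_condition : Prop :=
  exists A : 'M[R]_K,
    ((N%:R^-1 ^+ 3) *: ((Lam (m N))^T *m Mmx P k0 (m N) *m Lam (m N)))
      @[N --> \oo] --> A /\
    exists2 s : seq R, spectrum A s & uniq s.

Definition subexponential_condition : Prop :=
  exists C1 C2 : R, [/\ 0 < C1, 0 < C2 &
    forall N, (K <= N)%N -> forall (t : int) (x : R), 0 < x ->
      (forall v : 'cV[R]_K, norm2 v = 1 ->
         (P [set w | (x < `|(v^T *m factor (m N) t w) 0 0|)%R]
            <= (C1 * expR (- (C2 * x)))%:E)%E) /\
      (forall v : 'cV[R]_N, norm2 v = 1 ->
         (P [set w | (x < `|(v^T *m noise (m N) t w) 0 0|)%R]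
            <= (C1 * expR (- (C2 * x)))%:E)%E)].

(* CLT for the scores; the p_i being deterministic, Gamma_t is an ordinary
   limit. *)
Definition score_clt (Gamma : nat -> 'M[R]_K) : Prop :=
  forall t : nat, (1 <= t)%N ->
    score_var P (m N) t%:Z @[N --> \oo] --> Gamma t /\
    cvg_dist_normal P \oo (fun N => score (m N) t%:Z) (Gamma t).

(* A measurable selection of eigenvectors, which are determined at best up to
   sign: the columns of Lhat may change sign arbitrarily with N, T and w. *)
Definition eigen_estimator (Lhat : forall N, nat -> Om -> 'M[R]_(N, K))
    (Vhat : nat -> nat -> Om -> 'rV[R]_K) : Prop :=
  forall N T, (K <= N)%N ->
    random_mx (Lhat N T) /\
    forall w, top_eigenpairs (Mhat k0 (m N) T w) (Vhat N T w) (Lhat N T w).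

End assumptions.

(* Main.v *)
(* Put Psi = Lam / sqrt N, which has orthonormal columns. Model and white noise give
   Sigma_y(k) = Lam C_k, so M / N^2 = Psi a Psi' with a = Lam' M Lam / N^3, and a >= c I
   by the eigenvalue condition. The sample autocovariances are Lam G_{1,k} + E_k with
   E_k = (1/T) sum_t xi_t y_{t-k}'; Davydov's covariance inequality bounds the second
   moments of |E_k| / N and |G_{1,k} - C_k| / sqrt N by a multiple of 1/T. Hence
   Mhat / N^2 is within delta = O_p(1 / sqrt T) of Psi a Psi'. By Courant-Fischer and
   perturbation bounds, q = Lam' Lhat / N is nearly orthogonal, Lhat / sqrt N - Psi q =
   O(delta), H_NT' - q = O(delta), and q nearly diagonalises a.
   As y_t = Lam f_t + xi_t,
     fhat_t - q' f_t = q' Lam' xi_t / N + (Lhat - Lam q)' xi_t / N,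
   and K_NT = q'. For the maximum over t, exponential tails bound Lam' xi_t / N, and
   truncated second moments bound |xi_t| / sqrt N, up to log T. For the central limit
   theorem, a -> A = E diag(al) E' with distinct eigenvalues; after fixing the signs,
   q -> E, the second term is negligible since N = o(T), and Slutsky's lemma applies
   with H = E'. *)

From HB Require Import structures.
Require Import Defs.
From mathcomp Require Import zify ring lra measurable_realfun.

Set Implicit Arguments.
Unset Strict Implicit.
Unset Printing Implicit Defensive.

Local Open Scope classical_set_scope.
Local Open Scope ring_scope.

(** [N] and [T] grow together, so every constant must be fixed before [N]: [regular_panel] isolates
    the hypotheses with such constants. Two quantities resist uniformity. A row of the loading
    matrix is bounded only through Lam' Lam = N I, so single observations have no moment bounds
    uniform in [N]; each is divided by its own [obs_scale], and the squared scales add up to O(N).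
    And a union bound over the N noise coordinates would cost log N, which log T does not dominate;
    averaging truncated squares over the coordinates avoids it. Once [err_nf] is small, all
    statements on eigenvectors are deterministic inequalities with explicit constants. The residual
    of the loadings is not bounded through a theorem on eigenspaces: multiplied by the sample
    eigenvalues, it is a projection of terms that all contain an E_k. The signs of the sample
    eigenvectors vary arbitrarily with the outcome, so the rotation is shown to converge after a
    measurable choice of signs that makes the diagonal of E' q nonnegative. *)

(** * Expectation of real random variables *)

Section real_expectation.
Context {R : realType} {d : measure_display} {Om : measurableType d}.
Variable P : probability Om R.
Implicit Types f g : Om -> R.

Definition Ex (f : Om -> R) : R := fine 'E_P[f].

Definition ig (f : Om -> R) : Prop := P.-integrable [set: Om] (EFin \o f).

Lemma ig_meas f : ig f -> measurable_fun [set: Om] f.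
Proof. by move=> /measurable_int /measurable_EFinP. Qed.

Lemma ExE f : ig f -> ('E_P[f] = (Ex f)%:E)%E.
Proof.
by move=> fi; rewrite /Ex fineK// unlock; exact: (integrable_fin_num _ fi).
Qed.

Lemma eq_Ex f g : f =1 g -> Ex f = Ex g.
Proof. by move=> /funext ->. Qed.

Lemma ig_le f g : measurable_fun [set: Om] f -> ig g ->
  (forall w, `|f w| <= g w) -> ig f.
Proof.
move=> mf gi fg; apply: le_integrable gi => //; first exact/measurable_EFinP.
by move=> w _ /=; rewrite lee_fin (le_trans (fg w))// ler_norm.
Qed.

Lemma ig_cst c : ig (fun=> c).
Proof. exact: finite_measure_integrable_cst. Qed.

Lemma igD f g : ig f -> ig g -> ig (fun w => f w + g w).
Proof. by move=> fi gi; exact: (integrableD _ fi gi). Qed.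

Lemma igB f g : ig f -> ig g -> ig (fun w => f w - g w).
Proof. by move=> fi gi; exact: (integrableB _ fi gi). Qed.

Lemma igZ k f : ig f -> ig (fun w => k * f w).
Proof. by move=> fi; exact: (integrableZl _ _ fi). Qed.

Lemma igN f : ig f -> ig (fun w => - f w).
Proof. by move=> fi; exact: (integrableN fi). Qed.

Lemma ig_norm f : ig f -> ig (fun w => `|f w|).
Proof. by move=> fi; exact: (integrable_abse fi). Qed.

Lemma ig_sum I (s : seq I) (F : I -> Om -> R) :
  (forall i, ig (F i)) -> ig (fun w => \sum_(i <- s) F i w).
Proof.
move=> Fi; elim: s => [|i s ih].
  by under [X in ig X]funext do rewrite big_nil; exact: ig_cst.
under [X in ig X]funext do rewrite big_cons; exact: igD.
Qed.

Lemma ig_indic A : measurable A -> ig (\1_A : Om -> R).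
Proof.
move=> mA; apply: (@ig_le _ (fun=> 1)).
- exact: measurable_indic.
- exact: ig_cst.
- by move=> w; rewrite indicE; case: (_ \in _); rewrite ?normr1 ?normr0.
Qed.

Lemma Ex_cst c : Ex (fun=> c) = c.
Proof. by rewrite /Ex expectation_cst. Qed.

Lemma ExD f g : ig f -> ig g -> Ex (fun w => f w + g w) = Ex f + Ex g.
Proof. by move=> fi gi; rewrite /Ex unlock; exact: RintegralD. Qed.

Lemma ExB f g : ig f -> ig g -> Ex (fun w => f w - g w) = Ex f - Ex g.
Proof. by move=> fi gi; rewrite /Ex unlock; exact: RintegralB. Qed.

Lemma ExZ k f : ig f -> Ex (fun w => k * f w) = k * Ex f.
Proof. by move=> fi; rewrite /Ex unlock; exact: RintegralZl. Qed.

Lemma Ex_sum I (s : seq I) (F : I -> Om -> R) : (forall i, ig (F i)) ->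
  Ex (fun w => \sum_(i <- s) F i w) = \sum_(i <- s) Ex (F i).
Proof.
move=> Fi; elim: s => [|i s ih].
  by under eq_Ex do rewrite big_nil; rewrite Ex_cst big_nil.
under eq_Ex do rewrite big_cons.
by rewrite ExD ?ih ?big_cons//; exact: ig_sum.
Qed.

Lemma Ex_ge0 f : (forall w, 0 <= f w) -> 0 <= Ex f.
Proof. by move=> f0; rewrite /Ex fine_ge0// expectation_ge0. Qed.

Lemma Ex_le f g : ig f -> ig g -> (forall w, f w <= g w) -> Ex f <= Ex g.
Proof. by move=> fi gi fg; rewrite /Ex unlock; apply: le_Rintegral. Qed.

Lemma Ex_norm_le f : ig f -> `|Ex f| <= Ex (fun w => `|f w|).
Proof. by move=> fi; rewrite /Ex unlock; apply: le_normr_Rintegral. Qed.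

Lemma Ex_indic A : measurable A -> Ex (\1_A) = fine (P A).
Proof. by move=> mA; rewrite /Ex expectation_indic. Qed.

Lemma ig_of_lt f C : measurable_fun [set: Om] f -> (forall w, 0 <= f w) ->
  ('E_P[f] < C%:E)%E -> ig f /\ Ex f <= C.
Proof.
move=> mf f0 fC; have fi : ig f.
  apply/integrableP; split; first exact/measurable_EFinP.
  apply: le_lt_trans (lt_trans fC (ltry C)); rewrite unlock.
  rewrite le_eqVlt; apply/orP; left; apply/eqP; apply: eq_integral => w _.
  by rewrite /= ger0_norm.
by split=> //; rewrite -lee_fin -ExE// ltW.
Qed.

Lemma prob_gt_le f (a : R) : ig f -> (forall w, 0 <= f w) -> 0 < a ->
  (P [set w | (a < f w)%R] <= (Ex f / a)%:E)%E.
Proof.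
move=> fi f0 a0; have mA : measurable [set w | a < f w].
  rewrite -[X in measurable X]setTI.
  have /(_ measurableT [set true]) := measurable_fun_ltr (measurable_cst a) (ig_meas fi).
  by apply.
rewrite -[leLHS]fineK ?fin_num_measure// lee_fin -Ex_indic// ler_pdivlMr// mulrC.
rewrite -ExZ; last exact: ig_indic.
apply: Ex_le => //; first exact/igZ/ig_indic.
move=> w; rewrite indicE; case: (boolP (w \in _)) => /=; last by rewrite mulr0.
by rewrite inE/= mulr1 => /ltW.
Qed.

End real_expectation.

Ltac solve_ig :=
  repeat first [ assumption | exact: ig_cst | apply: igD | apply: igB | apply: igN | apply: igZ
               | apply: ig_norm | apply: ig_sum => ?].

(** The sum counts the naturals below [x], so on [0, n] it is the ceiling of [x]. This measures the
    error of replacing a variable by a staircase of half-line indicators. *)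
Lemma count_lt_dist (R : realType) (n : nat) (x : R) : 0 <= x <= n%:R ->
  `|x - \sum_(j < n) (j%:R < x)%R%:R| <= 1.
Proof.
elim: n x => [|n ih] x /andP[x0 xn].
  by rewrite big_ord0 subr0 (le_anti (_ : x <= 0 <= x)) ?normr0// x0 xn.
rewrite big_ord_recr/=; have [xn'|nx] := leP x n%:R.
  by rewrite addr0 ih// x0.
rewrite (eq_bigr (fun=> 1)) => [|i _]; last first.
  by rewrite (lt_trans _ nx)// ltr_nat.
rewrite sumr_const card_ord [true%:R]/=; rewrite -natr1 in xn.
by rewrite ler_norml; lra.
Qed.

Lemma powR_le1 (R : realType) (x p : R) : 0 <= p -> 0 <= x <= 1 -> x `^ p <= 1.
Proof.
move=> p0 /andP[x0 x1]; rewrite -[leRHS](_ : 1 `^ p = 1); last by rewrite powR1.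
by rewrite ge0_ler_powR ?nnegrE.
Qed.

(** * Davydov's covariance inequality *)

Section covariance_inequality.
Context {R : realType} {d : measure_display} {Om : measurableType d}.
Variable P : probability Om R.
Implicit Types X Y : Om -> R.

Definition cov X Y : R := Ex P (fun w => X w * Y w) - Ex P X * Ex P Y.

(* Only half-lines are tested: this is all that the layer-cake argument for the
   covariance inequality needs. *)
Definition level_mixing (a : R) X Y : Prop := forall u v : R,
  `|fine (P ([set w | u < X w] `&` [set w | v < Y w]))
    - fine (P [set w | u < X w]) * fine (P [set w | v < Y w])| <= a.

Lemma measurable_gt (X : Om -> R) (u : R) : measurable_fun [set: Om] X ->
  measurable [set w | u < X w].
Proof.
move=> mX; rewrite -[X in measurable X]setTI.
by have /(_ measurableT [set true]) := measurable_fun_ltr (measurable_cst u) mX; apply.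
Qed.

Lemma ig_bounded X (b : R) : measurable_fun [set: Om] X ->
  (forall w, `|X w| <= b) -> ig P X.
Proof. by move=> mX Xb; apply: ig_le mX (ig_cst _ b) _. Qed.

Lemma Ex_norm_bound X (b : R) : measurable_fun [set: Om] X ->
  (forall w, `|X w| <= b) -> `|Ex P X| <= b.
Proof.
move=> mX Xb; have iX := ig_bounded mX Xb.
rewrite (le_trans (Ex_norm_le iX))// -[leRHS](Ex_cst P); apply: Ex_le => //.
- exact: ig_norm.
- exact: ig_cst.
Qed.

(** A staircase with [n] steps of height 2b/n on [-b, b], built from indicators of upper half-lines,
    the only events that [level_mixing] controls. *)
Let disc (b : R) (n : nat) X (w : Om) : R :=
  (2 * b / n%:R) * \sum_(j < n) \1_[set w | - b + 2 * b / n%:R * j%:R < X w] w - b.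

Let disc_meas b n X : measurable_fun [set: Om] X ->
  measurable_fun [set: Om] (disc b n X).
Proof.
move=> mX; apply: measurable_funB => //; apply: measurable_funM => //.
by apply: measurable_sum => j; apply: measurable_indic; exact: measurable_gt.
Qed.

Let disc_dist (b : R) n X w : 0 < b -> (0 < n)%N -> `|X w| <= b ->
  `|X w - disc b n X w| <= 2 * b / n%:R.
Proof.
move=> b0 n0; rewrite ler_norml => /andP[bX Xb]; rewrite /disc.
have nR : 0 < n%:R :> R by rewrite ltr0n.
have c0 : 0 < 2 * b / n%:R by rewrite divr_gt0// mulr_gt0.
set c := 2 * b / n%:R in c0 *; pose x := (X w + b) / c.
have cn : c * n%:R = 2 * b by rewrite /c divfK// gt_eqF.
have Xe : X w = c * x - b by rewrite /x mulrC divfK ?addrK// gt_eqF.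
have x0 : 0 <= x <= n%:R.
  by rewrite /x divr_ge0 ?(ltW c0)//= ?ler_pdivrMr//; lra.
under eq_bigr => j _.
  rewrite (_ : \1_ _ w = (j%:R < x)%R%:R); last first.
    rewrite indicE; congr (_%:R); congr nat_of_bool.
    rewrite /x ltr_pdivlMr// mulrC.
    by apply/idP/idP => [|h]; [rewrite inE/= => h|rewrite inE/=]; lra.
  over.
rewrite {1}Xe opprB addrA subrK -mulrBr normrM (gtr0_norm c0).
by apply: ler_piMr; [exact: ltW|exact: count_lt_dist].
Qed.

(** By bilinearity the covariance is (2b/n)^2 times a sum of n^2 covariances of half-line events,
    each at most [a] in absolute value, so the bound does not depend on [n]. *)
Let cov_disc (b : R) n X Y (a : R) : 0 <= b -> measurable_fun [set: Om] X ->
  measurable_fun [set: Om] Y -> (0 < n)%N -> level_mixing a X Y ->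
  `|cov (disc b n X) (disc b n Y)| <= 4 * b ^+ 2 * a.
Proof.
move=> b0 mX mY n0 Hm; have nR : 0 < n%:R :> R by rewrite ltr0n.
pose c := 2 * b / n%:R; have c0 : 0 <= c by rewrite divr_ge0// mulr_ge0.
pose A (Z : Om -> R) (j : 'I_n) := [set w | - b + c * j%:R < Z w].
pose S (Z : Om -> R) w := \sum_(j < n) (\1_(A Z j) w : R).
have mA (Z : Om -> R) j : measurable_fun [set: Om] Z -> measurable (A Z j).
  by move=> mZ; exact: measurable_gt.
have iS (Z : Om -> R) : measurable_fun [set: Om] Z -> ig P (S Z).
  by move=> mZ; apply: ig_sum => j; apply: ig_indic; exact: mA.
have ES (Z : Om -> R) : measurable_fun [set: Om] Z ->
    Ex P (S Z) = \sum_(j < n) fine (P (A Z j)).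
  move=> mZ; rewrite Ex_sum; last by move=> j; apply: ig_indic; exact: mA.
  by apply: eq_bigr => j _; rewrite Ex_indic//; exact: mA.
have SSE w : S X w * S Y w = \sum_(i < n) \sum_(j < n) \1_(A X i `&` A Y j) w.
  rewrite /S mulr_suml; apply: eq_bigr => i _; rewrite mulr_sumr.
  by apply: eq_bigr => j _; rewrite indicI.
have mAA i j : measurable (A X i `&` A Y j).
  by apply: measurableI; exact: mA.
have iSS : ig P (fun w => S X w * S Y w).
  under [X in ig _ X]funext do rewrite SSE.
  by apply: ig_sum => i; apply: ig_sum => j; exact: ig_indic.
have ESS : Ex P (fun w => S X w * S Y w) =
    \sum_(i < n) \sum_(j < n) fine (P (A X i `&` A Y j)).
  rewrite (eq_Ex P SSE) Ex_sum; last by move=> i; apply: ig_sum => j; exact: ig_indic.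
  apply: eq_bigr => i _; rewrite Ex_sum; last by move=> j; exact: ig_indic.
  by apply: eq_bigr => j _; rewrite Ex_indic.
have Edisc (Z : Om -> R) : measurable_fun [set: Om] Z -> Ex P (disc b n Z) = c * Ex P (S Z) - b.
  move=> mZ; rewrite ExB ?ExZ ?Ex_cst//; [exact: iS|exact/igZ/iS|exact: ig_cst].
have -> : cov (disc b n X) (disc b n Y) =
    c ^+ 2 * (Ex P (fun w => S X w * S Y w) - Ex P (S X) * Ex P (S Y)).
  rewrite /cov !Edisc// (@eq_Ex _ _ _ P _ (fun w => c ^+ 2 * (S X w * S Y w)
    - c * b * S X w - c * b * S Y w + b ^+ 2)); last first.
    by move=> w; rewrite /disc -/c -/(S X w) -/(S Y w); ring.
  have iX := iS _ mX; have iY := iS _ mY.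
  rewrite ExD ?ExB ?ExZ ?Ex_cst//; first by ring.
  all: solve_ig.

rewrite ESS !ES// mulr_suml -sumrB normrM ger0_norm ?sqr_ge0//.
have -> : 4 * b ^+ 2 * a = c ^+ 2 * (n%:R ^+ 2 * a).
  by rewrite /c; field; rewrite gt_eqF.
rewrite ler_wpM2l ?sqr_ge0//.
rewrite (le_trans (ler_norm_sum _ _ _))//.
have -> : n%:R ^+ 2 * a = \sum_(i < n) \sum_(j < n) a.
  under eq_bigr do rewrite sumr_const card_ord.
  by rewrite sumr_const card_ord -mulr_natl -[a *+ n]mulr_natl; ring.
apply: ler_sum => i _; rewrite mulr_sumr -sumrB (le_trans (ler_norm_sum _ _ _))//.
by apply: ler_sum => j _; exact: Hm.
Qed.

Lemma cov_bounded (b : R) X Y (a : R) : 0 < b -> measurable_fun [set: Om] X ->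
  measurable_fun [set: Om] Y -> level_mixing a X Y ->
  (forall w, `|X w| <= b) -> (forall w, `|Y w| <= b) ->
  `|cov X Y| <= 4 * b ^+ 2 * a.
Proof.
move=> b0 mX mY Hm Xb Yb; apply/ler_addgt0Pr => e e0.
(* The discretisation errors add up to 8bh = 16b^2/n, with mesh h = 2b/n. *)
pose n := (Num.truncn (16 * b ^+ 2 / e)).+1.
have n1 : (0 < n)%N by [].
have nR : 1 <= n%:R :> R by rewrite ler1n.
have nR0 : 0 < n%:R :> R by rewrite ltr0n.
have en : 16 * b ^+ 2 / n%:R <= e.
  by rewrite ler_pdivrMr// [e * _]mulrC -ler_pdivrMr// ltW// truncnS_gt.
set X' := disc b n X; set Y' := disc b n Y.
have mX' : measurable_fun [set: Om] X' by exact: disc_meas.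
have mY' : measurable_fun [set: Om] Y' by exact: disc_meas.
pose h := 2 * b / n%:R; have h0 : 0 <= h by rewrite divr_ge0 ?ltW// mulr_gt0.
have hb : h <= 2 * b by rewrite /h ler_pdivrMr// ler_peMr// mulr_ge0// ltW.
have dX w : `|X w - X' w| <= h by exact: disc_dist.
have dY w : `|Y w - Y' w| <= h by exact: disc_dist.
have Y'b w : `|Y' w| <= 3 * b.
  rewrite -[Y' w](subKr (Y w)) (le_trans (ler_normB _ _))//.
  by move: (dY w) (Yb w) hb => *; lra.
have X'b w : `|X' w| <= 3 * b.
  rewrite -[X' w](subKr (X w)) (le_trans (ler_normB _ _))//.
  by move: (dX w) (Xb w) hb => *; lra.
(* Telescoping as x(y - y') + (x - x')y' costs at most bh + 3bh. *)
have step (x x' y y' : R) : `|x| <= b -> `|x - x'| <= h -> `|y - y'| <= h ->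
    `|y'| <= 3 * b -> `|x * y - x' * y'| <= 4 * b * h.
  move=> xb xx yy yb; rewrite (_ : x * y - x' * y' = x * (y - y') + (x - x') * y'); last by ring.
  rewrite (le_trans (ler_normD _ _))// !normrM.
  have := ler_pM (normr_ge0 _) (normr_ge0 _) xb yy.
  have := ler_pM (normr_ge0 _) (normr_ge0 _) xx yb.
  by lra.
have iX := ig_bounded mX Xb; have iY := ig_bounded mY Yb.
have iX' := ig_bounded mX' X'b; have iY' := ig_bounded mY' Y'b.
have mXY := measurable_funM mX mY; have mXY' := measurable_funM mX' mY'.
have iXY : ig P (fun w => X w * Y w).
  by apply: (@ig_bounded _ (b * b)) => // w; rewrite normrM ler_pM.
have iXY' : ig P (fun w => X' w * Y' w).
  by apply: (@ig_bounded _ (3 * b * (3 * b))) => // w; rewrite normrM ler_pM.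
have E1 : `|Ex P (fun w => X w * Y w) - Ex P (fun w => X' w * Y' w)| <= 4 * b * h.
  rewrite -ExB//; apply: Ex_norm_bound; first exact: measurable_funB.
  by move=> w; exact: step.
have E2 : `|Ex P X * Ex P Y - Ex P X' * Ex P Y'| <= 4 * b * h.
  apply: step.
  - exact: Ex_norm_bound.
  - by rewrite -ExB//; apply: Ex_norm_bound => //; exact: measurable_funB.
  - by rewrite -ExB//; apply: Ex_norm_bound => //; exact: measurable_funB.
  - exact: Ex_norm_bound.
have E3 := cov_disc (ltW b0) mX mY n1 Hm.
have -> : cov X Y = cov X' Y' + ((Ex P (fun w => X w * Y w) - Ex P (fun w => X' w * Y' w))
   - (Ex P X * Ex P Y - Ex P X' * Ex P Y')) by rewrite /cov; ring.
rewrite (le_trans (ler_normD _ _))//.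
have := ler_normB (Ex P (fun w => X w * Y w) - Ex P (fun w => X' w * Y' w))
  (Ex P X * Ex P Y - Ex P X' * Ex P Y').
have : 4 * b * h + 4 * b * h = 16 * b ^+ 2 / n%:R by rewrite /h; field; rewrite gt_eqF.
rewrite -/X' -/Y' in E3.
by lra.
Qed.

Definition clamp (a x : R) : R := Num.max (- a) (Num.min x a).

Lemma clamp_bound (a x : R) : 0 <= a -> `|clamp a x| <= a.
Proof.
move=> a0; rewrite /clamp ler_norml le_max lexx/= ge_max ge_min lexx orbT andbT.
by rewrite lerNl (le_trans _ a0)// oppr_le0.
Qed.

Lemma sub_clamp_le (a x : R) : 0 <= a ->
  `|x - clamp a x| <= `|x| /\ (`|x - clamp a x| != 0 -> a < `|x|).
Proof.
move=> a0; rewrite /clamp /Num.max /Num.min.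
have [xa|ax] := ltP x a.
  have [|x1] := ltP (- a) x; first by rewrite subrr normr0 eqxx.
  rewrite opprK; have xN : x <= 0 by lra.
  rewrite (ler0_norm xN) ler0_norm; last by lra.
  split; first lra.
  by rewrite oppr_eq0 addr_eq0 => h; rewrite lt_neqAle lerNr x1 andbT; apply: contra h => /eqP ->; rewrite opprK.
have x0 : 0 <= x by lra.
have aa : (if - a < a then a else - a) = a by case: ltP => // ?; lra.
rewrite aa (ger0_norm x0) ger0_norm; last by lra.
split; first lra.
by rewrite subr_eq0 => xa; rewrite lt_neqAle ax eq_sym xa.
Qed.

(** A half-line event of the clamped variable is the whole space, the empty set or a half-line event
    of [X]. *)
Lemma level_mixing_clamp a b X Y : 0 <= a -> measurable_fun [set: Om] Y ->
  level_mixing a X Y -> level_mixing a (fun w => clamp b (X w)) Y.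
Proof.
move=> a0 mY Hm u v.
have [ub|bu] := ltP u (- b).
  rewrite (_ : [set w | u < clamp b (X w)] = setT); last first.
    by apply/seteqP; split=> // w _ /=; rewrite /clamp lt_max ub.
  by rewrite setTI probability_setT/= mul1r subrr normr0.
have [bu'|ub] := leP b u.
  rewrite (_ : [set w | u < clamp b (X w)] = set0); last first.
    apply/seteqP; split=> // w /=; rewrite /clamp lt_max lt_min !ltNge bu bu'.
    by rewrite andbF.
  by rewrite set0I measure0/= mul0r subrr normr0.
rewrite (_ : [set w | u < clamp b (X w)] = [set w | u < X w])//.
by apply/seteqP; split=> w /=; rewrite /clamp lt_max lt_min ub andbT ltNge bu.
Qed.

Lemma level_mixingC a X Y : level_mixing a X Y -> level_mixing a Y X.
Proof. by move=> Hm u v; rewrite setIC [X in _ - X]mulrC. Qed.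

Lemma measurable_clamp a X : measurable_fun [set: Om] X ->
  measurable_fun [set: Om] (fun w => clamp a (X w)).
Proof.
by move=> mX; apply: measurable_maxr => //; exact: measurable_minr.
Qed.

(* Davydov's inequality: truncate at level [al `^ (- g^-1)] and bound the
   covariance of the truncated variables by discretising their level sets. *)
Lemma cov_moment_pos (g A al : R) X Y : 2 < g -> 0 <= A -> 0 < al <= 1 ->
  measurable_fun [set: Om] X -> measurable_fun [set: Om] Y ->
  level_mixing al X Y ->
  ig P (fun w => `|X w| `^ g) -> ig P (fun w => `|Y w| `^ g) ->
  Ex P (fun w => `|X w| `^ g) <= A -> Ex P (fun w => `|Y w| `^ g) <= A ->
  `|cov X Y| <= (4 + 6 * A + A ^+ 2) * al `^ (1 - 2 / g).
Proof.
move=> g2 A0 /andP[al0 al1] mX mY Hm iXg iYg XA YA.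
have g0 : 0 < g by lra.
pose a := al `^ (- g^-1); have a0 : 0 < a by exact: powR_gt0.
(* With this [r], al a^2 = 1/r = al^(1 - 2/g): the bounded parts and the remainders contribute at
   the same order. *)
pose r := a `^ (g - 2); have r0 : 0 < r by exact: powR_gt0.
have a1 : 1 <= a.
  by rewrite /a powRN invf_ge1 ?powR_gt0// powR_le1 ?invr_ge0 ?(ltW g0) ?(ltW al0).
have r1 : 1 <= r by rewrite -(powRr0 a) ler_powR//; lra.
have rE : al `^ (1 - 2 / g) = r^-1.
  rewrite /r /a -powRrM -powRN; congr (_ `^ _); field; lra.
have aE : al * a ^+ 2 = r^-1.
  rewrite -rE -powR_mulrn ?ltW// /a -powRrM -{1}(powRr1 (ltW al0)) -powRD.
    by congr (_ `^ _); field; lra.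
  by rewrite (gt_eqF al0) implybT.
pose cl (Z : Om -> R) w := clamp a (Z w).
pose rs (Z : Om -> R) w := Z w - clamp a (Z w).
have mcl (Z : Om -> R) : measurable_fun [set: Om] Z -> measurable_fun [set: Om] (cl Z).
  exact: measurable_clamp.
have mrs (Z : Om -> R) : measurable_fun [set: Om] Z -> measurable_fun [set: Om] (rs Z).
  by move=> mZ; apply: measurable_funB => //; exact: mcl.
(* Where the remainder is nonzero, |Z| > a, so |Z| is at most |Z|^g / a^(g-1), and a^(g-1) = a r. *)
have rs1 Z w : `|rs Z w| <= (a * r)^-1 * `|Z w| `^ g.
  have [le1 lt1] := sub_clamp_le (Z w) (ltW a0).
  have [->|/lt1 aZ] := eqVneq `|rs Z w| 0.
    by rewrite mulr_ge0 ?powR_ge0// invr_ge0 mulr_ge0// ltW.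
  rewrite -ler_pdivrMl ?invrK; last by rewrite invr_gt0 mulr_gt0.
  have Z0 : 0 < `|Z w| by exact: lt_trans aZ.
  have -> : `|Z w| `^ g = `|Z w| * (`|Z w| * `|Z w| `^ (g - 2)).
    rewrite mulrA -expr2 -powR_mulrn// -powRD; first by congr (_ `^ _); ring.
    by rewrite (gt_eqF Z0) implybT.
  rewrite mulrC ler_pM ?mulr_ge0 ?(ltW a0) ?(ltW r0)//.
  by rewrite ler_pM ?(ltW a0) ?(ltW r0) ?(ltW aZ)// /r ge0_ler_powR ?nnegrE ?subr_ge0 ?(ltW a0) ?(ltW aZ) ?(ltW g2).
have rs2 Z w : `|rs Z w| ^+ 2 <= r^-1 * `|Z w| `^ g.
  have [le1 lt1] := sub_clamp_le (Z w) (ltW a0).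
  have [->|/lt1 aZ] := eqVneq `|rs Z w| 0.
    by rewrite expr0n mulr_ge0 ?powR_ge0// invr_ge0 ltW.
  rewrite -ler_pdivrMl ?invrK; last by rewrite invr_gt0.
  have Z0 : 0 < `|Z w| by exact: lt_trans aZ.
  have -> : `|Z w| `^ g = `|Z w| ^+ 2 * `|Z w| `^ (g - 2).
    rewrite -powR_mulrn// -powRD; first by congr (_ `^ _); ring.
    by rewrite (gt_eqF Z0) implybT.
  rewrite mulrC ler_pM ?sqr_ge0 ?(ltW r0)//.
    by rewrite ler_pXn2r ?nnegrE.
  by rewrite /r ge0_ler_powR ?nnegrE ?subr_ge0 ?(ltW a0) ?(ltW aZ) ?(ltW g2).
have icl (Z : Om -> R) : measurable_fun [set: Om] Z -> ig P (cl Z).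
  by move=> mZ; apply: (@ig_bounded _ a); [exact: mcl|move=> w; exact/clamp_bound/ltW].
have irs (Z : Om -> R) : measurable_fun [set: Om] Z -> ig P (fun w => `|Z w| `^ g) -> ig P (rs Z).
  by move=> mZ iZ; apply: ig_le (mrs _ mZ) (igZ _ iZ) (rs1 Z).
have Ers (Z : Om -> R) : measurable_fun [set: Om] Z -> ig P (fun w => `|Z w| `^ g) ->
    Ex P (fun w => `|Z w| `^ g) <= A -> `|Ex P (rs Z)| <= (a * r)^-1 * A.
  move=> mZ iZ ZA; have iR := irs _ mZ iZ; apply: le_trans (Ex_norm_le iR) _.
  apply: (@le_trans _ _ (Ex P (fun w => (a * r)^-1 * `|Z w| `^ g))).
    by apply: Ex_le => //; [exact: ig_norm|exact: igZ].
  by rewrite ExZ// ler_wpM2l// invr_ge0 mulr_ge0// ltW.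
have clb Z w : `|cl Z w| <= a by exact/clamp_bound/ltW.
have Ecl (Z : Om -> R) : measurable_fun [set: Om] Z -> `|Ex P (cl Z)| <= a.
  by move=> mZ; apply: Ex_norm_bound => //; exact: mcl.
pose D w := X w * Y w - cl X w * cl Y w.
have DE w : D w = rs X w * cl Y w + cl X w * rs Y w + rs X w * rs Y w.
  by rewrite /D /rs /cl; ring.
(* A mixed product pairs a remainder, bounded with the factor 1/(a r), and a clamped variable,
   bounded by [a]. The product of two remainders is split into squares by AM-GM. *)
have Db w : `|D w| <= 2 * (r^-1 * (`|X w| `^ g + `|Y w| `^ g)).
  have q1 : `|rs X w * cl Y w| <= r^-1 * `|X w| `^ g.
    rewrite normrM; apply: le_trans (ler_pM (normr_ge0 _) (normr_ge0 _) (rs1 X w) (clb Y w)) _.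
    by rewrite le_eqVlt; apply/orP; left; apply/eqP; field; rewrite !gt_eqF.
  have q2 : `|cl X w * rs Y w| <= r^-1 * `|Y w| `^ g.
    rewrite normrM; apply: le_trans (ler_pM (normr_ge0 _) (normr_ge0 _) (clb X w) (rs1 Y w)) _.
    by rewrite le_eqVlt; apply/orP; left; apply/eqP; field; rewrite !gt_eqF.
  have q3 : `|rs X w * rs Y w| <= (`|rs X w| ^+ 2 + `|rs Y w| ^+ 2) / 2.
    by rewrite normrM; have := sqr_ge0 (`|rs X w| - `|rs Y w|); lra.
  have := rs2 X w; have := rs2 Y w.
  rewrite DE; have := ler_normD (rs X w * cl Y w + cl X w * rs Y w) (rs X w * rs Y w).
  have := ler_normD (rs X w * cl Y w) (cl X w * rs Y w).
  have : 0 <= `|X w| `^ g by exact: powR_ge0.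
  have : 0 <= `|Y w| `^ g by exact: powR_ge0.
  have : 0 <= r^-1 * `|X w| `^ g by rewrite mulr_ge0 ?powR_ge0// invr_ge0 ltW.
  have : 0 <= r^-1 * `|Y w| `^ g by rewrite mulr_ge0 ?powR_ge0// invr_ge0 ltW.
  by lra.
have iB : ig P (fun w => 2 * (r^-1 * (`|X w| `^ g + `|Y w| `^ g))) by solve_ig.
have mXY := measurable_funM mX mY.
have mcXY := measurable_funM (mcl _ mX) (mcl _ mY).
have iD : ig P D by apply: ig_le iB Db; exact: measurable_funB.
have iclXY : ig P (fun w => cl X w * cl Y w).
  by apply: (@ig_bounded _ (a * a)) => // w; rewrite normrM ler_pM.
have EXY : Ex P (fun w => X w * Y w) = Ex P (fun w => cl X w * cl Y w) + Ex P D.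
  by rewrite -ExD//; apply: eq_Ex => w; rewrite /D; ring.
have ED : `|Ex P D| <= 4 * (r^-1 * A).
  apply: le_trans (Ex_norm_le iD) _; apply: le_trans (Ex_le (ig_norm iD) iB Db) _.
  rewrite ExZ ?ExZ ?ExD//; try by solve_ig.
  have : r^-1 * (Ex P (fun w => `|X w| `^ g) + Ex P (fun w => `|Y w| `^ g)) <= r^-1 * (2 * A).
    by rewrite ler_wpM2l ?invr_ge0 ?(ltW r0)//; lra.
  by lra.
have EZ (Z : Om -> R) : measurable_fun [set: Om] Z -> ig P (fun w => `|Z w| `^ g) ->
    Ex P Z = Ex P (cl Z) + Ex P (rs Z).
  move=> mZ iZ; rewrite -ExD//; [|exact: icl|exact: irs].
  by apply: eq_Ex => w; rewrite /cl /rs; ring.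
have C1 : `|cov (cl X) (cl Y)| <= 4 * r^-1.
  rewrite -aE mulrCA mulrC; apply: cov_bounded => //; [exact: mcl|exact: mcl|].
  apply: level_mixing_clamp => //; [exact: ltW|exact: mcl|].
  apply/level_mixingC/level_mixing_clamp => //; [exact: ltW|exact: level_mixingC].
have -> : cov X Y = cov (cl X) (cl Y) + Ex P D - (Ex P (rs X) * Ex P (cl Y)
   + Ex P (cl X) * Ex P (rs Y) + Ex P (rs X) * Ex P (rs Y)).
  by rewrite /cov EXY (EZ X)// (EZ Y)//; ring.
have arA : a * ((a * r)^-1 * A) = r^-1 * A by field; rewrite !gt_eqF.
have t1 : `|Ex P (rs X) * Ex P (cl Y)| <= r^-1 * A.
  by rewrite normrM mulrC -arA ler_pM ?Ers ?Ecl.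
have t2 : `|Ex P (cl X) * Ex P (rs Y)| <= r^-1 * A.
  by rewrite normrM -arA ler_pM ?Ers ?Ecl.
have t3 : `|Ex P (rs X) * Ex P (rs Y)| <= r^-1 * A ^+ 2.
  apply: (@le_trans _ _ (((a * r)^-1 * A) * ((a * r)^-1 * A))).
    by rewrite normrM ler_pM ?Ers.
  have /andP[i0 i1] : 0 < r^-1 <= 1 by rewrite invr_gt0 r0 invf_le1.
  have /andP[j0 j1] : 0 < a^-1 <= 1 by rewrite invr_gt0 a0 invf_le1.
  have ij : (a * r)^-1 ^+ 2 <= r^-1.
    rewrite invfM exprMn; apply: (@le_trans _ _ (1 * r^-1)); last by rewrite mul1r.
    rewrite ler_pM ?sqr_ge0// ?expr_le1 ?(ltW j0)//.
    by rewrite expr2 ler_piMr// ltW.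
  rewrite (_ : _ * _ = (a * r)^-1 ^+ 2 * A ^+ 2); last by rewrite -exprMn expr2.
  by rewrite ler_wpM2r ?sqr_ge0.
rewrite rE.
have := ler_normB (cov (cl X) (cl Y) + Ex P D) (Ex P (rs X) * Ex P (cl Y)
   + Ex P (cl X) * Ex P (rs Y) + Ex P (rs X) * Ex P (rs Y)).
have := ler_normD (cov (cl X) (cl Y)) (Ex P D).
have := ler_normD (Ex P (rs X) * Ex P (cl Y)
   + Ex P (cl X) * Ex P (rs Y)) (Ex P (rs X) * Ex P (rs Y)).
have := ler_normD (Ex P (rs X) * Ex P (cl Y)) (Ex P (cl X) * Ex P (rs Y)).
have : 0 <= r^-1 * A by rewrite mulr_ge0// invr_ge0 ltW.
by lra.
Qed.

(** A zero coefficient gives no truncation level. Every [e] in (0, 1] is then an admissible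
    coefficient, and a nonzero covariance is refuted by the [e] that makes the bound half of it. *)
Lemma cov_moment (g A al : R) X Y : 2 < g -> 0 <= A -> 0 <= al <= 1 ->
  measurable_fun [set: Om] X -> measurable_fun [set: Om] Y ->
  level_mixing al X Y ->
  ig P (fun w => `|X w| `^ g) -> ig P (fun w => `|Y w| `^ g) ->
  Ex P (fun w => `|X w| `^ g) <= A -> Ex P (fun w => `|Y w| `^ g) <= A ->
  `|cov X Y| <= (4 + 6 * A + A ^+ 2) * al `^ (1 - 2 / g).
Proof.
move=> g2 A0 /andP[al0 al1] mX mY Hm iX iY XA YA.
move: al0; rewrite le_eqVlt => /predU1P[al0|al0]; last first.
  by apply: cov_moment_pos => //; rewrite al0.
have th0 : 0 < 1 - 2 / g by rewrite subr_gt0 ltr_pdivrMr ?mul1r//; lra.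
set th := 1 - 2 / g in th0 *; set C := 4 + _ + _.
have C0 : 0 < C by rewrite /C; have := sqr_ge0 A; lra.
have key e : 0 < e <= 1 -> `|cov X Y| <= C * e `^ th.
  move=> e01; apply: cov_moment_pos => // u v.
  by apply: le_trans (Hm u v) _; rewrite -al0; case/andP: e01 => /ltW.
rewrite -al0 powR0 ?gt_eqF// mulr0 leNgt; apply/negP => c0.
have cC : `|cov X Y| <= C by have := key 1; rewrite powR1 mulr1 ltr01 lexx; apply.
pose z := `|cov X Y| / (2 * C).
have z0 : 0 < z by rewrite divr_gt0// mulr_gt0.
have z1 : z <= 1 by rewrite ler_pdivrMr ?mulr_gt0// mul1r; lra.
have := key (z `^ th^-1).
rewrite powR_gt0//= powR_le1 ?(ltW z0)// ?invr_ge0 ?(ltW th0)// => /(_ isT).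
rewrite -powRrM mulVf ?gt_eqF// powRr1 ?(ltW z0)// /z.
rewrite (_ : C * _ = `|cov X Y| / 2); last by field; rewrite gt_eqF.
by lra.
Qed.

End covariance_inequality.

(** * Second moments of sums with summable covariances *)

Section sums_of_lags.
Context {R : realType}.

(** With truncated subtraction, [t - s + (s - t)] is the distance between [t] and [s]; a given
    distance is realised by at most two values of [t]. *)
Lemma sum_lag_le (b : nat -> R) (S : R) : (forall l, 0 <= b l) ->
  (forall k, \sum_(0 <= l < k) b l <= S) ->
  forall n s, \sum_(0 <= t < n) b (t - s + (s - t))%N <= 2 * S.
Proof.
move=> b0 bS n s.
have le1 : \sum_(0 <= t < n) b (t - s + (s - t))%N <=
    \sum_(0 <= t < s + n) b (t - s + (s - t))%N.
  rewrite addnC (@big_cat_nat _ _ _ n 0 (n + s)) ?leq_addr//= lerDl.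
  by apply: sumr_ge0.
apply: le_trans le1 _; rewrite (@big_cat_nat _ _ _ s 0 (s + n)) ?leq_addr//=.
have -> : 2 * S = S + S by ring.
apply: lerD; last first.
  rewrite -{1}[s]add0n big_addn addKn; apply: le_trans (bS n).
  apply: ler_sum => t _; rewrite addnK (_ : (s - (t + s))%N = 0%N) ?addn0//.
  by apply/eqP; rewrite subn_eq0 leq_addl.
rewrite big_nat_rev /= add0n; apply: le_trans (bS s.+1).
rewrite big_nat_recl//= -[leLHS]add0r lerD//.
rewrite !big_mkord; apply: ler_sum => t _.
rewrite (_ : (s - t.+1 - s)%N = 0%N) ?add0n ?subKn//.
by apply/eqP; rewrite subn_eq0 leq_subr.
Qed.

End sums_of_lags.

Section variance_of_sums.
Context {R : realType} {d : measure_display} {Om : measurableType d}.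
Variable P : probability Om R.

Lemma Ex_sqr_sum (Z : nat -> Om -> R) (b : nat -> R) (S : R) n :
  (forall s t, ig P (fun w => Z s w * Z t w)) ->
  (forall s t, (s <= t)%N -> `|Ex P (fun w => Z s w * Z t w)| <= b (t - s)%N) ->
  (forall l, 0 <= b l) -> (forall k, \sum_(0 <= l < k) b l <= S) ->
  Ex P (fun w => (\sum_(0 <= t < n) Z t w) ^+ 2) <= 2 * S * n%:R.
Proof.
move=> iZ Zb b0 bS.
rewrite (@eq_Ex _ _ _ P _ (fun w => \sum_(0 <= s < n) \sum_(0 <= t < n) Z s w * Z t w)); last first.
  move=> w; rewrite expr2 mulr_suml; apply: eq_bigr => s _.
  by rewrite mulr_sumr.
rewrite Ex_sum; last by move=> s; apply: ig_sum.
have -> : 2 * S * n%:R = \sum_(0 <= s < n) (2 * S).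
  by rewrite sumr_const_nat subn0 mulr_natr.
apply: ler_sum => s _; rewrite Ex_sum//; apply: le_trans (sum_lag_le b0 bS n s).
apply: ler_sum => t _; apply: le_trans (ler_norm _) _.
have [st|/ltnW ts] := leqP s t.
  rewrite (_ : (s - t)%N = 0%N) ?addn0 ?Zb//; by apply/eqP; rewrite subn_eq0.
rewrite (_ : (t - s)%N = 0%N) ?add0n//; last by apply/eqP; rewrite subn_eq0.
by under eq_Ex do rewrite mulrC; exact: Zb.
Qed.

End variance_of_sums.

(** * Random matrices and mixing *)

Section random_matrices.
Context {R : realType} {d : measure_display} {Om : measurableType d}.

Lemma measurable_forall_fin (I : finType) (A : I -> set Om) :
  (forall i, measurable (A i)) -> measurable [set w | forall i, A i w].
Proof.
move=> mA; rewrite (_ : [set w | _] = \bigcap_(i in [set: I]) A i).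
  by apply: fin_bigcap_measurable.
by apply/seteqP; split=> w /= Aw i; [move=> _; exact: Aw|exact: Aw].
Qed.

Lemma measurable_exists_fin (I : finType) (A : I -> set Om) :
  (forall i, measurable (A i)) -> measurable [set w | exists i, A i w].
Proof.
move=> mA; rewrite (_ : [set w | _] = \bigcup_(i in [set: I]) A i).
  by apply: fin_bigcup_measurable.
by apply/seteqP; split=> w /= [i]; [exists i|move=> _; exists i].
Qed.

Lemma measurable_lt (X : Om -> R) (u : R) : measurable_fun [set: Om] X ->
  measurable [set w | X w < u].
Proof.
move=> mX; rewrite -[X in measurable X]setTI.
by have /(_ measurableT [set true]) := measurable_fun_ltr mX (measurable_cst u); apply.
Qed.

(* An open set is a countable union of boxes with rational data. *)
Lemma random_mx_measurable m n (X : Om -> 'M[R]_(m, n)) : random_mx X ->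
  measurable_fun [set: Om] (X : Om -> borel_mx m n).
Proof.
move=> mX; apply: (@measurability _ _ Om (borel_mx m n) _ _ (@open 'M[R]_(m, n))) => //.
move=> _ [U oU <-]; rewrite setTI.
pose B (q : 'M[rat]_(m, n) * nat) := [set x : 'M[R]_(m, n) |
  forall ij : 'I_m * 'I_n, `|x ij.1 ij.2 - ratr (q.1 ij.1 ij.2)| < q.2.+1%:R^-1].
pose F q := if `[< B q `<=` U >] then X @^-1` B q else set0.
rewrite (_ : _ @^-1` _ = \bigcup_q F q); last first.
  apply/seteqP; split=> w /=; last first.
    by move=> [q _]; rewrite /F; case: asboolP => // BU; exact: BU.
  move=> Uw; have /nbhs_ballP[e /= e0 eU] : nbhs (X w) U by exact: open_nbhs_nbhs.
  pose k := Num.truncn (2 / e).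
  have k0 : 0 < k.+1%:R^-1 :> R by rewrite invr_gt0.
  have ke : k.+1%:R^-1 < e / 2.
    rewrite -[e / 2]invrK ltf_pV2 ?posrE ?invr_gt0 ?divr_gt0//.
    by rewrite invf_div truncnS_gt.
  have /choice[q qP] : forall ij : 'I_m * 'I_n,
      exists q : rat, `|X w ij.1 ij.2 - ratr q| < k.+1%:R^-1.
    move=> ij; have /rat_in_itvoo[q] : X w ij.1 ij.2 - k.+1%:R^-1 < X w ij.1 ij.2 + k.+1%:R^-1.
      by rewrite ltrBlDr -addrA ltrDl addr_gt0.
    rewrite in_itv/= => /andP[q1 q2]; exists q; rewrite ltr_norml.
    by move: (k.+1%:R^-1) (ratr q) q1 q2 => c z q1 q2; apply/andP; split; lra.
  exists (\matrix_(i, j) q (i, j), k) => //; rewrite /F.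
  have sBU : B (\matrix_(i, j) q (i, j), k) `<=` U.
    move=> x Bx; apply: eU; split=> // i j.
    rewrite /ball/= -(subrK (ratr (q (i, j))) (X w i j)) -addrA.
    rewrite (le_lt_trans (ler_normD _ _))//.
    have := qP (i, j); have /= := Bx (i, j); rewrite mxE [`|x i j - _|]distrC.
    by move: (k.+1%:R^-1) ke => c ke h1 h2; lra.
  case: asboolP => // _ ij /=; rewrite mxE; exact: (qP (ij.1, ij.2)).
apply: countable_bigcupT_measurable => // q; rewrite /F; case: ifP => _ //.
apply: measurable_forall_fin => ij; apply: measurable_lt.
apply: measurableT_comp => //; apply: measurable_funB => //; exact: mX.
Qed.

Lemma random_mx_preimage m n (X : Om -> 'M[R]_(m, n)) (A : set (borel_mx m n)) :
  random_mx X -> measurable A -> measurable (X @^-1` A).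
Proof.
by move=> /random_mx_measurable mX mA; rewrite -[X in measurable X]setTI; exact: mX.
Qed.

Lemma continuous_borel_measurable m n (h : 'M[R]_(m, n) -> R) : continuous h ->
  measurable_fun [set: borel_mx m n] (h : borel_mx m n -> R).
Proof.
move=> ch; apply: (measurability _ (RGenOpens.measurableE R)).
move=> _ [_ [a [b ->] <-]]; rewrite setTI.
apply: sub_sigma_algebra => /=.
by apply: open_comp => // x _; exact: ch.
Qed.

End random_matrices.

Lemma coord_mx_continuous (R : realType) m n (i : 'I_m) (j : 'I_n) :
  continuous (fun x : 'M[R]_(m, n) => x i j).
Proof. exact: coord_continuous. Qed.

Lemma continuousD_fun (R : realType) (T : topologicalType) (f g : T -> R) :
  continuous f -> continuous g -> continuous (fun x => f x + g x).
Proof. by move=> cf cg x; apply: cvgD; [exact: cf|exact: cg]. Qed.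

Lemma continuousM_fun (R : realType) (T : topologicalType) (f g : T -> R) :
  continuous f -> continuous g -> continuous (fun x => f x * g x).
Proof. by move=> cf cg x; apply: cvgM; [exact: cf|exact: cg]. Qed.

Lemma continuous_sum_fun (R : realType) (T : topologicalType) I (s : seq I)
    (F : I -> T -> R) :
  (forall i, continuous (F i)) -> continuous (fun x => \sum_(i <- s) F i x).
Proof.
move=> cF; elim: s => [|i s ih].
  by under [X in continuous X]funext do rewrite big_nil; move=> x; exact: cvg_cst.
by under [X in continuous X]funext do rewrite big_cons; exact: continuousD_fun.
Qed.

Section stationary_mixing_process.
Context {R : realType} {d : measure_display} {Om : measurableType d}.
Variable P : probability Om R.

Lemma Ex_eq_distr (X Y : Om -> R) : ig P X -> ig P Y ->
  (forall B : set R, measurable B -> P (X @^-1` B) = P (Y @^-1` B)) ->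
  Ex P X = Ex P Y.
Proof.
move=> iX iY XY.
have h (Z : Om -> R) : ig P Z -> exists2 Z' : {mfun Om >-> R},
    Z' = Z :> (Om -> R) & 'E_P[Z]%E = (\int[distribution P Z']_y y%:E)%E.
  move=> iZ; exists (mfun_Sub (mem_set (ig_meas iZ))); first exact: mfun_valP.
  by rewrite unlock integral_distribution//; exact: EFin_measurable.
have [X' XE EX] := h _ iX; have [Y' YE EY] := h _ iY.
rewrite /Ex EX EY; congr fine; apply: eq_measure_integral => B mB _.
have : P (X' @^-1` B) = P (Y' @^-1` B) by rewrite XE YE; exact: XY.
by [].
Qed.

Variable n : nat.
Implicit Types (a b : 'cV[R]_n) (J : int -> Om -> 'cV[R]_n).

Definition lin a J (t : int) (w : Om) : R := \sum_(i < n) a i 0 * J t w i 0.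

Lemma lin_meas a J t : random_mx (J t) -> measurable_fun [set: Om] (lin a J t).
Proof. by move=> mJ; apply: measurable_sum => i; apply: measurable_funM. Qed.

(** The product is a continuous function of a two-column [stack], so preimages of Borel sets are
    Borel sets of matrices, to which stationarity applies with shift [t]. *)
Lemma Ex_lin_stationary J a b (k : int) t : (forall t, random_mx (J t)) ->
  strictly_stationary P J ->
  (forall t, ig P (fun w => lin a J t w * lin b J (t - k) w)) ->
  Ex P (fun w => lin a J t w * lin b J (t - k) w) =
  Ex P (fun w => lin a J 0 w * lin b J (- k) w).
Proof.
move=> mJ sJ iJ; apply: Ex_eq_distr; first exact: iJ.
  by have := iJ 0; rewrite sub0r.
move=> B mB.
pose ts (i : 'I_2) : int := if i == ord0 then 0 else - k.
pose h (x : 'M[R]_(n, 2)) : R :=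
  (\sum_(i < n) a i 0 * x i ord0) * (\sum_(i < n) b i 0 * x i ord_max).
have ch : continuous h.
  by apply: continuousM_fun; apply: continuous_sum_fun => i; apply: continuousM_fun;
    first [exact: cst_continuous|exact: coord_mx_continuous].
have mhB : measurable (h @^-1` B : set (borel_mx n 2)).
  by have := continuous_borel_measurable ch measurableT mB; rewrite setTI.
have hE (ts' : 'I_2 -> int) w :
    h (stack J ts' w) = lin a J (ts' ord0) w * lin b J (ts' ord_max) w.
  by rewrite /h /lin; congr (_ * _); apply: eq_bigr => i _; rewrite mxE.
have pE (ts' : 'I_2 -> int) : stack J ts' @^-1` (h @^-1` B) =
    [set w | B (lin a J (ts' ord0) w * lin b J (ts' ord_max) w)].
  by apply/seteqP; split=> w; rewrite /preimage /= hE.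
by have := sJ 2%N ts t _ mhB; rewrite !pE /= add0r [- k + t]addrC => ->.
Qed.

Let gen J (D : set int) : set (set Om) := [set E | exists2 t, D t &
  exists2 A : set (borel_mx n 1), measurable A & E = J t @^-1` A].

(** Taking the generated sigma-field as the measurable structure of the sample space turns
    membership in it into measurability of a product of linear forms. *)
Lemma sigma_field_lin_mul J (D : set int) a b s t (u : R) : D s -> D t ->
  sigma_field J D [set w | u < lin a J s w * lin b J t w].
Proof.
move=> Ds Dt.
have key c r : D r ->
    measurable_fun [set: g_sigma_algebraType (gen J D)]
      (lin c J r : g_sigma_algebraType (gen J D) -> R).
  move=> Dr; apply: measurable_sum => i; apply: measurable_funM => //.
  move=> _ B mB; rewrite setTI; apply: sub_sigma_algebra; exists r => //.
  exists ((fun x : 'cV[R]_n => x i 0) @^-1` B) => //.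
  by have := continuous_borel_measurable (@coord_mx_continuous R n 1 i 0) measurableT mB;
    rewrite setTI.
have := measurable_gt u (measurable_funM (key a s Ds) (key b t Dt)).
by [].
Qed.

Lemma sigma_field_measurable J (D : set int) A : (forall t, random_mx (J t)) ->
  sigma_field J D A -> measurable A.
Proof.
move=> mJ; apply: smallest_sub; first exact: sigma_algebra_measurable.
by move=> _ [t _ [B mB ->]]; exact: random_mx_preimage.
Qed.

Lemma alpha_coef_ge0 J k : (0 <= alpha_coef P J k)%E.
Proof.
apply: (@le_trans _ _ `| P (set0 `&` set0) - P set0 * P set0 |%E) => //.
apply: ereal_sup_ubound; exists 0, set0, set0; split => //; exact: sigma_algebra0.
Qed.

Lemma alpha_coef_le1 J k : (forall t, random_mx (J t)) -> (alpha_coef P J k <= 1)%E.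
Proof.
move=> mJ; apply: ge_ereal_sup => _ [i [A [B [sA sB ->]]]].
have mA := sigma_field_measurable mJ sA; have mB := sigma_field_measurable mJ sB.
have mAB := measurableI _ _ mA mB.
have b01 C : measurable C -> exists2 p : R, P C = p%:E & 0 <= p <= 1.
  move=> mC; exists (fine (P C)); first by rewrite fineK ?fin_num_measure.
  by rewrite fine_ge0//= -lee_fin fineK ?fin_num_measure// probability_le1.
have [p -> p01] := b01 _ mA; have [q -> q01] := b01 _ mB; have [r -> r01] := b01 _ mAB.
rewrite -EFinM -EFinB /= lee_fin ler_norml; move: p01 q01 r01.
by move=> /andP[? ?] /andP[? ?] /andP[? ?]; apply/andP; split; nra.
Qed.

Definition alphaR J k : R := fine (alpha_coef P J k).

Lemma alphaRE J k : (forall t, random_mx (J t)) -> alpha_coef P J k = (alphaR J k)%:E.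
Proof.
move=> mJ; rewrite /alphaR fineK// ge0_fin_numE ?alpha_coef_ge0//.
exact: le_lt_trans (alpha_coef_le1 k mJ) (ltry _).
Qed.

Lemma alphaR01 J k : (forall t, random_mx (J t)) -> 0 <= alphaR J k <= 1.
Proof. by move=> mJ; rewrite -!lee_fin -alphaRE// alpha_coef_ge0 alpha_coef_le1. Qed.

(** The first product uses times up to [s], the second times from [s + l] on: its own lag takes back
    the [k] in [l + k]. *)
Lemma level_mixing_lin J a b (k l : nat) (s : int) : (forall t, random_mx (J t)) ->
  level_mixing P (alphaR J l)
    (fun w => lin a J s w * lin b J (s - k%:Z) w)
    (fun w => lin a J (s + (l + k)%:Z) w * lin b J (s + (l + k)%:Z - k%:Z) w).
Proof.
move=> mJ u v.
set A := [set w | u < _]; set B := [set w | v < _].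
have sA : sigma_field J [set t | (t <= s)%R] A.
  by apply: sigma_field_lin_mul => //=; rewrite lerBlDr lerDl.
have sB : sigma_field J [set t | (s + l%:Z <= t)%R] B.
  apply: sigma_field_lin_mul => /=; first by rewrite lerD2l lez_nat leq_addr.
  by rewrite PoszD addrA addrK.
have mA := sigma_field_measurable mJ sA; have mB := sigma_field_measurable mJ sB.
have mAB := measurableI _ _ mA mB.
rewrite -lee_fin -(alphaRE l mJ).
apply: (@le_trans _ _ `| P (A `&` B) - P A * P B |%E); last first.
  by apply: ereal_sup_ubound; exists s, A, B.
by rewrite -{2}[P A]fineK ?fin_num_measure// -{2}[P B]fineK ?fin_num_measure//
  -{2}[P (A `&` B)]fineK ?fin_num_measure.
Qed.

End stationary_mixing_process.

(** * Mean square error of lagged averages *)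

Section second_moments.
Context {R : realType} {d : measure_display} {Om : measurableType d}.
Variable P : probability Om R.

Lemma ig_mul_sqr (X Y : Om -> R) : measurable_fun [set: Om] X ->
  measurable_fun [set: Om] Y -> ig P (fun w => X w ^+ 2) ->
  ig P (fun w => Y w ^+ 2) -> ig P (fun w => X w * Y w).
Proof.
move=> mX mY iX iY; apply: (@ig_le _ _ _ _ _ (fun w => X w ^+ 2 + Y w ^+ 2)).
- exact: measurable_funM.
- exact: igD.
- move=> w; rewrite ler_norml.
  have := sqr_ge0 (X w - Y w); have := sqr_ge0 (X w + Y w).
  by have := sqr_ge0 (X w); have := sqr_ge0 (Y w); lra.
Qed.

Lemma ig_of_sqr (X : Om -> R) : measurable_fun [set: Om] X ->
  ig P (fun w => X w ^+ 2) -> ig P X.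
Proof.
move=> mX iX; apply: (@ig_le _ _ _ _ _ (fun w => 1 + X w ^+ 2)) => //.
  by apply: igD => //; exact: ig_cst.
move=> w; rewrite ler_norml.
by have := sqr_ge0 (X w - 1); have := sqr_ge0 (X w + 1); lra.
Qed.

Lemma powR_mul_le (x y g : R) : 0 <= g ->
  `|x * y| `^ g <= `|x| `^ (2 * g) + `|y| `^ (2 * g).
Proof.
move=> g0; rewrite normrM powRM// !(mulrC 2 g) !powRrM.
rewrite !(@powR_mulrn _ _ 2%N) ?powR_ge0//.
set p := _ `^ _; set q := _ `^ _.
by have := sqr_ge0 (p - q); have := sqr_ge0 p; have := sqr_ge0 q; lra.
Qed.

Lemma expr_le_powR (x g : R) (k : nat) : k%:R <= g -> `|x| ^+ k <= 1 + `|x| `^ g.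
Proof.
move=> kg; have [x1|x1] := leP `|x| 1.
  by rewrite (@le_trans _ _ 1) ?exprn_ile1 ?lerDl ?powR_ge0.
rewrite (@le_trans _ _ (`|x| `^ g)) ?lerDr// -powR_mulrn//.
by rewrite ler_powR// ltW.
Qed.

Lemma ig_powR_mul (X Y : Om -> R) (g : R) : 0 <= g ->
  measurable_fun [set: Om] X -> measurable_fun [set: Om] Y ->
  ig P (fun w => `|X w| `^ (2 * g)) -> ig P (fun w => `|Y w| `^ (2 * g)) ->
  ig P (fun w => `|X w * Y w| `^ g).
Proof.
move=> g0 mX mY iX iY.
apply: (@ig_le _ _ _ _ _ (fun w => `|X w| `^ (2 * g) + `|Y w| `^ (2 * g))).
- apply: (measurableT_comp (measurable_powR g)).
  by apply: (measurableT_comp (@normr_measurable _ setT)); exact: measurable_funM.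
- exact: igD.
- by move=> w; rewrite ger0_norm ?powR_ge0// powR_mul_le.
Qed.

Lemma ig_sqr_powR (X : Om -> R) (g : R) : 2 <= g -> measurable_fun [set: Om] X ->
  ig P (fun w => `|X w| `^ g) ->
  ig P (fun w => X w ^+ 2) /\
  Ex P (fun w => X w ^+ 2) <= 1 + Ex P (fun w => `|X w| `^ g).
Proof.
move=> g2 mX iX; have h w : X w ^+ 2 <= 1 + `|X w| `^ g.
  by rewrite -real_normK ?num_real// expr_le_powR.
have iR : ig P (fun w => 1 + `|X w| `^ g) by solve_ig.
have i2 : ig P (fun w => X w ^+ 2).
  apply: ig_le iR _; first exact: measurable_funX.
  by move=> w; rewrite ger0_norm ?sqr_ge0.
split=> //; rewrite -{1}(Ex_cst P 1) -ExD//; last exact: ig_cst.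
exact: Ex_le.
Qed.

Lemma Ex_mul_le (X Y : Om -> R) (A : R) : measurable_fun [set: Om] X ->
  measurable_fun [set: Om] Y -> ig P (fun w => X w ^+ 2) ->
  ig P (fun w => Y w ^+ 2) -> Ex P (fun w => X w ^+ 2) <= A ->
  Ex P (fun w => Y w ^+ 2) <= A -> `|Ex P (fun w => X w * Y w)| <= A.
Proof.
move=> mX mY iX iY XA YA; have iXY := ig_mul_sqr mX mY iX iY.
apply: le_trans (Ex_norm_le iXY) _.
have iB : ig P (fun w => 2^-1 * (X w ^+ 2 + Y w ^+ 2)) by solve_ig.
apply: (@le_trans _ _ (Ex P (fun w => 2^-1 * (X w ^+ 2 + Y w ^+ 2)))).
  apply: Ex_le => //; first exact: ig_norm.
  move=> w; rewrite ler_norml.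
  by have := sqr_ge0 (X w - Y w); have := sqr_ge0 (X w + Y w); lra.
by rewrite ExZ ?ExD//; [lra|exact: igD].
Qed.

End second_moments.

Section lagged_products.
Context {R : realType} {d : measure_display} {Om : measurableType d}.
Variable P : probability Om R.
Variables (n : nat) (J : int -> Om -> 'cV[R]_n) (g A S : R) (k : nat).
Variables a b : 'cV[R]_n.
Hypothesis g2 : 2 < g.
Hypothesis A0 : 0 <= A.
Hypothesis mJ : forall t, random_mx (J t).
Hypothesis sJ : strictly_stationary P J.
Hypothesis mixJ : forall l, \sum_(0 <= i < l) alphaR P J i.+1 `^ (1 - 2 / g) <= S.
Hypothesis mom : forall c, c = a \/ c = b -> forall t,
  ig P (fun w => `|lin c J t w| `^ (2 * g)) /\
  Ex P (fun w => `|lin c J t w| `^ (2 * g)) <= A.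

Let X (t : int) w := lin a J t w * lin b J (t - k%:Z) w.

(** Total covariance over all lags. At the [k + 1] lags up to [k] the two products overlap in time
    and only second moments are used; beyond, Davydov's inequality with moments at most 2A is summed
    against the mixing bound [S]. *)
Definition lag_cst : R :=
  k.+1%:R * ((1 + 2 * A) + (1 + 2 * A) ^+ 2) + (4 + 6 * (2 * A) + (2 * A) ^+ 2) * S.

Lemma lag_measurable t : measurable_fun [set: Om] (X t).
Proof. by apply: measurable_funM; exact: lin_meas. Qed.

Let moma t := mom (or_introl erefl) t.
Let momb t := mom (or_intror erefl) t.

Let X_g t : ig P (fun w => `|X t w| `^ g) /\ Ex P (fun w => `|X t w| `^ g) <= 2 * A.
Proof.
have [ia Ea] := moma t; have [ib Eb] := momb (t - k%:Z).
have g0 : 0 <= g by apply: ltW; apply: lt_trans g2.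
have iX : ig P (fun w => `|X t w| `^ g) by apply: ig_powR_mul => //; exact: lin_meas.
split=> //; apply: (@le_trans _ _ (Ex P (fun w => `|lin a J t w| `^ (2 * g)
    + `|lin b J (t - k%:Z) w| `^ (2 * g)))).
  by apply: Ex_le => //; [exact: igD|move=> w; exact: powR_mul_le].
by rewrite ExD//; lra.
Qed.

Let X_sqr t : ig P (fun w => X t w ^+ 2) /\ Ex P (fun w => X t w ^+ 2) <= 1 + 2 * A.
Proof.
have [iX EX] := X_g t; have [|i2 E2] := ig_sqr_powR _ (lag_measurable t) iX.
  exact: ltW.
by split=> //; apply: le_trans E2 _; rewrite lerD2l.
Qed.

Lemma ig_lag t : ig P (X t).
Proof. by apply: ig_of_sqr; [exact: lag_measurable|have [] := X_sqr t]. Qed.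

Let mu := Ex P (fun w => lin a J 0 w * lin b J (- k%:Z) w).

Lemma Ex_lag t : Ex P (X t) = mu.
Proof. by apply: Ex_lin_stationary => // s; exact: ig_lag. Qed.

Let mu_sqr : mu ^+ 2 <= (1 + 2 * A) ^+ 2.
Proof.
have mle : `|mu| <= 1 + 2 * A.
  rewrite -(Ex_lag 0) -[X in `|X|](@eq_Ex _ _ _ P (fun w => X 0 w * 1)).
    have [i2 E2] := X_sqr 0; apply: Ex_mul_le => //; first exact: lag_measurable.
    - by under [X in ig _ X]funext do rewrite expr1n; exact: ig_cst.
    - by under eq_Ex do rewrite expr1n; rewrite Ex_cst; move: A0 => A0'; lra.
  by move=> w; rewrite mulr1.
by rewrite -real_normK ?num_real// ler_pXn2r// ?nnegrE//; move: A0 => A0'; lra.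
Qed.

Let be (l : nat) : R := if (l <= k)%N then (1 + 2 * A) + (1 + 2 * A) ^+ 2 else
  (4 + 6 * (2 * A) + (2 * A) ^+ 2) * alphaR P J (l - k) `^ (1 - 2 / g).

Let be_ge0 l : 0 <= be l.
Proof.
rewrite /be; case: ifP => _.
  by have := sqr_ge0 (1 + 2 * A); move: A0 => A0'; lra.
by rewrite mulr_ge0 ?powR_ge0//; have := sqr_ge0 (2 * A); move: A0 => A0'; lra.
Qed.

Let be_sum m : \sum_(0 <= l < m) be l <= lag_cst.
Proof.
have c0 : 0 <= 4 + 6 * (2 * A) + (2 * A) ^+ 2 by have := sqr_ge0 (2 * A); move: A0 => A0'; lra.
apply: (@le_trans _ _ (\sum_(0 <= l < k.+1 + m) be l)).
  rewrite addnC (@big_cat_nat _ _ _ m 0 (m + k.+1)) ?leq_addr//= lerDl.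
  exact: sumr_ge0.
rewrite (@big_cat_nat _ _ _ k.+1 0 (k.+1 + m)) ?leq_addr//=; apply: lerD.
  rewrite (eq_big_nat _ _ (F2 := fun=> (1 + 2 * A) + (1 + 2 * A) ^+ 2)).
    by rewrite sumr_const_nat subn0 -[leLHS]mulr_natl.
  by move=> l /= lk; rewrite /be -ltnS lk.
rewrite -{1}[k.+1]add0n big_addn addKn; apply: le_trans (ler_wpM2l c0 (mixJ m)).
rewrite mulr_sumr; apply: ler_sum => l _.
have lk : (l + k.+1 <= k)%N = false by lia.
by rewrite /be lk (_ : (l + k.+1 - k)%N = l.+1)//; lia.
Qed.

Let Z (t : nat) w := X t.+1%:Z w - mu.

Let mZ t : measurable_fun [set: Om] (Z t).
Proof. by apply: measurable_funB => //; exact: lag_measurable. Qed.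

Let iZZ s t : ig P (fun w => Z s w * Z t w).
Proof.
have iZ2 r : ig P (fun w => Z r w ^+ 2).
  under [X in ig _ X]funext do rewrite /Z sqrrB -mulr_natl mulrA [_ * mu]mulrC mulrA.
  apply: igD; last exact: ig_cst.
  by apply: igB; [have [] := X_sqr r.+1|apply: igZ; exact: ig_lag].
by apply: ig_mul_sqr.
Qed.

Let EZZ s t : Ex P (fun w => Z s w * Z t w) = cov P (X s.+1) (X t.+1).
Proof.
have [js _] := X_sqr s.+1; have [jt _] := X_sqr t.+1.
have iXX : ig P (fun w => X s.+1 w * X t.+1 w).
  by apply: ig_mul_sqr => //; exact: lag_measurable.
have i1 := ig_lag s.+1; have i2 := ig_lag t.+1.
rewrite (@eq_Ex _ _ _ P _ (fun w => X s.+1 w * X t.+1 w - mu * X s.+1 w - mu * X t.+1 w + mu ^+ 2)).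
  rewrite ExD ?ExB ?ExZ ?Ex_cst ?Ex_lag /cov ?Ex_lag; try by solve_ig.
  by ring.
by move=> w; rewrite /Z; ring.
Qed.

Let EZZ_le s t : (s <= t)%N -> `|Ex P (fun w => Z s w * Z t w)| <= be (t - s)%N.
Proof.
move=> st; rewrite EZZ /be; case: ifPn => [_|].
  have [js Es] := X_sqr s.+1; have [jt Et] := X_sqr t.+1.
  rewrite /cov !Ex_lag (le_trans (ler_normB _ _))// lerD//.
    by apply: Ex_mul_le => //; exact: lag_measurable.
  by rewrite -expr2 ger0_norm ?sqr_ge0.
rewrite -ltnNge => kts; have [js Es] := X_g s.+1; have [jt Et] := X_g t.+1.
apply: cov_moment => //.
- by rewrite mulr_ge0.
- exact: alphaR01.
- exact: lag_measurable.
- exact: lag_measurable.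
- have := level_mixing_lin P a b k (t - s - k) s.+1%:Z mJ.
  rewrite subnK ?(ltnW kts)// -PoszD addSn subnKC//.
Qed.

(** The sum has only T - k terms but is divided by T, so besides the fluctuation there is a bias, a
    fraction of the mean. Both are O(1/T) in mean square. *)
Lemma Ex_sqr_lag_average (T : nat) : (0 < T)%N ->
  let D w := T%:R^-1 * (\sum_(k.+1 <= t < T.+1) X t%:Z w) - mu in
  ig P (fun w => D w ^+ 2) /\
  Ex P (fun w => D w ^+ 2) <= (4 * lag_cst + 2 * k%:R * (1 + 2 * A) ^+ 2) / T%:R.
Proof.
move=> T0 D; have TR : 0 < T%:R :> R by rewrite ltr0n.
(* [minn] covers T < k, where the sum is empty and the bias is the whole mean. As r <= 1, r^2 <= r
   <= k/T. *)
pose r : R := (minn k T)%:R / T%:R.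
pose Y w := \sum_(k <= t < T) Z t w.
have DE w : D w = T%:R^-1 * Y w - r * mu.
  have TkE : (T - k)%N%:R = T%:R - (minn k T)%:R :> R.
    by rewrite -natrB ?geq_minr//; congr (_%:R); lia.
  rewrite /D /Y /Z sumrB sumr_const_nat big_add1/= -[mu *+ _]mulr_natr TkE /r.
  by field; rewrite gt_eqF.
(* Padding by zeros lets the sum start at index 0 and keeps the covariance bound. *)
pose Z' (t : nat) w := if (k <= t)%N then Z t w else 0.
have YE w : Y w = \sum_(0 <= t < T) Z' t w.
  by rewrite /Y (@big_nat_widenl _ _ _ k 0)// [LHS]big_mkcond.
have iZ' s t : ig P (fun w => Z' s w * Z' t w).
  rewrite /Z'; case: (k <= s)%N; case: (k <= t)%N => //.
  - by under [X in ig _ X]funext do rewrite mulr0; exact: ig_cst.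
  - by under [X in ig _ X]funext do rewrite mul0r; exact: ig_cst.
  - by under [X in ig _ X]funext do rewrite mul0r; exact: ig_cst.
have iY : ig P (fun w => Y w ^+ 2).
  rewrite (_ : (fun w => _) = (fun w => \sum_(0 <= s < T) \sum_(0 <= t < T) Z' s w * Z' t w)).
    by apply: ig_sum => s; apply: ig_sum.
  apply/funext => w; rewrite YE expr2 mulr_suml; apply: eq_bigr => s _.
  by rewrite mulr_sumr.
have EY : Ex P (fun w => Y w ^+ 2) <= 2 * lag_cst * T%:R.
  under eq_Ex do rewrite YE.
  apply: (Ex_sqr_sum _ iZ' _ be_ge0 be_sum) => s t st; rewrite /Z'.
  case: (k <= s)%N; case: (k <= t)%N; first exact: EZZ_le.
  - by under eq_Ex do rewrite mulr0; rewrite Ex_cst normr0.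
  - by under eq_Ex do rewrite mul0r; rewrite Ex_cst normr0.
  - by under eq_Ex do rewrite mul0r; rewrite Ex_cst normr0.
have mY : measurable_fun [set: Om] Y by apply: measurable_sum => t; exact: mZ.
pose B w := 2 * T%:R^-1 ^+ 2 * Y w ^+ 2 + 2 * (r * mu) ^+ 2.
have DB w : D w ^+ 2 <= B w.
  by rewrite DE /B; have := sqr_ge0 (T%:R^-1 * Y w + r * mu); lra.
have iB : ig P B by rewrite /B; solve_ig.
have iD : ig P (fun w => D w ^+ 2).
  apply: ig_le iB _; last by move=> w; rewrite ger0_norm ?sqr_ge0.
  apply: measurable_funX; rewrite (funext DE).
  by apply: measurable_funB => //; apply: measurable_funM.
split=> //; apply: le_trans (Ex_le iD iB DB) _; rewrite /B ExD; try by solve_ig.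
rewrite Ex_cst ExZ// [leRHS]mulrDl. apply: lerD.
  apply: (@le_trans _ _ (2 * T%:R^-1 ^+ 2 * (2 * lag_cst * T%:R))).
    by rewrite ler_wpM2l// mulr_ge0// sqr_ge0.
  by rewrite le_eqVlt; apply/orP; left; apply/eqP; field; rewrite gt_eqF.
have r01 : 0 <= r <= 1.
  by rewrite /r divr_ge0//= ler_pdivrMr// mul1r ler_nat geq_minr.
have rk : r <= k%:R / T%:R by rewrite /r ler_pM2r ?invr_gt0// ler_nat geq_minl.
have r2 : r ^+ 2 <= k%:R / T%:R.
  by case/andP: r01 => r0 r1; apply: le_trans rk; rewrite expr2 ler_piMr.
apply: (@le_trans _ _ (2 * (k%:R / T%:R * (1 + 2 * A) ^+ 2))).
  by rewrite exprMn ler_wpM2l// ler_pM ?sqr_ge0.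
by rewrite le_eqVlt; apply/orP; left; apply/eqP; field; rewrite gt_eqF.
Qed.

End lagged_products.

(** * Moments of one panel *)

Section weighted_jensen.
Context {R : realType}.

(* Young's inequality gives the supporting line of [x `^ p] at [z]. *)
Lemma powR_support (p x z : R) : 1 < p -> 0 <= x -> 0 < z ->
  z `^ p <= x `^ p + p * z `^ (p - 1) * (z - x).
Proof.
move=> p1 x0 z0; have p0 : 0 < p by lra.
have q0 : 0 < p / (p - 1) by rewrite divr_gt0// subr_gt0.
have := @conjugate_powR R x (z `^ (p - 1)) p (p / (p - 1)) x0 (powR_ge0 _ _) p0 q0.
have -> : p^-1 + (p / (p - 1))^-1 = 1 by field; lra.
move=> /(_ erefl); rewrite -powRrM mulrCA divff ?mulr1; last by lra.
have zz : z `^ p = z * z `^ (p - 1) by rewrite mulr_powRB1 ?ltW.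
rewrite invf_div => h.
have : p * (x * z `^ (p - 1)) <= p * (x `^ p / p + z `^ p * ((p - 1) / p)) by rewrite ler_pM2l.
rewrite [leRHS](_ : _ = x `^ p + z `^ p * (p - 1)); last by field; lra.
by rewrite zz; lra.
Qed.

(** The supporting lines at z = sum w |x| are summed. The weights may add up to less than one; the
    missing mass enters with the nonnegative factor p z^p - z^p. *)
Lemma jensen_powR I (s : seq I) (p : R) (w x : I -> R) : 1 < p ->
  (forall i, 0 <= w i) -> \sum_(i <- s) w i <= 1 ->
  `|\sum_(i <- s) w i * x i| `^ p <= \sum_(i <- s) w i * `|x i| `^ p.
Proof.
move=> p1 w0 w1; have p0 : 0 < p by lra.
apply: (@le_trans _ _ ((\sum_(i <- s) w i * `|x i|) `^ p)).
  rewrite ge0_ler_powR ?nnegrE ?(ltW p0)//.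
    by apply: sumr_ge0 => i _; rewrite mulr_ge0.
  rewrite (le_trans (ler_norm_sum _ _ _))//.
  by apply: ler_sum => i _; rewrite normrM ger0_norm.
set z := \sum_(i <- s) w i * `|x i|.
have : 0 <= z by apply: sumr_ge0 => i _; rewrite mulr_ge0.
rewrite le_eqVlt => /predU1P[<-|z0].
  rewrite powR0 ?gt_eqF//; apply: sumr_ge0 => i _; rewrite mulr_ge0 ?powR_ge0//.
have zp : 0 <= z `^ (p - 1) by exact: powR_ge0.
set c := p * z `^ (p - 1); have c0 : 0 <= c by rewrite mulr_ge0// ltW.
have h i : w i * (z `^ p - c * z) <= w i * `|x i| `^ p - c * (w i * `|x i|).
  rewrite [leRHS](_ : _ = w i * (`|x i| `^ p - c * `|x i|)); last by ring.
  rewrite ler_wpM2l//; have := powR_support p1 (normr_ge0 (x i)) z0.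
  by rewrite -/c; lra.
have := @ler_sum _ _ s xpredT _ _ (fun i _ => h i).
rewrite -mulr_suml sumrB -mulr_sumr -/z.
have zz : z `^ p = z * z `^ (p - 1) by rewrite mulr_powRB1 ?ltW.
have : 0 <= (1 - \sum_(i <- s) w i) * (c * z - z `^ p).
  rewrite mulr_ge0 ?subr_ge0// /c zz.
  rewrite (_ : p * _ * z = p * (z * z `^ (p - 1))); last by ring.
  by rewrite ler_peMl ?mulr_ge0// ltW.
by lra.
Qed.

End weighted_jensen.

Lemma sqr_sum_le (R : realDomainType) (n : nat) (x : 'I_n -> R) :
  (\sum_i x i) ^+ 2 <= n%:R * \sum_i x i ^+ 2.
Proof.
have h (a b : R) : (a * b) *+ 2 <= a ^+ 2 + b ^+ 2.
  by have := sqr_ge0 (a - b); rewrite sqrrB; lra.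
rewrite -(ler_pMn2r (isT : (0 < 2)%N)) expr2 mulr_suml.
under eq_bigr do rewrite mulr_sumr.
rewrite -sumrMnl; under eq_bigr do rewrite -sumrMnl.
apply: (@le_trans _ _ (\sum_i \sum_j (x i ^+ 2 + x j ^+ 2))).
  by apply: ler_sum => i _; apply: ler_sum => j _; exact: h.
under eq_bigr do rewrite big_split/= sumr_const card_ord.
by rewrite big_split/= sumr_const card_ord sumrMnl mulr2n mulr_natl.
Qed.

Definition frob2 (R : realType) m n (A : 'M[R]_(m, n)) : R := \sum_i \sum_j A i j ^+ 2.

Section panel_moments.
Context {R : realType} {d : measure_display} {Om : measurableType d}.
Variable P : probability Om R.
Context {N K : nat}.
Variables (m : panel R Om N K) (g C1 C2 S : R).
Hypothesis g2 : 2 < g.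
Hypothesis K0 : (0 < K)%N.
Hypothesis model : spatial_factor_model P m.
Hypothesis unitS : Smx m \in unitmx.
Hypothesis sumsS : abs_sums_le C2 (invmx (Smx m)).
Hypothesis C21 : 1 <= C2.
Hypothesis momf : forall t j,
  ('E_P[fun w => (`|factor m t w j 0| `^ (2 * g))%R] < C1%:E)%E.
Hypothesis mome : forall t i,
  ('E_P[fun w => (`|noise m t w i 0| `^ (2 * g))%R] < C1%:E)%E.
Hypothesis statJ : strictly_stationary P (joint m).
Hypothesis mixJ :
  forall l, \sum_(0 <= i < l) alphaR P (joint m) i.+1 `^ (1 - 2 / g) <= S.
Hypothesis noiseP : forall (t : int) (j : nat), (0 < j)%N ->
          covmx P (obs m (t - j%:Z)) (noise m t) = 0.
Hypothesis noise0 : forall t, mean_zero P (noise m t).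
Hypothesis LamLam : (Lam m)^T *m Lam m = N%:R%:M.

Let y := obs m.
Let f := factor m.
Let xi_ := xi m.

Lemma obsE t w : y t w = Lam m *m f t w + xi_ t w.
Proof.
have [_ _ _ /(_ t w)] := model; rewrite -/(y t w) -/(f t w) => yE.
rewrite /Lam /xi_ /xi -mulmxA -mulmxDr -[LHS]mul1mx -(mulVmx unitS) -mulmxA.
congr (_ *m _); rewrite /Smx mulmxBl mul1mx {1}yE.
by rewrite -[X in X - _]addrA [X in X - _]addrC addrK.
Qed.

Let my t : random_mx (y t). Proof. by have [/(_ t)[]] := model. Qed.
Let mf t : random_mx (f t). Proof. by have [/(_ t)[]] := model. Qed.
Let me t : random_mx (noise m t). Proof. by have [/(_ t)[]] := model. Qed.

Lemma random_joint t : random_mx (joint m t).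
Proof.
move=> i j; rewrite /joint.
under [X in measurable_fun _ X]funext do rewrite mxE.
by case: splitP => k _; [exact: my|exact: mf].
Qed.

Lemma random_xi t : random_mx (xi_ t).
Proof.
move=> i j; under [X in measurable_fun _ X]funext do rewrite mxE.
by apply: measurable_sum => k; apply: measurable_funM => //; exact: me.
Qed.

Lemma lin_joint (b : 'cV[R]_N) (c : 'cV[R]_K) t w :
  lin (col_mx b c) (joint m) t w =
  \sum_i b i 0 * y t w i 0 + \sum_j c j 0 * f t w j 0.
Proof.
rewrite /lin big_split_ord/=; congr (_ + _); apply: eq_bigr => i _.
  by rewrite /joint !col_mxEu.
by rewrite /joint !col_mxEd.
Qed.

(* Dividing by [obs_scale] makes an observation (up to its idiosyncratic part) a
   convex combination of factors, so that Jensen's inequality bounds its moments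
   uniformly in [N]. *)
Definition obs_scale (j : 'I_N) : R := 1 + \sum_k `|Lam m j k|.

Lemma obs_scale_ge1 j : 1 <= obs_scale j.
Proof. by rewrite /obs_scale lerDl sumr_ge0. Qed.

Definition fvec (j : 'I_K) : 'cV[R]_(N + K) := col_mx 0 (delta_mx j 0).
(** Since xi = y - Lam f is a linear form in the joint process, mixing of (y, f) controls averages
    of the idiosyncratic part. *)
Definition xvec (i : 'I_N) : 'cV[R]_(N + K) :=
  col_mx (delta_mx i 0) (- (row i (Lam m))^T).
Definition yvec (j : 'I_N) : 'cV[R]_(N + K) := col_mx ((obs_scale j)^-1 *: delta_mx j 0) 0.

Let sum_delta n (i : 'I_n) (F : 'I_n -> R) :
  \sum_j (delta_mx i 0 : 'cV[R]_n) j 0 * F j = F i.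
Proof.
rewrite (bigD1 i)//= mxE !eqxx mul1r big1 ?addr0// => j ji.
by rewrite mxE (negbTE ji) mul0r.
Qed.

Lemma lin_fvec j t w : lin (fvec j) (joint m) t w = f t w j 0.
Proof.
rewrite lin_joint sum_delta big1 ?add0r// => i _; by rewrite mxE mul0r.
Qed.

Lemma lin_xvec i t w : lin (xvec i) (joint m) t w = xi_ t w i 0.
Proof.
rewrite lin_joint sum_delta obsE mxE mxE addrAC -big_split/= big1 ?add0r// => j _.
by rewrite !mxE mulNr subrr.
Qed.

Lemma lin_yvec j t w : lin (yvec j) (joint m) t w = (obs_scale j)^-1 * y t w j 0.
Proof.
rewrite lin_joint [X in _ + X]big1 ?addr0 => [|i _]; last by rewrite mxE mul0r.
under eq_bigr do rewrite mxE -mulrA.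
by rewrite -mulr_sumr sum_delta.
Qed.

(** Dominates both C1, for the factors, and C1 C2^(2g), for the idiosyncratic parts, hence also the
    rescaled observations, which are convex combinations of these up to signs. *)
Definition mom_cst : R := C1 * (1 + C2 `^ (2 * g)).

Let mpow (X : Om -> R) : measurable_fun [set: Om] X ->
  measurable_fun [set: Om] (fun w => `|X w| `^ (2 * g)).
Proof.
move=> mX; apply: (measurableT_comp (measurable_powR _)).
exact: (measurableT_comp (@normr_measurable _ setT)).
Qed.

Let C1_ge0 : 0 <= C1.
Proof.
have [_ E] := ig_of_lt (mpow (@mf 0 (Ordinal K0) 0)) (fun w => powR_ge0 _ _) (momf 0 (Ordinal K0)).
by apply: le_trans E; apply: Ex_ge0 => w; exact: powR_ge0.
Qed.

Let p1 : 1 < 2 * g. Proof. by move: g2 => h; lra. Qed.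

Lemma mom_cst_ge0 : 0 <= mom_cst.
Proof. by rewrite mulr_ge0// addr_ge0// powR_ge0. Qed.

Lemma mom_factor j t : ig P (fun w => `|f t w j 0| `^ (2 * g)) /\
  Ex P (fun w => `|f t w j 0| `^ (2 * g)) <= C1.
Proof. by apply: ig_of_lt => //; apply: mpow; exact: mf. Qed.

(** A row of the inverse of [Smx], divided by [C2], has absolute sum at most one, so Jensen's
    inequality applies and only the factor C2^(2g) is lost. *)
Lemma mom_xi i t : ig P (fun w => `|xi_ t w i 0| `^ (2 * g)) /\
  Ex P (fun w => `|xi_ t w i 0| `^ (2 * g)) <= C2 `^ (2 * g) * C1.
Proof.
have C20 : 0 < C2 by apply: lt_le_trans C21.
pose v j := `|invmx (Smx m) i j| / C2.
have v0 j : 0 <= v j by rewrite divr_ge0// ltW.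
have v1 : \sum_j v j <= 1.
  by rewrite -mulr_suml ler_pdivrMr// mul1r; have [] := sumsS i.
have ie j : ig P (fun w => `|noise m t w j 0| `^ (2 * g)) /\
    Ex P (fun w => `|noise m t w j 0| `^ (2 * g)) <= C1.
  by apply: ig_of_lt => //; apply: mpow; exact: me.
pose B w := C2 `^ (2 * g) * \sum_j v j * `|noise m t w j 0| `^ (2 * g).
have iB : ig P B.
  by apply: igZ; apply: ig_sum => j; apply: igZ; case: (ie j).
have le w : `|xi_ t w i 0| `^ (2 * g) <= B w.
  rewrite /B (_ : xi_ t w i 0 = C2 * \sum_j v j * (Num.sg (invmx (Smx m) i j) * noise m t w j 0)).
    rewrite normrM (ger0_norm (ltW C20)) powRM ?(ltW C20)// ler_wpM2l ?powR_ge0//.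
    apply: le_trans (jensen_powR _ p1 v0 v1) _.
    apply: ler_sum => j _; rewrite ler_wpM2l// ge0_ler_powR ?nnegrE ?(ltW (lt_trans ltr01 p1))//.
    by rewrite normrM normr_sg; case: (_ != 0); rewrite ?mul1r// mul0r.
  rewrite mxE mulr_sumr; apply: eq_bigr => j _; rewrite /v.
  by rewrite {1}[invmx _ i j]numEsg; field; rewrite gt_eqF.
have iX : ig P (fun w => `|xi_ t w i 0| `^ (2 * g)).
  apply: ig_le iB _; first by apply: mpow; exact: random_xi.
  by move=> w; rewrite ger0_norm ?powR_ge0.
split=> //; apply: le_trans (Ex_le iX iB le) _.
rewrite ExZ; last by apply: ig_sum => j; apply: igZ; case: (ie j).
rewrite ler_wpM2l ?powR_ge0// Ex_sum; last by move=> j; apply: igZ; case: (ie j).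
apply: (@le_trans _ _ (\sum_j v j * C1)).
  by apply: ler_sum => j _; have [i1 E1] := ie j; rewrite ExZ// ler_wpM2l.
by rewrite -mulr_suml ler_piMl.
Qed.

Lemma mom_obs j t : ig P (fun w => `|(obs_scale j)^-1 * y t w j 0| `^ (2 * g)) /\
  Ex P (fun w => `|(obs_scale j)^-1 * y t w j 0| `^ (2 * g)) <= mom_cst.
Proof.
pose l := obs_scale j; have l0 : 0 < l by exact: lt_le_trans (obs_scale_ge1 j).
(* [None] stands for the idiosyncratic term; with it the weights add up to one. *)
pose v (k : option 'I_K) := if k is Some k then `|Lam m j k| / l else l^-1.
pose x w (k : option 'I_K) :=
  if k is Some k then Num.sg (Lam m j k) * f t w k 0 else xi_ t w j 0.
pose s : seq (option 'I_K) := None :: map Some (index_enum 'I_K).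
have v0 k : 0 <= v k by case: k => [k|] /=; rewrite ?divr_ge0 ?invr_ge0// ltW.
have v1 : \sum_(k <- s) v k <= 1.
  rewrite /s big_cons big_map/= -mulr_suml -{1}[l^-1]mul1r -mulrDl.
  by rewrite -/(obs_scale j) divff// gt_eqF.
have vx w : \sum_(k <- s) v k * x w k = l^-1 * y t w j 0.
  have yE : y t w j 0 = \sum_k Lam m j k * f t w k 0 + xi_ t w j 0 by rewrite obsE mxE mxE.
  rewrite /s big_cons big_map/= yE mulrDr addrC; congr (_ + _).
  rewrite mulr_sumr; apply: eq_bigr => k _; rewrite {3}[Lam m j k]numEsg.
  by field; rewrite gt_eqF.
pose B w := \sum_(k <- s) v k * `|x w k| `^ (2 * g).
have ix k : ig P (fun w => `|x w k| `^ (2 * g)) /\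
    Ex P (fun w => `|x w k| `^ (2 * g)) <= mom_cst.
  case: k => [k|] /=; last first.
    by have [i1 E1] := mom_xi j t; split=> //; apply: le_trans E1 _; rewrite /mom_cst; move: C1_ge0 => h; lra.
  have [i1 E1] := mom_factor k t.
  have le w : `|Num.sg (Lam m j k) * f t w k 0| `^ (2 * g) <= `|f t w k 0| `^ (2 * g).
    rewrite ge0_ler_powR ?nnegrE ?(ltW (lt_trans ltr01 p1))//.
    by rewrite normrM normr_sg; case: (_ != 0); rewrite ?mul1r// mul0r.
  have i2 : ig P (fun w => `|Num.sg (Lam m j k) * f t w k 0| `^ (2 * g)).
    apply: ig_le i1 _; first by apply: mpow; apply: measurable_funM => //; exact: mf.
    by move=> w; rewrite ger0_norm ?powR_ge0.
  split=> //; apply: le_trans (Ex_le i2 i1 le) _; apply: le_trans E1 _.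
  by rewrite /mom_cst mulrDr mulr1 lerDl mulr_ge0// powR_ge0.
have iB : ig P B by apply: ig_sum => k; apply: igZ; case: (ix k).
have le w : `|l^-1 * y t w j 0| `^ (2 * g) <= B w by rewrite -vx; exact: jensen_powR.
have iX : ig P (fun w => `|l^-1 * y t w j 0| `^ (2 * g)).
  apply: ig_le iB _; first by apply: mpow; apply: measurable_funM => //; exact: my.
  by move=> w; rewrite ger0_norm ?powR_ge0.
split=> //; apply: le_trans (Ex_le iX iB le) _.
rewrite Ex_sum; last by move=> k; apply: igZ; case: (ix k).
apply: (@le_trans _ _ (\sum_(k <- s) v k * mom_cst)).
  by apply: ler_sum => k _; have [i1 E1] := ix k; rewrite ExZ// ler_wpM2l.
by rewrite -mulr_suml ler_piMl// mom_cst_ge0.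
Qed.

Definition Ek (T k : nat) (w : Om) : 'M[R]_N :=
  T%:R^-1 *: \sum_(k.+1 <= t < T.+1) xi_ t%:Z w *m (y (t%:Z - k%:Z) w)^T.

Definition Ck (k : nat) : 'M[R]_(K, N) := covmx P (f 0) (y (- k%:Z)).

Lemma G1E T k w : G1 m T k w =
  T%:R^-1 *: \sum_(k.+1 <= t < T.+1) f t%:Z w *m (y (t%:Z - k%:Z) w)^T.
Proof.
congr (_ *: _); apply: eq_bigr => t _.
by rewrite obsE linearD/= mulmxDr -mulmxA -trmx_mul.
Qed.

Lemma Sigma_y_hatE T k w : Sigma_y_hat m T k w = Lam m *m G1 m T k w + Ek T k w.
Proof.
rewrite G1E /Ek -scalemxAr -scalerDr; congr (_ *: _).
rewrite mulmx_sumr -big_split/=; apply: eq_bigr => t _.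
by rewrite [X in X *m _ = _](obsE t%:Z) mulmxDl mulmxA.
Qed.

Let p2 : 2 <= 2 * g. Proof. by move: g2 => h; lra. Qed.

Lemma sqr_factor j t : ig P (fun w => f t w j 0 ^+ 2).
Proof. by have [i1 _] := mom_factor j t; have [] := ig_sqr_powR p2 (@mf t j 0) i1. Qed.

Lemma sqr_xi i t : ig P (fun w => xi_ t w i 0 ^+ 2).
Proof. by have [i1 _] := mom_xi i t; have [] := ig_sqr_powR p2 (@random_xi t i 0) i1. Qed.

Lemma sqr_obs j t : ig P (fun w => y t w j 0 ^+ 2).
Proof.
have [i1 _] := mom_obs j t.
have l0 : 0 < obs_scale j by exact: lt_le_trans (obs_scale_ge1 j).
have mY : measurable_fun [set: Om] (fun w => (obs_scale j)^-1 * y t w j 0).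
  by apply: measurable_funM => //; exact: my.
have [i2 _] := ig_sqr_powR p2 mY i1.
have := igZ (obs_scale j ^+ 2) i2; congr (ig P _); apply/funext => w.
by field; rewrite gt_eqF.
Qed.

Lemma sqr_noise i t : ig P (fun w => noise m t w i 0 ^+ 2).
Proof.
have [i1 _] := ig_of_lt (mpow (@me t i 0)) (fun w => powR_ge0 _ _) (mome t i).
by have [] := ig_sqr_powR p2 (@me t i 0) i1.
Qed.

Lemma covmxE a b (X : Om -> 'cV[R]_a) (Y : Om -> 'cV[R]_b) i j :
  mean_zero P X -> mean_zero P Y ->
  covmx P X Y i j = Ex P (fun w => X w i 0 * Y w j 0).
Proof.
move=> X0 Y0; rewrite mxE unlock (X0 i) (Y0 j) /Ex; congr (fine 'E_P[_]%E).
apply/funext => w; change ((X w i 0 - 0) * (Y w j 0 - 0) = X w i 0 * Y w j 0).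
by rewrite !subr0.
Qed.

Lemma Ex_xi_obs i j k : (0 < k)%N -> Ex P (fun w => xi_ 0 w i 0 * y (- k%:Z) w j 0) = 0.
Proof.
move=> k0; have [_ y0 _ _] := model.
have ie l : ig P (fun w => noise m 0 w l 0 * y (- k%:Z) w j 0).
  by apply: ig_mul_sqr; [exact: me|exact: my|exact: sqr_noise|exact: sqr_obs].
rewrite (@eq_Ex _ _ _ P _ (fun w => \sum_l invmx (Smx m) i l * (noise m 0 w l 0 * y (- k%:Z) w j 0))).
  rewrite Ex_sum; last by move=> l; exact: igZ.
  rewrite big1// => l _; rewrite ExZ//.
  have := noiseP 0 k0 => /matrixP/(_ j l); rewrite covmxE// mxE sub0r => e.
  by under eq_Ex do rewrite mulrC; rewrite e mulr0.
by move=> w; rewrite mxE mulr_suml; apply: eq_bigr => l _; rewrite mulrA.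
Qed.

Lemma Sigma_yE k : (0 < k)%N -> Sigma_y P m k = Lam m *m Ck k.
Proof.
move=> k0; have [_ y0 f0 _] := model.
apply/matrixP => i j; rewrite covmxE// mxE.
have ify l : ig P (fun w => f 0 w l 0 * y (- k%:Z) w j 0).
  by apply: ig_mul_sqr; [exact: mf|exact: my|exact: sqr_factor|exact: sqr_obs].
have ixy : ig P (fun w => xi_ 0 w i 0 * y (- k%:Z) w j 0).
  by apply: ig_mul_sqr; [exact: random_xi|exact: my|exact: sqr_xi|exact: sqr_obs].
rewrite (@eq_Ex _ _ _ P _ (fun w => (\sum_l Lam m i l * (f 0 w l 0 * y (- k%:Z) w j 0))
   + xi_ 0 w i 0 * y (- k%:Z) w j 0)).
  rewrite ExD//; last by apply: ig_sum => l; exact: igZ.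
  rewrite Ex_xi_obs// addr0 Ex_sum; last by move=> l; exact: igZ.
  by apply: eq_bigr => l _; rewrite ExZ// covmxE.
move=> w.
have yE : y 0 w i 0 = \sum_l Lam m i l * f 0 w l 0 + xi_ 0 w i 0 by rewrite obsE mxE mxE.
rewrite [X in X * _ = _]yE mulrDl mulr_suml; congr (_ + _).
by apply: eq_bigr => l _; rewrite mulrA.
Qed.

Definition avg_cst (k : nat) : R :=
  4 * lag_cst mom_cst S k + 2 * k%:R * (1 + 2 * mom_cst) ^+ 2.

Let mom_lin c : (exists i, c = xvec i) \/ (exists j, c = fvec j) \/ (exists j, c = yvec j) ->
  forall t, ig P (fun w => `|lin c (joint m) t w| `^ (2 * g)) /\
  Ex P (fun w => `|lin c (joint m) t w| `^ (2 * g)) <= mom_cst.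
Proof.
have h0 := C1_ge0; have h1 := powR_ge0 C2 (2 * g).
have h2 : 0 <= C1 * C2 `^ (2 * g) by rewrite mulr_ge0.
move=> [[i ->]|[[j ->]|[j ->]]] t.
- rewrite (_ : (fun w => _) = fun w => `|xi_ t w i 0| `^ (2 * g)).
    by have [? ?] := mom_xi i t; split=> //; rewrite /mom_cst; lra.
  by apply/funext => w; rewrite lin_xvec.
- rewrite (_ : (fun w => _) = fun w => `|f t w j 0| `^ (2 * g)).
    by have [? ?] := mom_factor j t; split=> //; rewrite /mom_cst; lra.
  by apply/funext => w; rewrite lin_fvec.
- rewrite (_ : (fun w => _) = fun w => `|(obs_scale j)^-1 * y t w j 0| `^ (2 * g)).
    exact: mom_obs.
  by apply/funext => w; rewrite lin_yvec.
Qed.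

(** The average is controlled for the rescaled coordinate, whose moments are uniform in [N]; undoing
    the scale multiplies the mean square by [obs_scale j ^+ 2]. *)
Let avg_entry c j T k : (exists i, c = xvec i) \/ (exists i, c = fvec i) -> (0 < T)%N ->
  let D w := T%:R^-1 * (\sum_(k.+1 <= t < T.+1) lin c (joint m) t%:Z w * y (t%:Z - k%:Z) w j 0)
     - Ex P (fun w => lin c (joint m) 0 w * y (- k%:Z) w j 0) in
  ig P (fun w => D w ^+ 2) /\
  Ex P (fun w => D w ^+ 2) <= obs_scale j ^+ 2 * (avg_cst k / T%:R).
Proof.
move=> cP T0 D; pose l := obs_scale j.
have l0 : 0 < l by exact: lt_le_trans (obs_scale_ge1 j).
have [|i1 E1] := Ex_sqr_lag_average k g2 mom_cst_ge0 random_joint statJ mixJ (a := c) (b := yvec j) _ T0.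
  move=> c' [->|->] t; apply: mom_lin; last by right; right; exists j.
  by case: cP => ?; [left|right; left].
have lE t w : lin (yvec j) (joint m) t w = l^-1 * y t w j 0 by exact: lin_yvec.
have ly : ig P (fun w => lin c (joint m) 0 w * y (- k%:Z) w j 0).
  apply: ig_mul_sqr; [exact/lin_meas/random_joint|exact: my| |exact: sqr_obs].
  by case: cP => -[i ->]; under [X in ig _ X]funext do rewrite ?lin_xvec ?lin_fvec;
    [exact: sqr_xi|exact: sqr_factor].
have DE w : D w ^+ 2 = l ^+ 2 * (T%:R^-1 *
         (\sum_(k.+1 <= t < T.+1)
             lin c (joint m) t%:Z w * lin (yvec j) (joint m) (t%:Z - k%:Z) w) -
         Ex P (fun w0 => lin c (joint m) 0 w0 * lin (yvec j) (joint m) (- k%:Z) w0)) ^+ 2.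
  rewrite -exprMn; congr (_ ^+ 2).
  under [X in Ex P X]funext do rewrite lE mulrCA.
  have sE : \sum_(k.+1 <= t < T.+1) lin c (joint m) t%:Z w * lin (yvec j) (joint m) (t%:Z - k%:Z) w
      = l^-1 * \sum_(k.+1 <= t < T.+1) lin c (joint m) t%:Z w * y (t%:Z - k%:Z) w j 0.
    by rewrite mulr_sumr; apply: eq_bigr => t _; rewrite lE mulrCA.
  rewrite sE ExZ// /D; field; rewrite !gt_eqF// ltr0n//.
rewrite (funext DE); split; first exact: igZ.
by rewrite ExZ// ler_wpM2l// sqr_ge0.
Qed.

(** A single scale may be large, but each of the K columns of the loading matrix has squared norm
    N. *)
Lemma sum_obs_scale : \sum_j obs_scale j ^+ 2 <= (2 + 2 * K%:R ^+ 2) * N%:R.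
Proof.
have le j : obs_scale j ^+ 2 <= 2 + 2 * K%:R * \sum_k Lam m j k ^+ 2.
  have := sqr_sum_le (fun k => `|Lam m j k|).
  under [X in _ <= _ * X]eq_bigr do rewrite real_normK ?num_real//.
  rewrite /obs_scale; set s := \sum_k `|_|; set q := \sum_k _.
  by have := sqr_ge0 (s - 1); lra.
apply: le_trans (ler_sum _ (fun j _ => le j)) _.
rewrite big_split/= sumr_const card_ord -mulr_sumr exchange_big/=.
rewrite (eq_bigr (fun=> N%:R)) => [|k _]; last first.
  have /matrixP/(_ k k) := LamLam; rewrite mxE [RHS]mxE eqxx mulr1n => <-.
  by apply: eq_bigr => j _; rewrite [(Lam m)^T _ _]mxE expr2.
rewrite sumr_const card_ord -mulr_natr -[N%:R *+ K]mulr_natr.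
by rewrite le_eqVlt; apply/orP; left; apply/eqP; ring.
Qed.

Let sum_frob2 a T (F : 'I_a -> 'I_N -> Om -> R) (c : R) :
  (forall i j, ig P (fun w => F i j w ^+ 2) /\
    Ex P (fun w => F i j w ^+ 2) <= obs_scale j ^+ 2 * (c / T%:R)) -> 0 <= c ->
  ig P (fun w => \sum_i \sum_j F i j w ^+ 2) /\
  Ex P (fun w => \sum_i \sum_j F i j w ^+ 2) <=
     (2 + 2 * K%:R ^+ 2) * c * (a%:R * N%:R / T%:R).
Proof.
move=> H c0; have i1 i j := (H i j).1.
have i2 i : ig P (fun w => \sum_j F i j w ^+ 2) by exact: ig_sum.
split; first exact: ig_sum.
rewrite Ex_sum//; apply: (@le_trans _ _ (\sum_(i < a) (2 + 2 * K%:R ^+ 2) * N%:R * (c / T%:R))).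
  apply: ler_sum => i _; rewrite Ex_sum//.
  apply: le_trans (ler_sum _ (fun j _ => (H i j).2)) _.
  rewrite -mulr_suml ler_wpM2r ?divr_ge0//; exact: sum_obs_scale.
rewrite sumr_const card_ord -mulr_natr.
by rewrite le_eqVlt; apply/orP; left; apply/eqP; ring.
Qed.

Lemma avg_cst_ge0 k : 0 <= avg_cst k.
Proof.
have A0 := mom_cst_ge0; have := mixJ 0; rewrite big_geq// => S0.
rewrite /avg_cst /lag_cst addr_ge0 ?mulr_ge0 ?sqr_ge0// addr_ge0// mulr_ge0//.
  by rewrite addr_ge0 ?sqr_ge0//; lra.
by rewrite addr_ge0 ?sqr_ge0//; lra.
Qed.

Definition err_cst k : R := (2 + 2 * K%:R ^+ 2) * avg_cst k.

(** The average of xi_t y_{t-k}' estimates zero, as the noise is uncorrelated with past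
    observations. *)
Lemma Ex_frob2_Ek T k : (0 < T)%N -> (0 < k)%N ->
  ig P (fun w => frob2 (Ek T k w)) /\
  Ex P (fun w => frob2 (Ek T k w)) <= err_cst k * (N%:R * N%:R / T%:R).
Proof.
move=> T0 k0; rewrite /frob2; apply: sum_frob2; last exact: avg_cst_ge0.
move=> i j; have := @avg_entry (xvec i) j T k (or_introl (ex_intro _ i erefl)) T0.
move=> /[let] D; rewrite (_ : (fun w => D w ^+ 2) = fun w => Ek T k w i j ^+ 2)//.
apply/funext => w; congr (_ ^+ 2); rewrite /D.
under [X in Ex P X]funext do rewrite lin_xvec.
rewrite Ex_xi_obs// subr0 !mxE summxE; congr (_ * _); apply: eq_bigr => t _.
by rewrite lin_xvec [RHS]mxE big_ord1 [X in _ = _ * X]mxE.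
Qed.

Lemma Ex_frob2_G1 T k : (0 < T)%N ->
  ig P (fun w => frob2 (G1 m T k w - Ck k)) /\
  Ex P (fun w => frob2 (G1 m T k w - Ck k)) <= err_cst k * (K%:R * N%:R / T%:R).
Proof.
have [_ y0 f0 _] := model.
move=> T0; rewrite /frob2; apply: sum_frob2; last exact: avg_cst_ge0.
move=> i j; have := @avg_entry (fvec i) j T k (or_intror (ex_intro _ i erefl)) T0.
move=> /[let] D; rewrite (_ : (fun w => D w ^+ 2) = fun w => (G1 m T k w - Ck k) i j ^+ 2)//.
apply/funext => w; congr (_ ^+ 2); rewrite /D [RHS]mxE [X in _ = _ + X]mxE covmxE// G1E.
congr (_ - _); last by apply: eq_Ex => w'; rewrite lin_fvec.
rewrite mxE summxE; congr (_ * _); apply: eq_bigr => t _.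
by rewrite lin_fvec [RHS]mxE big_ord1 [X in _ = _ * X]mxE.
Qed.

Lemma frob2_Ck k : frob2 (Ck k) <= (1 + mom_cst) ^+ 2 * (2 + 2 * K%:R ^+ 2) * (K%:R * N%:R).
Proof.
have [_ y0 f0 _] := model; have A0 := mom_cst_ge0.
have le i j : Ck k i j ^+ 2 <= obs_scale j ^+ 2 * (1 + mom_cst) ^+ 2.
  have l0 : 0 < obs_scale j by exact: lt_le_trans (obs_scale_ge1 j).
  rewrite covmxE//.
  have mY : measurable_fun [set: Om] (fun w => (obs_scale j)^-1 * y (- k%:Z) w j 0).
    by apply: measurable_funM => //; exact: my.
  have [i1 E1] := mom_obs j (- k%:Z); have [i2 E2] := ig_sqr_powR p2 mY i1.
  have [i3 E3] := mom_factor i 0; have [i4 E4] := ig_sqr_powR p2 (@mf 0 i 0) i3.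
  have CA : C1 <= mom_cst.
    by rewrite /mom_cst mulrDr mulr1 lerDl mulr_ge0// powR_ge0.
  have h : `|Ex P (fun w => f 0 w i 0 * ((obs_scale j)^-1 * y (- k%:Z) w j 0))| <= 1 + mom_cst.
    by apply: Ex_mul_le => //; [exact: mf|lra|lra].
  have ify : ig P (fun w => f 0 w i 0 * ((obs_scale j)^-1 * y (- k%:Z) w j 0)).
    by apply: ig_mul_sqr => //; exact: mf.
  rewrite (@eq_Ex _ _ _ P _ (fun w => obs_scale j * (f 0 w i 0 * ((obs_scale j)^-1 * y (- k%:Z) w j 0)))).
    rewrite ExZ// exprMn ler_wpM2l ?sqr_ge0// -real_normK ?num_real//.
    by rewrite ler_pXn2r// nnegrE//; lra.
  by move=> w; field; rewrite gt_eqF.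
rewrite /frob2; apply: (@le_trans _ _ (\sum_(i < K) (2 + 2 * K%:R ^+ 2) * N%:R * (1 + mom_cst) ^+ 2)).
  apply: ler_sum => i _; apply: le_trans (ler_sum _ (fun j _ => le i j)) _.
  rewrite -mulr_suml ler_wpM2r ?sqr_ge0//; exact: sum_obs_scale.
rewrite sumr_const card_ord -mulr_natr.
by rewrite le_eqVlt; apply/orP; left; apply/eqP; ring.
Qed.

Lemma Ex_xi_pow4 i t : ig P (fun w => xi_ t w i 0 ^+ 4) /\
  Ex P (fun w => xi_ t w i 0 ^+ 4) <= 1 + mom_cst.
Proof.
have [i1 E1] := mom_xi i t; have h0 := C1_ge0; have h1 := powR_ge0 C2 (2 * g).
have le w : xi_ t w i 0 ^+ 4 <= 1 + `|xi_ t w i 0| `^ (2 * g).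
  rewrite -[_ ^+ 4]ger0_norm ?exprn_even_ge0// normrX expr_le_powR//.
  by move: g2 => h; lra.
have iB : ig P (fun w => 1 + `|xi_ t w i 0| `^ (2 * g)) by solve_ig.
have i4 : ig P (fun w => xi_ t w i 0 ^+ 4).
  apply: ig_le iB _; first by apply: measurable_funX; exact: random_xi.
  by move=> w; rewrite ger0_norm ?exprn_even_ge0.
split=> //; apply: le_trans (Ex_le i4 iB le) _; rewrite ExD//; last exact: ig_cst.
by rewrite Ex_cst lerD2l /mom_cst; lra.
Qed.

Lemma Ex_xi_sqr i t : Ex P (fun w => xi_ t w i 0 ^+ 2) <= 1 + mom_cst.
Proof.
have [i1 E1] := mom_xi i t; have [_ E2] := ig_sqr_powR p2 (@random_xi t i 0) i1.
by apply: le_trans E2 _; rewrite lerD2l; apply: le_trans E1 _; rewrite /mom_cst; move: C1_ge0 => h; lra.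
Qed.

End panel_moments.

(** * Frobenius norm, spectral theorem, perturbation of eigenvectors *)

Section frobenius_norm.
Context {R : realType}.

(** Lagrange's identity: twice the gap is a double sum of squares. *)
Lemma sum_cauchy_schwarz I (r : seq I) (a b : I -> R) :
  (\sum_(i <- r) a i * b i) ^+ 2 <= (\sum_(i <- r) a i ^+ 2) * (\sum_(i <- r) b i ^+ 2).
Proof.
rewrite -subr_ge0 -(pmulrn_lge0 _ (isT : (0 < 2)%N)).
rewrite (_ : _ *+ 2 = \sum_(i <- r) \sum_(j <- r) (a i * b j - a j * b i) ^+ 2).
  by apply: sumr_ge0 => i _; apply: sumr_ge0 => j _; exact: sqr_ge0.
have -> : \sum_(i <- r) \sum_(j <- r) (a i * b j - a j * b i) ^+ 2 =
    \sum_(i <- r) \sum_(j <- r) a i ^+ 2 * b j ^+ 2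
    + \sum_(i <- r) \sum_(j <- r) a j ^+ 2 * b i ^+ 2
    - (\sum_(i <- r) \sum_(j <- r) (a i * b i) * (a j * b j)) *+ 2.
  rewrite -big_split -sumrMnl -sumrB; apply: eq_bigr => i _.
  rewrite -big_split -sumrMnl -sumrB; apply: eq_bigr => j _ /=.
  by rewrite -mulr_natl; ring.
rewrite [X in _ + X - _]exchange_big/= mulrnBl mulr2n expr2.
rewrite !mulr_suml; congr (_ + _ - _).
- by apply: eq_bigr => i _; rewrite mulr_sumr.
- by apply: eq_bigr => i _; rewrite mulr_sumr.
- by congr (_ *+ _); apply: eq_bigr => i _; rewrite mulr_sumr.
Qed.

Definition nf m n (A : 'M[R]_(m, n)) : R := Num.sqrt (frob2 A).

Lemma frob2_ge0 m n (A : 'M[R]_(m, n)) : 0 <= frob2 A.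
Proof. by apply: sumr_ge0 => i _; apply: sumr_ge0 => j _; exact: sqr_ge0. Qed.

Lemma nf_ge0 m n (A : 'M[R]_(m, n)) : 0 <= nf A.
Proof. exact: sqrtr_ge0. Qed.

Lemma nf_sqr m n (A : 'M[R]_(m, n)) : nf A ^+ 2 = frob2 A.
Proof. by rewrite sqr_sqrtr// frob2_ge0. Qed.

Lemma frob2E m n (A : 'M[R]_(m, n)) : frob2 A = \tr (A *m A^T).
Proof.
apply: eq_bigr => i _; rewrite mxE; apply: eq_bigr => j _.
by rewrite mxE expr2.
Qed.

Lemma frob2_pair m n (A : 'M[R]_(m, n)) :
  frob2 A = \sum_(p : 'I_m * 'I_n) A p.1 p.2 ^+ 2.
Proof. by rewrite /frob2 pair_bigA. Qed.

Lemma frob2_le m n (A : 'M[R]_(m, n)) (c : R) : 0 <= c -> (nf A <= c) = (frob2 A <= c ^+ 2).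
Proof.
move=> c0; rewrite /nf -[in LHS](ger0_norm c0) -(sqrtr_sqr c) ler_sqrt//.
exact: sqr_ge0.
Qed.

Lemma nfD m n (A B : 'M[R]_(m, n)) : nf (A + B) <= nf A + nf B.
Proof.
rewrite frob2_le ?addr_ge0 ?nf_ge0// sqrrD !nf_sqr.
rewrite [frob2 (A + B)]frob2_pair.
under eq_bigr do rewrite mxE sqrrD.
rewrite !big_split/= -!frob2_pair lerD2r lerD2l -mulr2n lerMn2r/=.
apply: le_trans (ler_norm _) _; rewrite -ler_sqr ?nnegrE ?mulr_ge0 ?nf_ge0//.
rewrite real_normK ?num_real// exprMn !nf_sqr !frob2_pair.
exact: sum_cauchy_schwarz.
Qed.

Lemma nfN m n (A : 'M[R]_(m, n)) : nf (- A) = nf A.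
Proof.
congr Num.sqrt; apply: eq_bigr => i _; apply: eq_bigr => j _.
by rewrite mxE sqrrN.
Qed.

Lemma nfB m n (A B : 'M[R]_(m, n)) : nf (A - B) <= nf A + nf B.
Proof. by rewrite -[nf B]nfN nfD. Qed.

Lemma nf0 m n : nf (0 : 'M[R]_(m, n)) = 0.
Proof.
by rewrite /nf /frob2 big1 ?sqrtr0// => i _; rewrite big1// => j _; rewrite mxE expr0n.
Qed.

Lemma nf_sum m n I (r : seq I) (F : I -> 'M[R]_(m, n)) :
  nf (\sum_(i <- r) F i) <= \sum_(i <- r) nf (F i).
Proof.
elim: r => [|i r ih]; first by rewrite !big_nil nf0.
by rewrite !big_cons (le_trans (nfD _ _))// lerD2l.
Qed.

Lemma nf_tr m n (A : 'M[R]_(m, n)) : nf A^T = nf A.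
Proof.
congr Num.sqrt; rewrite /frob2 exchange_big; apply: eq_bigr => i _.
by apply: eq_bigr => j _; rewrite mxE.
Qed.

Lemma nfZ m n (c : R) (A : 'M[R]_(m, n)) : nf (c *: A) = `|c| * nf A.
Proof.
rewrite /nf (_ : frob2 (c *: A) = c ^+ 2 * frob2 A).
  by rewrite sqrtrM ?sqr_ge0// sqrtr_sqr.
rewrite /frob2 mulr_sumr; apply: eq_bigr => i _; rewrite mulr_sumr.
by apply: eq_bigr => j _; rewrite mxE exprMn.
Qed.

Lemma nfM m n p (A : 'M[R]_(m, n)) (B : 'M[R]_(n, p)) : nf (A *m B) <= nf A * nf B.
Proof.
rewrite frob2_le ?mulr_ge0 ?nf_ge0// exprMn !nf_sqr /frob2 mulr_suml.
apply: ler_sum => i _; rewrite [X in _ * X]exchange_big mulr_sumr.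
by apply: ler_sum => j _; rewrite mxE; exact: sum_cauchy_schwarz.
Qed.

Lemma entry_le_nf m n (A : 'M[R]_(m, n)) i j : `|A i j| <= nf A.
Proof.
rewrite -ler_sqr ?nnegrE ?nf_ge0// nf_sqr real_normK ?num_real//.
rewrite /frob2 (bigD1 i)//= (bigD1 j)//= -addrA lerDl addr_ge0//.
  by apply: sumr_ge0 => k _; exact: sqr_ge0.
by apply: sumr_ge0 => k _; apply: sumr_ge0 => l _; exact: sqr_ge0.
Qed.

Lemma nf_orthonormal m n p (Q : 'M[R]_(m, n)) (A : 'M[R]_(n, p)) :
  Q^T *m Q = 1%:M -> nf (Q *m A) = nf A.
Proof.
move=> QQ; congr Num.sqrt; rewrite -[frob2 A](nf_sqr A) -nf_tr nf_sqr -[frob2 (Q *m A)]nf_sqr -nf_tr nf_sqr.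
by rewrite !frob2E !trmx_mul !trmxK -mulmxA [Q^T *m _]mulmxA QQ mul1mx.
Qed.

Lemma nf_orthonormal_cols m n (Q : 'M[R]_(m, n)) : Q^T *m Q = 1%:M ->
  nf Q = Num.sqrt n%:R.
Proof.
by move=> QQ; rewrite -nf_tr; congr Num.sqrt; rewrite frob2E trmxK QQ mxtrace1.
Qed.

(* Pythagoras for the orthogonal projection [1 - Q Q^T]. *)
Lemma nf_proj m n p (Q : 'M[R]_(m, n)) (A : 'M[R]_(m, p)) : Q^T *m Q = 1%:M ->
  nf (A - Q *m (Q^T *m A)) <= nf A.
Proof.
move=> QQ; rewrite ler_sqrt ?frob2_ge0//.
have tE l k (B : 'M[R]_(l, k)) : frob2 B = \tr (B^T *m B).
  by rewrite -[frob2 B]nf_sqr -nf_tr nf_sqr frob2E trmxK.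
pose B := Q^T *m A.
have -> : (A - Q *m (Q^T *m A)) = A - Q *m B by [].
have eB : (A - Q *m B)^T *m (A - Q *m B) = A^T *m A - B^T *m B.
  have -> : (A - Q *m B)^T = A^T - B^T *m Q^T by rewrite raddfB/= trmx_mul.
  rewrite mulmxBl !mulmxBr -[B^T *m Q^T *m A]mulmxA -/B -[B^T *m Q^T *m _]mulmxA.
  rewrite [Q^T *m (Q *m B)]mulmxA QQ mul1mx subrr subr0.
  by congr (_ - _); rewrite {2}/B trmx_mul trmxK mulmxA.
rewrite !tE eB (raddfB (mxtrace (n:=p))) gerBl.
by have := frob2_ge0 B; rewrite tE.
Qed.

End frobenius_norm.

Section spectral_theorem.
Context {R : realType}.

Lemma frob2_row n (u : 'rV[R]_n) : frob2 u = (u *m u^T) 0 0.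
Proof. by rewrite frob2E /mxtrace big_ord1. Qed.

Lemma frob2_eq0 m n (A : 'M[R]_(m, n)) : (frob2 A == 0) = (A == 0).
Proof.
apply/eqP/eqP => [A0|->].
  apply/matrixP => i j; rewrite mxE; apply/eqP; rewrite -normr_le0.
  by apply: le_trans (entry_le_nf A i j) _; rewrite /nf A0 sqrtr0.
by rewrite -nf_sqr nf0 expr0n.
Qed.

(** The reflection along the difference of the first basis vector and [u] exchanges these two
    vectors of equal norm; when they coincide, the identity serves. *)
Lemma householder n (u : 'rV[R]_n.+1) : u *m u^T = 1%:M ->
  exists H : 'M[R]_n.+1, [/\ H^T = H, H *m H = 1%:M & delta_mx 0 0 *m H = u].
Proof.
move=> uu; pose e : 'rV[R]_n.+1 := delta_mx 0 0.
have ee : e *m e^T = 1%:M by rewrite /e trmx_delta mul_delta_mx; apply/matrixP => i j; rewrite !mxE !ord1.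
have [eu|neu] := eqVneq e u.
  by exists 1%:M; rewrite trmx1 mul1mx mulmx1.
pose w := e - u; pose c := frob2 w.
have c0 : c != 0 by rewrite /c frob2_eq0 subr_eq0.
pose t := 2 / c; pose W := w^T *m w.
have ww : w *m w^T = c%:M by rewrite [LHS]mx11_scalar /c frob2_row.
have WW : W *m W = c *: W.
  by rewrite /W -mulmxA [w *m (_ *m _)]mulmxA ww mul_scalar_mx -scalemxAr.
have eu_ue : u *m e^T = e *m u^T.
  by rewrite -[u *m e^T]trmxK trmx_mul trmxK [RHS]mx11_scalar [X in X^T]mx11_scalar tr_scalar_mx.
have cE : c%:M = 2 *: (e *m w^T) :> 'M[R]_1.
  rewrite -ww /w !(linearB, linearD, mulmxBl, mulmxBr)/= ee uu eu_ue.
  by apply/matrixP => i j; rewrite !mxE; ring.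
exists (1%:M - t *: W); split.
- by rewrite linearB/= linearZ/= trmx1 /W trmx_mul trmxK.
- rewrite mulmxBl !mulmxBr mul1mx mulmx1 mul1mx -scalemxAl -scalemxAr WW !scalerA.
  rewrite (_ : t * t * c = t *+ 2); last by rewrite /t; field.
  by rewrite mulr2n scalerDl opprB addrK subrK.
- rewrite mulmxBr mulmx1 -scalemxAr /W mulmxA -/e.
  have -> : e *m w^T = (c / 2)%:M.
    have : 2^-1 *: c%:M = e *m w^T by rewrite cE scalerA mulVf// scale1r.
    by move=> <-; apply/matrixP => i j; rewrite !mxE mulrC mulrnAl.
  rewrite mul_scalar_mx scalerA (_ : t * _ = 1) ?scale1r ?subKr//.
  by rewrite /t; field.
Qed.

Lemma char_poly_conj n (A H : 'M[R]_n) : H *m H = 1%:M ->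
  char_poly (H *m A *m H) = char_poly A.
Proof.
move=> HH; pose Hp := map_mx (@polyC R) H.
have HpHp : Hp *m Hp = 1%:M by rewrite /Hp -map_mxM HH map_mx1.
rewrite /char_poly (_ : char_poly_mx (H *m A *m H) = Hp *m char_poly_mx A *m Hp).
  by rewrite !det_mulmx mulrAC -det_mulmx HpHp det1 mul1r.
rewrite /char_poly_mx mulmxBr mulmxBl !map_mxM; congr (_ - _).
by rewrite mul_mx_scalar -scalemxAl HpHp scalemx1.
Qed.

Lemma char_poly_block n (x : R) (A : 'M[R]_n) :
  char_poly (block_mx x%:M 0 0 A : 'M[R]_(1 + n)) = ('X - x%:P) * char_poly A.
Proof.
rewrite /char_poly /char_poly_mx map_block_mx !map_mx0.
have -> : 'X%:M = block_mx 'X%:M 0 0 'X%:M :> 'M[{poly R}]_(1 + n) by rewrite -scalar_mx_block.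
rewrite opp_block_mx add_block_mx !oppr0 !addr0 det_ublock; congr (_ * _).
by rewrite det_mx11 !mxE.
Qed.

(* One eigenvalue is deflated at a time by a Householder reflection; no complex
   numbers are needed since the characteristic polynomial is given in split form. *)
Lemma spectral_theorem n (A : 'M[R]_n) (s : seq R) : A^T = A -> spectrum A s ->
  size s = n /\ exists2 O : 'M[R]_n, O^T *m O = 1%:M &
    A = O *m diag_mx (\row_j s`_j) *m O^T.
Proof.
move=> As sA; have sz : size s = n.
  by have := size_char_poly A; rewrite sA size_prod_XsubC => -[].
split=> //; elim: n s A As sA sz => [|n ih] [|x s]//= A As sA sz.
  by exists 1%:M; [rewrite trmx1 mulmx1|apply/matrixP => -[]].
have [v vA v0] : exists2 v : 'rV[R]_n.+1, v *m A = x *: v & v != 0.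
  apply/eigenvalueP; rewrite eigenvalue_root_char sA root_prod_XsubC mem_head//.
have fv : 0 < frob2 v by rewrite lt_neqAle eq_sym frob2_eq0 v0 frob2_ge0.
pose u := (nf v)^-1 *: v.
have nv : nf v != 0 by rewrite gt_eqF// sqrtr_gt0.
have uu : u *m u^T = 1%:M.
  rewrite /u linearZ/= -scalemxAl -scalemxAr scalerA [v *m _]mx11_scalar -frob2_row.
  rewrite scale_scalar_mx -nf_sqr; congr (_%:M); by field.
have uA : u *m A = x *: u by rewrite /u -scalemxAl vA !scalerA mulrC.
have [H [Hs HH eH]] := householder uu.
pose B : 'M[R]_(1 + n) := H *m A *m H.
have Bs : B^T = B by rewrite /B !trmx_mul Hs As mulmxA.
have eB : delta_mx 0 0 *m B = x *: delta_mx 0 0 :> 'rV_(1 + n).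
  by rewrite /B !mulmxA eH uA -scalemxAl -eH -mulmxA HH mulmx1.
have cB : char_poly B = char_poly A by rewrite char_poly_conj.
have AB : A = H *m B *m H.
  by rewrite /B !mulmxA HH mul1mx -mulmxA HH mulmx1.
clearbody B; pose A' := drsubmx B.
have B0 j : B 0 j = x * (j == 0)%:R.
  have := congr1 (fun M : 'rV_(1 + n) => M 0 j) eB.
  by rewrite /= -rowE !mxE eqxx.
(* The first row of [B] is [x] times a basis row, and symmetry transfers this to the first
   column. *)
have BE : B = block_mx x%:M 0 0 A'.
  rewrite -[LHS]submxK; congr block_mx.
  - apply/matrixP => i j; rewrite !ord1 !mxE eqxx (_ : lshift n 0 = 0); last exact/val_inj.
    by rewrite B0 eqxx mulr1.
  - apply/matrixP => i j; rewrite !ord1 !mxE (_ : lshift n 0 = 0); last exact/val_inj.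
    by rewrite B0 mulr0.
  - apply/matrixP => i j; rewrite !ord1 !mxE (_ : lshift n 0 = 0); last exact/val_inj.
    by rewrite -Bs mxE B0 mulr0.
have A's : A'^T = A' by rewrite /A' trmx_drsub Bs.
have sA' : spectrum A' s.
  have : ('X - x%:P) * char_poly A' = ('X - x%:P) * \prod_(y <- s) ('X - y%:P).
    by rewrite -char_poly_block -BE cB sA big_cons.
  by apply: mulfI; rewrite polyXsubC_eq0.
have [Q QQ A'E] := ih _ _ A's sA' (succn_inj sz).
pose Q' : 'M[R]_(1 + n) := block_mx 1%:M 0 0 Q.
have QQ' : Q'^T *m Q' = 1%:M.
  rewrite /Q' tr_block_mx mulmx_block.
  by rewrite !trmx0 !mulmx0 !mul0mx !addr0 !add0r trmx1 mul1mx QQ -scalar_mx_block.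
pose D : 'M[R]_(1 + n) := diag_mx (\row_j (x :: s)`_j).
have DE : D = block_mx x%:M 0 0 (diag_mx (\row_j s`_j)).
  rewrite -[LHS]submxK; congr block_mx; apply/matrixP => i j; rewrite !mxE ?ord1 ?eqxx//.
have BQ : B = Q' *m D *m Q'^T.
  rewrite BE DE /Q' A'E tr_block_mx !mulmx_block.
  by rewrite !trmx0 !mulmx0 !mul0mx !addr0 !add0r trmx1 mul1mx mulmx1 !mul0mx.
exists (H *m Q').
  by rewrite trmx_mul Hs -mulmxA [H *m (H *m _)]mulmxA HH mul1mx.
by rewrite [LHS]AB BQ trmx_mul Hs !mulmxA.
Qed.

End spectral_theorem.

Section eigenvalue_bounds.
Context {R : realType}.

Definition quad n (A : 'M[R]_n) (z : 'rV[R]_n) : R := (z *m A *m z^T) 0 0.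

Lemma quad_diag n (e : 'rV[R]_n) z : quad (diag_mx e) z = \sum_i e 0 i * z 0 i ^+ 2.
Proof.
rewrite /quad mxE; apply: eq_bigr => i _.
by rewrite mul_mx_diag !mxE; ring.
Qed.

Lemma quad_conj n p (A : 'M[R]_n) (Q : 'M[R]_(p, n)) z :
  quad (Q *m A *m Q^T) z = quad A (z *m Q).
Proof. by rewrite /quad trmx_mul !mulmxA. Qed.

Lemma frob2_rowE n (z : 'rV[R]_n) : frob2 z = \sum_i z 0 i ^+ 2.
Proof. by rewrite /frob2 big_ord1. Qed.

Lemma frob2_row_orthonormal n p (Q : 'M[R]_(p, n)) (z : 'rV[R]_p) :
  Q *m Q^T = 1%:M -> frob2 (z *m Q) = frob2 z.
Proof. by move=> QQ; rewrite !frob2_row trmx_mul mulmxA -[z *m Q *m _]mulmxA QQ mulmx1. Qed.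

Lemma exists_left_kernel m n (A : 'M[R]_(m, n)) : (n < m)%N ->
  exists2 z : 'rV[R]_m, z != 0 & z *m A = 0.
Proof.
move=> nm; have : kermx A != 0.
  rewrite kermx_eq0 /row_free; apply/eqP => rA.
  by have := rank_leq_col A; rewrite rA leqNgt nm.
by move=> /rowV0Pn[z /sub_kermxP zA z0]; exists z.
Qed.

(** A space of dimension j + 1 contains a nonzero vector orthogonal to the first [j] eigenvectors,
    and there the quadratic form is at most s_j times the squared norm. *)
Lemma courant_fischer_lower N j (A : 'M[R]_N) (s : seq R) (Q : 'M[R]_(N, j.+1)) (b : R) :
  A^T = A -> spectrum A s -> sorted >=%R s -> Q^T *m Q = 1%:M ->
  (forall z, b * frob2 z <= quad A (z *m Q^T)) -> b <= s`_j.
Proof.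
move=> As sA srt QQ bQ; have [sz [U UU AE]] := spectral_theorem As sA.
have UU' : U *m U^T = 1%:M by apply: mulmx1C.
pose T := Q^T *m U.
have TT : T *m T^T = 1%:M.
  by rewrite /T trmx_mul trmxK !mulmxA -[Q^T *m U *m _]mulmxA UU' mulmx1.
(* Coordinates on the first [j] eigenvectors; [insub] yields a zero column for an index outside
   'I_N. *)
pose T1 : 'M[R]_(j.+1, j) :=
  \matrix_(a, i) (if (insub (nat_of_ord i) : option 'I_N) is Some i' then T a i' else 0).
have [z z0 zT1] := exists_left_kernel T1 (ltnSn j).
have fz : 0 < frob2 z by rewrite lt_neqAle eq_sym frob2_eq0 z0 frob2_ge0.
have zT (i : 'I_N) : (i < j)%N -> (z *m T) 0 i = 0.
  move=> ij; have := congr1 (fun M : 'rV[R]_j => M 0 (Ordinal ij)) zT1.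
  rewrite mxE [RHS]mxE => <-; rewrite mxE; apply: eq_bigr => a _; rewrite [T1 _ _]mxE /=.
  by have -> : (insub (nat_of_ord i) : option 'I_N) = Some i := valK i.
rewrite -(ler_pM2r fz); apply: le_trans (bQ z) _.
rewrite AE quad_conj -mulmxA -/T quad_diag -[X in _ <= _ * X](frob2_row_orthonormal z TT) frob2_rowE mulr_sumr.
apply: ler_sum => i _; rewrite mxE; have [ij|ji] := ltnP i j.
  by rewrite zT// expr0n/= !mulr0.
rewrite ler_wpM2r ?sqr_ge0//.
have := @sorted_leq_nth _ _ (@ge_trans _ R) (@ge_refl _ R) 0 s srt.
by apply => //; rewrite inE sz//; exact: leq_ltn_trans (ltn_ord i).
Qed.

Lemma rank_diag_count n (e : 'rV[R]_n) :
  (#|[set i : 'I_n | e ord0 i != 0%R]%SET| <= \rank (diag_mx e))%N.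
Proof.
set T := [set i | _]%SET; pose Q : 'M[R]_(#|T|, n) := \matrix_(a, i) (enum_val a == i)%:R.
have QdE : Q *m diag_mx e *m Q^T = diag_mx (\row_a e 0 (enum_val a)).
  apply/matrixP => a b; rewrite mxE (bigD1 (enum_val b))//= big1 ?addr0 => [|i ib].
    rewrite mul_mx_diag !mxE eqxx mulr1 (inj_eq enum_val_inj).
    by have [->|_] := eqVneq a b; rewrite ?mul1r ?mulr1n ?mul0r ?mulr0n.
  by rewrite mul_mx_diag !mxE [enum_val b == i]eq_sym (negbTE ib) mulr0.
have : \rank (Q *m diag_mx e *m Q^T) = #|T|.
  rewrite QdE; apply: mxrank_unit; rewrite unitmxE det_diag unitfE.
  apply/prodf_neq0 => a _; rewrite mxE.
  by have := enum_valP a; rewrite inE.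
move=> <-; apply: leq_trans (mxrankM_maxl _ _) _; exact: mxrankM_maxr.
Qed.

Lemma rank_orthonormal N K (Q : 'M[R]_(N, K)) : Q^T *m Q = 1%:M -> \rank Q^T = K.
Proof.
move=> QQ; apply/eqP; rewrite eqn_leq rank_leq_row/=.
by rewrite -{1}(mxrank1 R K) -QQ mxrankM_maxl.
Qed.

Lemma count_nth_card (s : seq R) n (a : pred R) : size s = n ->
  count a s = #|[set i : 'I_n | a s`_i]%SET|.
Proof.
move=> <-; rewrite cardsE cardE size_filter /enum_mem -enumT.
rewrite -{1}(mkseq_nth 0 s) /mkseq count_map -val_enum_ord count_map.
by apply: eq_count => i.
Qed.

(** K nonzero eigenvalues force the rank of [M] to reach K, so its range is the whole span of [Q]. A
    vector of the range has no component along null eigenvectors, and only eigenvalues at least [b]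
    contribute. *)
Lemma nonzero_eigenvalues_quad N K (M : 'M[R]_N) (B : 'M[R]_K) (Q : 'M[R]_(N, K)) (s : seq R) (b : R) :
  Q^T *m Q = 1%:M -> M = Q *m B *m Q^T -> M^T = M -> spectrum M s ->
  count (fun x => x != 0) s = K -> (forall x, x \in s -> x != 0 -> b <= x) ->
  forall z, b * frob2 z <= quad B z.
Proof.
move=> QQ ME Ms sM cK bs z; have [sz [U UU MU]] := spectral_theorem Ms sM.
have UU' : U *m U^T = 1%:M by apply: mulmx1C.
pose D := diag_mx (\row_j s`_j) : 'M[R]_N.
have rM : (K <= \rank M)%N.
  rewrite -{1}cK (count_nth_card _ sz).
  apply: (@leq_trans (\rank D)).
    apply: leq_trans (rank_diag_count _); rewrite subset_leq_card//.
    by apply/fintype.subsetP => i; rewrite !inE mxE.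
  have -> : D = U^T *m M *m U by rewrite MU !mulmxA UU mul1mx -mulmxA UU mulmx1.
  by apply: leq_trans (mxrankM_maxl _ _) _; exact: mxrankM_maxr.
have MQ : (M <= Q^T)%MS by rewrite ME; exact: submxMl.
have QM : (Q^T <= M)%MS.
  have := mxrank_leqif_sup MQ; rewrite rank_orthonormal// => -[_ <-].
  by apply/eqP/anti_leq; rewrite rM andbT -[X in (_ <= X)%N](rank_orthonormal QQ) mxrankS.
have /submxP[t tE] : (z *m Q^T <= M)%MS by apply: submx_trans (submxMl _ _) QM.
have -> : quad B z = quad M (z *m Q^T).
  by rewrite ME quad_conj -mulmxA QQ mulmx1.
have QQt : Q^T *m (Q^T)^T = 1%:M by rewrite trmxK.
rewrite -(frob2_row_orthonormal z QQt) MU quad_conj quad_diag.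
rewrite -(frob2_row_orthonormal (z *m Q^T) UU') frob2_rowE mulr_sumr.
apply: ler_sum => i _; rewrite !mxE -/(s`_i).
set c := \sum_j _; have [si|si] := eqVneq s`_i 0; last first.
  by rewrite ler_wpM2r ?sqr_ge0// bs// mem_nth ?sz.
suff -> : c = 0 by rewrite expr0n/= !mulr0.
have -> : c = (z *m Q^T *m U) 0 i by rewrite mxE.
have -> : z *m Q^T *m U = t *m U *m D by rewrite tE MU -!mulmxA UU mulmx1.
by rewrite mul_mx_diag !mxE si mulr0.
Qed.

End eigenvalue_bounds.

Section perturbation.
Context {R : realType}.

Lemma quad_nf n (A : 'M[R]_n) z : `|quad A z| <= nf A * frob2 z.
Proof.
apply: le_trans (entry_le_nf _ 0 0) _; rewrite -nf_sqr expr2 mulrA.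
apply: le_trans (nfM _ _) _; rewrite nf_tr ler_wpM2r ?nf_ge0//.
by apply: le_trans (nfM _ _) _; rewrite mulrC.
Qed.

Lemma quadD n (A B : 'M[R]_n) z : quad (A + B) z = quad A z + quad B z.
Proof. by rewrite /quad mulmxDr mulmxDl mxE. Qed.

Lemma quadZ n t (A : 'M[R]_n) z : quad (t *: A) z = t * quad A z.
Proof. by rewrite /quad -scalemxAr -scalemxAl mxE. Qed.

Lemma nf_col_scale m n (X : 'M[R]_(m, n)) (v : 'rV[R]_n) (b : R) : 0 < b ->
  (forall j, b <= v 0 j) -> nf X <= b^-1 * nf (X *m diag_mx v).
Proof.
move=> b0 bv; rewrite ler_pdivlMl//.
rewrite -{1}(gtr0_norm b0) -nfZ frob2_le ?nf_ge0// nf_sqr; apply: ler_sum => i _; apply: ler_sum => j _.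
rewrite mul_mx_diag !mxE [b * _]mulrC !exprMn ler_wpM2l ?sqr_ge0//.
by rewrite ler_pXn2r// nnegrE ?ltW// (lt_le_trans b0).
Qed.

Lemma invmx_diag n (v : 'rV[R]_n) : (forall j, v 0 j != 0) ->
  invmx (diag_mx v) = diag_mx (\row_j (v 0 j)^-1).
Proof.
move=> v0; have u : diag_mx v *m diag_mx (\row_j (v 0 j)^-1) = 1%:M.
  apply/matrixP => i j; rewrite mul_diag_mx !mxE.
  by case: eqP => [->|_]; rewrite ?mulr1n ?mulr0n ?mulr0// divff.
have [du _] := mulmx1_unit u.
by rewrite -[LHS]mulmx1 -u mulmxA mulVmx// mul1mx.
Qed.

Lemma sub_proj_mul N K p (Psi : 'M[R]_(N, K)) (A : 'M[R]_(K, p)) (e : 'M[R]_(N, p)) :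
  Psi^T *m Psi = 1%:M ->
  (Psi *m A + e) - Psi *m (Psi^T *m (Psi *m A + e)) = e - Psi *m (Psi^T *m e).
Proof.
move=> PP; rewrite mulmxDr [Psi^T *m (Psi *m A)]mulmxA PP mul1mx mulmxDr.
by rewrite opprD addrACA subrr add0r.
Qed.

Lemma add4_sub_cancel (V : zmodType) (x y z w : V) :
  (x + y) + (z + w) - x = y + z + w.
Proof. by rewrite addrAC [x + y]addrC addrK addrA. Qed.

Definition lead_proj K j : 'M[R]_(K, j.+1) := \matrix_(i, l) (i == l :> nat)%:R.

Lemma lead_proj_orthonormal K j : (j < K)%N ->
  (lead_proj K j)^T *m lead_proj K j = 1%:M.
Proof.
move=> jK; apply/matrixP => a b; rewrite !mxE.
have aK : (a < K)%N by apply: leq_trans (ltn_ord a) _.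
rewrite (bigD1 (Ordinal aK))//= big1 ?addr0 => [|i ia].
  by rewrite !mxE /= eqxx mul1r.
rewrite !mxE (_ : (i == a :> nat) = false) ?mul0r//.
by apply: contra_neqF ia => /eqP ia; exact/val_inj.
Qed.

(** Courant-Fischer on the columns of [Psi *m F]: there the unperturbed form is that of [B], and the
    perturbation costs at most [eps] per unit of squared norm. *)
Lemma top_eigenvalue_lower N K (j : nat) (Mh : 'M[R]_N) (s : seq R)
    (Psi : 'M[R]_(N, K)) (B : 'M[R]_K) (F : 'M[R]_(K, j.+1)) (b eps : R) :
  Mh^T = Mh -> spectrum Mh s -> sorted >=%R s -> Psi^T *m Psi = 1%:M ->
  F^T *m F = 1%:M -> nf (Mh - Psi *m B *m Psi^T) <= eps ->
  (forall z, b * frob2 z <= quad B (z *m F^T)) -> b - eps <= s`_j.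
Proof.
move=> Ms sM srt PP FF Me bB.
have QQ : (Psi *m F)^T *m (Psi *m F) = 1%:M.
  by rewrite trmx_mul !mulmxA -[F^T *m _ *m _]mulmxA PP mulmx1.
apply: (courant_fischer_lower Ms sM srt QQ) => z.
have QQt : (Psi *m F)^T *m ((Psi *m F)^T)^T = 1%:M by rewrite trmxK.
rewrite -[Mh](subrK (Psi *m B *m Psi^T)) quadD quad_conj.
have -> : z *m (Psi *m F)^T *m Psi = z *m F^T.
  by rewrite trmx_mul !mulmxA -mulmxA PP mulmx1.
have := quad_nf (Mh - Psi *m B *m Psi^T) (z *m (Psi *m F)^T).
rewrite (frob2_row_orthonormal z QQt) ler_norml => /andP[h _].
have := ler_wpM2r (frob2_ge0 z) Me.
by have := bB z; lra.
Qed.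

Variables (K k0 : nat) (C0 b0 : R).
Hypothesis C0_ge0 : 0 <= C0.
Hypothesis b0_gt0 : 0 < b0.

(* Lipschitz constants, with respect to the size [de] of the estimation errors, of
   the residual, of the rotation, etc; [pcst] dominates all of them, and [pcst * de
   <= 1] is the event on which the perturbation bounds hold. *)
Definition pc1 : R := k0%:R * (4 * C0 + 4).
Definition pc2 : R := (b0 / 2)^-1 * (k0%:R * (C0 + 2) * K%:R).
Definition pc3 : R := (b0 / 2)^-1 * (k0%:R * (2 * C0 + 1) * K%:R + K%:R * pc1).
Definition pcst : R := 1 + 2 / b0 * pc1 + pc1 + K%:R * pc1 + pc2 + pc2 ^+ 2 + pc3.

Let pc1_ge0 : 0 <= pc1.
Proof. by rewrite mulr_ge0// addr_ge0// mulr_ge0. Qed.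

Let pc2_ge0 : 0 <= pc2.
Proof.
apply: mulr_ge0; first by rewrite invr_ge0 divr_ge0 ?(ltW b0_gt0).
by apply: mulr_ge0 => //; apply: mulr_ge0 => //; rewrite addr_ge0.
Qed.

Let pc3_ge0 : 0 <= pc3.
Proof.
apply: mulr_ge0; first by rewrite invr_ge0 divr_ge0 ?(ltW b0_gt0).
apply: addr_ge0; last exact: mulr_ge0.
by apply: mulr_ge0 => //; apply: mulr_ge0 => //; rewrite addr_ge0// mulr_ge0.
Qed.

Let pieces_ge0 : [/\ 0 <= 2 / b0 * pc1, 0 <= K%:R * pc1 & 0 <= pc2 ^+ 2].
Proof.
split; [|exact: mulr_ge0|exact: sqr_ge0].
by apply: mulr_ge0 => //; rewrite divr_ge0 ?(ltW b0_gt0).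
Qed.

Lemma pcst_gt0 : 0 < pcst.
Proof.
have [h1 h2 h3] := pieces_ge0; move: pc1_ge0 pc2_ge0 pc3_ge0 => h4 h5 h6.
by rewrite /pcst; lra.
Qed.

Lemma pc_ge0 : [/\ 0 <= pc1, 0 <= pc2 & 0 <= pc3].
Proof. by split; [exact: pc1_ge0|exact: pc2_ge0|exact: pc3_ge0]. Qed.

Lemma pc2_lt1 de : 0 <= de -> pcst * de <= 1 -> pc2 * de < 1.
Proof.
rewrite le_eqVlt => /predU1P[<-|de0] de1; first by rewrite mulr0.
apply: lt_le_trans de1; rewrite ltr_pM2r//.
have [h1 h2 h3] := pieces_ge0; move: pc1_ge0 pc2_ge0 pc3_ge0 => h4 h5 h6.
by rewrite /pcst; lra.
Qed.

Variables (N : nat) (Psi U : 'M[R]_(N, K)) (g c : nat -> 'M[R]_(K, N)) (e : nat -> 'M[R]_N).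
Variables (v : 'rV[R]_K) (s : seq R) (t de : R).
(** One frozen realisation: [Sk] is a scaled sample autocovariance, [c] the population value of [g],
    [U] the sample eigenvectors. The factor [t] stands for N^2, as the ordered spectrum is given for
    the unscaled matrix. *)
Let Sk k := Psi *m g k + e k.
Let mh := \sum_(1 <= k < k0.+1) Sk k *m (Sk k)^T.
Let a := \sum_(1 <= k < k0.+1) c k *m (c k)^T.
Let q := Psi^T *m U.
Let r := U - Psi *m q.
Hypothesis PP : Psi^T *m Psi = 1%:M.
Hypothesis UU : U^T *m U = 1%:M.
Hypothesis t0 : 0 < t.
Hypothesis mhs : spectrum (t *: mh) s.
Hypothesis srt : sorted >=%R s.
Hypothesis vs : forall j : 'I_K, v 0 j = t^-1 * s`_j.
Hypothesis mhU : mh *m U = U *m diag_mx v.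
Hypothesis ab0 : forall z, b0 * frob2 z <= quad a z.
Hypothesis de0 : 0 <= de.
Hypothesis de1 : pcst * de <= 1.
Hypothesis cC0 : forall k, (0 < k <= k0)%N -> nf (c k) <= C0.
Hypothesis ede : forall k, (0 < k <= k0)%N -> nf (e k) <= de.
Hypothesis gde : forall k, (0 < k <= k0)%N -> nf (g k - c k) <= de.

Let de_le1 : de <= 1.
Proof.
have [h1 h2 h3] := pieces_ge0; move: pc1_ge0 pc2_ge0 pc3_ge0 => h4 h5 h6.
apply: le_trans de1; rewrite ler_peMl// /pcst; lra.
Qed.

Let nf_sum_le m n (F : nat -> 'M[R]_(m, n)) (b : R) :
  (forall k, (0 < k <= k0)%N -> nf (F k) <= b) ->
  nf (\sum_(1 <= k < k0.+1) F k) <= k0%:R * b.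
Proof.
move=> Fb; apply: le_trans (nf_sum _ _) _.
have -> : k0%:R * b = \sum_(1 <= k < k0.+1) b.
  by rewrite sumr_const_nat subSS subn0 mulr_natl.
by apply: ler_sum_nat => k; rewrite ltnS; exact: Fb.
Qed.

(** Each [Sk] is Psi c_k plus a remainder of norm at most 2 de. The two cross terms cost 2 C0 de
    each and the square 4 de^2 <= 4 de, which explains [pc1]. *)
Lemma nf_mh_sub : nf (mh - Psi *m a *m Psi^T) <= pc1 * de.
Proof.
rewrite /mh /a mulmx_sumr mulmx_suml -sumrB /pc1 -mulrA.
apply: nf_sum_le => k kk; pose rk := Psi *m (g k - c k) + e k.
have rde : nf rk <= 2 * de.
  apply: le_trans (nfD _ _) _; rewrite nf_orthonormal//.
  by have := gde kk; have := ede kk; lra.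
have SE : Sk k = Psi *m c k + rk.
  by rewrite /rk /Sk mulmxBr addrA [Psi *m c k + _]addrC subrK.
have -> : Sk k *m (Sk k)^T - Psi *m (c k *m (c k)^T) *m Psi^T =
    (Psi *m c k) *m rk^T + rk *m (Psi *m c k)^T + rk *m rk^T.
  rewrite SE [(_ + rk)^T]linearD/= mulmxDl !mulmxDr trmx_mul !mulmxA.
  exact: add4_sub_cancel.
have pc : nf (Psi *m c k) <= C0 by rewrite nf_orthonormal// cC0.
have rr0 := nf_ge0 rk; have pc0 := nf_ge0 (Psi *m c k).
have h1 : nf ((Psi *m c k) *m rk^T) <= C0 * (2 * de).
  by apply: le_trans (nfM _ _) _; rewrite nf_tr ler_pM.
have h2 : nf (rk *m (Psi *m c k)^T) <= C0 * (2 * de).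
  by apply: le_trans (nfM _ _) _; rewrite nf_tr mulrC ler_pM.
have h3 : nf (rk *m rk^T) <= 4 * de.
  apply: le_trans (nfM _ _) _; rewrite nf_tr.
  apply: (@le_trans _ _ ((2 * de) * (2 * de))); first by rewrite ler_pM.
  rewrite (_ : 2 * de * (2 * de) = 4 * (de * de)); last by ring.
  by rewrite ler_wpM2l// ler_piMl.
apply: le_trans (nfD _ _) _; have := nfD ((Psi *m c k) *m rk^T) (rk *m (Psi *m c k)^T).
by lra.
Qed.

Lemma nf_gg_sub :
  nf (\sum_(1 <= k < k0.+1) g k *m (g k)^T - a) <= k0%:R * (2 * C0 + 1) * de.
Proof.
rewrite /a -sumrB -mulrA; apply: nf_sum_le => k kk; pose rk := g k - c k.
have rde : nf rk <= de by exact: gde.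
have -> : g k *m (g k)^T - c k *m (c k)^T = c k *m rk^T + rk *m (c k)^T + rk *m rk^T.
  have -> : g k = c k + rk by rewrite /rk addrC subrK.
  rewrite [(_ + rk)^T]linearD/= mulmxDl !mulmxDr.
  exact: add4_sub_cancel.
have cc := cC0 kk; have rr0 := nf_ge0 rk; have pc0 := nf_ge0 (c k).
have h1 : nf (c k *m rk^T) <= C0 * de.
  by apply: le_trans (nfM _ _) _; rewrite nf_tr ler_pM.
have h2 : nf (rk *m (c k)^T) <= C0 * de.
  by apply: le_trans (nfM _ _) _; rewrite nf_tr mulrC ler_pM.
have h3 : nf (rk *m rk^T) <= de.
  apply: le_trans (nfM _ _) _; rewrite nf_tr.
  by apply: (@le_trans _ _ (de * de)); [rewrite ler_pM|rewrite ler_piMl].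
apply: le_trans (nfD _ _) _; have := nfD (c k *m rk^T) (rk *m (c k)^T).
by lra.
Qed.

Lemma eigenvalue_lower j (F : 'M[R]_(K, j.+1)) (b : R) (jK : (j < K)%N) :
  F^T *m F = 1%:M -> (forall z, b * frob2 z <= quad a (z *m F^T)) ->
  b - pc1 * de <= v 0 (Ordinal jK).
Proof.
move=> FF bF; rewrite vs ler_pdivlMl// mulrBr.
have mhsym : (t *: mh)^T = t *: mh.
  rewrite linearZ/= /mh linear_sum/=; congr (_ *: _); apply: eq_bigr => k _.
  by rewrite trmx_mul trmxK.
apply: (top_eigenvalue_lower (B := t *: a) mhsym mhs srt PP FF).
  rewrite -scalemxAr -scalemxAl -scalerBr nfZ gtr0_norm// ler_wpM2l ?(ltW t0)//.
  exact: nf_mh_sub.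
by move=> z; rewrite quadZ -mulrA ler_wpM2l ?(ltW t0).
Qed.

(** The summand [2 / b0 * pc1] of [pcst] keeps the perturbation of the eigenvalues below b0/2. *)
Lemma eigenvalue_half j : b0 / 2 <= v 0 j.
Proof.
case: j => j jK.
have := @eigenvalue_lower j (lead_proj K j) b0 jK (lead_proj_orthonormal jK).
have FFt : (lead_proj K j)^T *m ((lead_proj K j)^T)^T = 1%:M.
  by rewrite trmxK lead_proj_orthonormal.
have h z : b0 * frob2 z <= quad a (z *m (lead_proj K j)^T).
  by rewrite -(frob2_row_orthonormal z FFt).
move=> /(_ h); apply: le_trans.
have : 2 / b0 * pc1 * de <= 1.
  apply: le_trans de1; rewrite ler_wpM2r// /pcst.
  have [h1 h2 h3] := pieces_ge0; move: pc1_ge0 pc2_ge0 pc3_ge0 => h4 h5 h6; lra.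
rewrite -mulrA mulrAC ler_pdivrMr// mul1r => h'.
by move: b0_gt0 => hb; lra.
Qed.

Let half0 : 0 < b0 / 2. Proof. by rewrite divr_gt0. Qed.

Let nfU : nf U = Num.sqrt K%:R. Proof. exact: nf_orthonormal_cols. Qed.
Let sqrtK : Num.sqrt K%:R <= K%:R :> R.
Proof.
case: K => [|k]; first by rewrite sqrtr0.
rewrite -[leRHS]ger0_norm// -sqrtr_sqr ler_sqrt ?sqr_ge0// expr2 -natrM ler_nat.
by rewrite leq_pmulr.
Qed.

Lemma nf_q : nf q <= K%:R.
Proof.
apply: le_trans (nfM _ _) _; rewrite nf_tr nfU (nf_orthonormal_cols PP).
by rewrite -expr2 sqr_sqrtr.
Qed.

(** Multiplied by the eigenvalues, [r] becomes the projection of mh U off the span of [Psi]. This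
    annihilates every Psi g_k and leaves only terms with a factor e_k; dividing by eigenvalues at
    least b0/2 gives a bound linear in [de]. *)
Lemma nf_resid : nf r <= pc2 * de.
Proof.
apply: le_trans (nf_col_scale _ half0 eigenvalue_half) _.
rewrite /pc2 -[leRHS]mulrA ler_wpM2l ?invr_ge0 ?(ltW half0)//.
have Skb k : (0 < k <= k0)%N -> nf (Sk k) <= C0 + 2.
  move=> kk; apply: le_trans (nfD _ _) _; rewrite nf_orthonormal//.
  have := nfD (g k - c k) (c k); rewrite subrK.
  by have := gde kk; have := ede kk; have := cC0 kk; move: de_le1 => hd; lra.
pose Y := \sum_(1 <= k < k0.+1) e k *m ((Sk k)^T *m U).
have -> : r *m diag_mx v = Y - Psi *m (Psi^T *m Y).
  rewrite /r /q mulmxBl -!mulmxA -mhU.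
  have -> : mh *m U = Psi *m (\sum_(1 <= k < k0.+1) g k *m ((Sk k)^T *m U)) + Y.
    rewrite /mh mulmx_suml mulmx_sumr -big_split/=; apply: eq_bigr => k _.
    by rewrite -mulmxA {1}/Sk mulmxDl !mulmxA.
  exact: sub_proj_mul.
apply: le_trans (nf_proj _ PP) _.
have -> : k0%:R * (C0 + 2) * K%:R * de = k0%:R * (de * ((C0 + 2) * K%:R)) by ring.
apply: nf_sum_le => k kk; apply: le_trans (nfM _ _) _.
rewrite ler_pM ?nf_ge0 ?ede//; apply: le_trans (nfM _ _) _.
by rewrite nf_tr ler_pM ?nf_ge0 ?Skb ?nfU.
Qed.

(** Apply [Psi^T] to the eigenvector equation of [mh]; replacing [mh] by its population counterpart
    is the only error. *)
Lemma nf_approx_eigen : nf (a *m q - q *m diag_mx v) <= K%:R * pc1 * de.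
Proof.
have -> : a *m q - q *m diag_mx v = - (Psi^T *m ((mh - Psi *m a *m Psi^T) *m U)).
  rewrite mulmxBl mhU mulmxBr opprB /q !mulmxA PP mul1mx.
  by rewrite -!mulmxA.
rewrite nfN; apply: le_trans (nfM _ _) _; rewrite nf_tr (nf_orthonormal_cols PP).
have h := nfM (mh - Psi *m a *m Psi^T) U; rewrite nfU in h.
apply: le_trans (ler_wpM2l (sqrtr_ge0 _) h) _.
rewrite mulrCA -expr2 sqr_sqrtr// mulrC -mulrA ler_wpM2l//.
exact: nf_mh_sub.
Qed.

(** Pythagoras: U has orthonormal columns and splits into the orthogonal parts Psi q and [r]. *)
Lemma qq_sub : q^T *m q - 1%:M = - (r^T *m r).
Proof.
have Pr : Psi^T *m r = 0 by rewrite /r mulmxBr mulmxA PP mul1mx subrr.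
have UE : U = Psi *m q + r by rewrite /r addrC subrK.
have gen (q' : 'M[R]_K) (r' : 'M[R]_(N, K)) : Psi^T *m r' = 0 ->
    (Psi *m q' + r')^T *m (Psi *m q' + r') = q'^T *m q' + r'^T *m r'.
  move=> Pr'; rewrite [(_ + r')^T]linearD/= mulmxDl !mulmxDr trmx_mul.
  rewrite -[q'^T *m Psi^T *m r']mulmxA Pr' mulmx0 addr0.
  have -> : r'^T *m (Psi *m q') = 0.
    by rewrite mulmxA -[r'^T *m Psi]trmxK trmx_mul trmxK Pr' trmx0 mul0mx.
  by rewrite add0r -[q'^T *m _ *m _]mulmxA [Psi^T *m (_ *m _)]mulmxA PP mul1mx.
have := gen q r Pr; rewrite -UE UU => ->.
by rewrite opprD addrA subrr add0r.
Qed.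

Lemma nf_qq_sub : nf (q^T *m q - 1%:M) <= pc2 ^+ 2 * de.
Proof.
rewrite qq_sub nfN; apply: le_trans (nfM _ _) _; rewrite nf_tr.
apply: (@le_trans _ _ ((pc2 * de) * (pc2 * de))).
  by rewrite ler_pM ?nf_ge0 ?nf_resid.
rewrite (_ : _ * _ = pc2 ^+ 2 * (de * de)); last by ring.
by rewrite ler_wpM2l ?sqr_ge0// ler_piMl.
Qed.

(** A row [z] killed by q' would satisfy |z r'| = |z|, impossible for a residual of norm below
    one. *)
Lemma q_unit : pc2 * de < 1 -> q \in unitmx.
Proof.
move=> r1; rewrite -unitmx_tr -row_free_unit -kermx_eq0; apply: contraLR isT => /=.
move=> /rowV0Pn[z /sub_kermxP zq z0].
have fz : 0 < frob2 z by rewrite lt_neqAle eq_sym frob2_eq0 z0 frob2_ge0.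
have e1 : z *m (q^T *m q) *m z^T = 0 by rewrite mulmxA zq !mul0mx.
have : z *m (q^T *m q - 1%:M) *m z^T = - (z *m z^T).
  by rewrite mulmxBr mulmxBl e1 sub0r mulmx1.
rewrite qq_sub mulmxN mulNmx => /oppr_inj/(congr1 (fun M : 'M[R]_1 => M 0 0)).
rewrite -frob2_row (_ : z *m _ *m _ = (z *m r^T) *m (z *m r^T)^T); last first.
  by rewrite trmx_mul trmxK !mulmxA.
rewrite -frob2_row => h.
have : nf (z *m r^T) <= nf z * (pc2 * de).
  by apply: le_trans (nfM _ _) _; rewrite nf_tr ler_wpM2l ?nf_ge0// nf_resid.
have nz : 0 < nf z by rewrite sqrtr_gt0.
rewrite /nf h -/(nf z) => h2; have : nf z * (pc2 * de) < nf z by rewrite gtr_pMr.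
by lra.
Qed.

(** Multiplied by diag(v), the difference is the error of the Gram sum against [a], applied to [q],
    plus the defect in the approximate eigenvector equation. *)
Lemma nf_rotation_sub :
  nf ((\sum_(1 <= k < k0.+1) g k *m (g k)^T) *m q *m invmx (diag_mx v) - q) <= pc3 * de.
Proof.
have v0 j : v 0 j != 0 by rewrite gt_eqF// (lt_le_trans half0)// eigenvalue_half.
have du : diag_mx v \in unitmx.
  by rewrite unitmxE det_diag unitfE; apply/prodf_neq0 => j _.
apply: le_trans (nf_col_scale _ half0 eigenvalue_half) _.
rewrite /pc3 -[leRHS]mulrA ler_wpM2l ?invr_ge0 ?(ltW half0)//.
set G := \sum_(_ <= _ < _) _.
have -> : (G *m q *m invmx (diag_mx v) - q) *m diag_mx v =
    (G - a) *m q + (a *m q - q *m diag_mx v).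
  by rewrite mulmxBl -[_ *m invmx _ *m _]mulmxA mulVmx// mulmx1 mulmxBl addrA subrK.
apply: le_trans (nfD _ _) _; rewrite mulrDl lerD ?nf_approx_eigen//.
apply: le_trans (nfM _ _) _; rewrite [leRHS]mulrAC ler_pM ?nf_ge0 ?nf_q//.
exact: nf_gg_sub.
Qed.

End perturbation.

Section eigenvector_selection.
Context {R : realType}.

Lemma inj_le_id K (f : 'I_K -> 'I_K) : injective f -> (forall j, (f j <= j)%N) ->
  forall j, f j = j.
Proof.
move=> fi fle; suff h n (j : 'I_K) : (j < n)%N -> f j = j by move=> j; exact: (h j.+1).
elim: n j => // n ih j; rewrite ltnS leq_eqVlt => /predU1P[jn|]; last exact: ih.
have := fle j; rewrite leq_eqVlt => /predU1P[/val_inj//|fj].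
by have /fi := ih (f j) (leq_trans fj (eq_leq jn)).
Qed.

Lemma strict_gap K (al : 'rV[R]_K) : (forall i j : 'I_K, (i < j)%N -> al 0 j < al 0 i) ->
  exists2 gap : R, 0 < gap <= 1 & forall i j : 'I_K, (i < j)%N -> al 0 j + gap <= al 0 i.
Proof.
move=> al_dec; pose d (p : 'I_K * 'I_K) := al 0 p.1 - al 0 p.2.
exists (\big[Num.min/1]_(p : 'I_K * 'I_K | (p.1 < p.2)%N) d p).
  apply/andP; split; last exact: bigmin_le_id.
  by apply: lt_bigmin => // p pp; rewrite subr_gt0 al_dec.
move=> i j ij; rewrite -lerBrDl.
exact: (bigmin_le_cond (j := (i, j)) 1 d ij).
Qed.

(** These signs make the diagonal of E' q nonnegative. A zero entry gets 1, so that every outcome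
    yields a vector of signs. *)
Definition sign_mx K (E q : 'M[R]_K) : 'rV[R]_K :=
  \row_j (if 0 <= (E^T *m q) j j then 1 else -1).

(* [p = E^T q] is nearly orthogonal and each of its columns [j] has a single entry
   that is not small, in a row [f j]; [f] is injective, and the lower bounds on the
   eigenvalues force [f j <= j], hence [f = id]. *)
Lemma eigenvector_selection K (al : 'rV[R]_K) (A E : 'M[R]_K) (eta : R) :
  E^T *m E = 1%:M -> A = E *m diag_mx al *m E^T ->
  (forall i j : 'I_K, (i < j)%N -> al 0 j < al 0 i) -> 0 < eta ->
  exists2 de : R, 0 < de & forall q v,
    nf (A *m q - q *m diag_mx v) <= de -> nf (q^T *m q - 1%:M) <= de ->
    (forall j, al 0 j - de <= v 0 j) ->
    forall i j, `|(q *m diag_mx (sign_mx E q) - E) i j| <= eta.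
Proof.
move=> EE AE al_dec eta0.
have EE' : E *m E^T = 1%:M by exact: mulmx1C.
have [gap /andP[gap0 gap1] gapP] := strict_gap al_dec.
case: K al A E EE AE al_dec EE' gapP => [|K0] al A E EE AE al_dec EE' gapP.
  by exists 1 => // q v _ _ _ [].
set K := K0.+1; pose k : R := K%:R.
have k1 : 1 <= k by rewrite ler1n.
(* Threshold for a large entry: if the k squares in a column were all at most [ka], its squared norm
   would be at most 1/2. *)
pose ka := (2 * k)^-1.
have ka0 : 0 < ka by rewrite invr_gt0; lra.
have ka1 : ka <= 1 by rewrite invf_le1; lra.
pose et := eta / k.
have et0 : 0 < et by rewrite divr_gt0//; lra.
(* Three roles: th <= ka^2/2 separates small sums from a product of two large entries, th <= eta/k
   absorbs the final sum over k entries, th <= 1/2 keeps squared column norms above 1/2. *)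
pose th := Num.min (ka ^+ 2 / 2) (Num.min et 2^-1).
have th0 : 0 < th by rewrite !lt_min et0 divr_gt0 ?exprn_gt0//= invr_gt0.
have th_ka : th <= ka ^+ 2 / 2 by rewrite ge_min lexx.
have th_et : th <= et by rewrite !ge_min lexx orbT.
have th_2 : th <= 2^-1 by rewrite !ge_min lexx !orbT.
pose rho := th / (2 * (k + 1)).
(* Dividing an error [de] by an eigenvalue distance of at least gap/2 leaves an entry of size at
   most [rho]. *)
pose de := gap * rho / 2.
have rho0 : 0 < rho by rewrite divr_gt0//; lra.
have krho : k * rho <= th / 2.
  rewrite /rho mulrA ler_pdivrMr; last by lra.
  by have := mulr_ge0 (ltW th0) (ler0n R 1); nra.
have rho1 : rho <= 1 by have := ler_peMl (ltW rho0) k1; lra.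
have de0 : 0 < de by rewrite divr_gt0// mulr_gt0.
have de_rho : de <= rho / 2.
  by rewrite /de ler_pM2r ?invr_gt0// ler_piMl// ltW.
have rho2 : k * rho ^+ 2 <= th / 2.
  by apply: le_trans krho; rewrite expr2 mulrA ler_piMr// mulr_ge0 ?(ltW rho0)//; lra.
have rho_th : rho <= th / 2 by apply: le_trans krho; rewrite ler_peMl// ltW.
exists de => // q v Aq qq vlow.
pose p := E^T *m q.
have pp : p^T *m p = q^T *m q by rewrite /p trmx_mul trmxK mulmxA -[_ *m E *m _]mulmxA EE' mulmx1.
(* In the basis [E], the approximate eigenvector equation reads entrywise: (al_i - v_j) p_ij is at
   most [de] in absolute value. *)
have ent i j : `|(al 0 i - v 0 j) * p i j| <= de.
  have e1 : diag_mx al *m p - p *m diag_mx v = E^T *m (A *m q - q *m diag_mx v).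
    rewrite mulmxBr AE /p !mulmxA EE mul1mx; congr (_ - _).
  have := entry_le_nf (diag_mx al *m p - p *m diag_mx v) i j.
  have -> : (diag_mx al *m p - p *m diag_mx v) i j = (al 0 i - v 0 j) * p i j.
    rewrite mxE [X in _ + X]mxE mul_diag_mx mul_mx_diag [X in X - _]mxE [X in _ - X]mxE.
    by ring.
  move/le_trans; apply; rewrite e1 nf_orthonormal ?trmxK//.
have col j j' : `|\sum_i p i j * p i j' - (j == j')%:R| <= de.
  have := entry_le_nf (q^T *m q - 1%:M) j j'; rewrite -pp => h.
  apply: le_trans (le_trans h _); last by rewrite pp.
  rewrite mxE [X in _ <= `|_ + X|]mxE [X in _ <= `|_ - X|]mxE.
  rewrite le_eqVlt; apply/orP; left; apply/eqP; congr `|_ - _|.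
  by rewrite mxE; apply: eq_bigr => i _; rewrite [p^T _ _]mxE.
have colsq j : `|\sum_i p i j ^+ 2 - 1| <= de.
  have := col j j; rewrite eqxx; under eq_bigr do rewrite -expr2; by [].
have /choice[sg sgP] : forall j : 'I_K, exists i : 'I_K, ka <= `|p i j|.
  move=> j; apply: contrapT => /forallNP h.
  have lt i : p i j ^+ 2 <= ka.
    have := h i => /negP; rewrite -ltNge => hi.
    rewrite -real_normK ?num_real//.
    apply: (@le_trans _ _ (ka * 1)); last by rewrite mulr1.
    rewrite expr2.
    by apply: ler_pM => //; [exact: ltW|apply: ltW; apply: lt_le_trans ka1].
  have : \sum_i p i j ^+ 2 <= \sum_(i : 'I_K) ka by apply: ler_sum => i _; exact: lt.
  rewrite sumr_const card_ord -mulr_natl -/k.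
  have -> : k * ka = 2^-1 by rewrite /ka; field; lra.
  by have := colsq j; rewrite ler_norml => /andP[? ?]; lra.
have near j : `|al 0 (sg j) - v 0 j| <= gap / 2.
  have := ent (sg j) j; rewrite normrM => h.
  have h2 : `|al 0 (sg j) - v 0 j| * ka <= de.
    by apply: le_trans h; rewrite ler_wpM2l.
  rewrite -(ler_pM2r ka0); apply: le_trans h2 _.
  have -> : de = gap / 2 * rho by rewrite /de; ring.
  rewrite ler_pM2l ?divr_gt0//; apply: le_trans rho_th _.
  have : ka ^+ 2 <= ka by rewrite expr2 ler_piMl// ltW.
  by lra.
(* If sg j > j, the eigenvalue at sg j is at most al_j - gap, yet it lies within gap/2 of v_j >=
   al_j - de, and de < gap/2. *)
have sg_le j : (sg j <= j)%N.
  rewrite leqNgt; apply/negP => /gapP; have := near j; have := vlow j.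
  rewrite ler_norml => h1 /andP[h2 h3].
  have : de < gap / 2 by rewrite /de; nra.
  lra.
have off i j : i != sg j -> `|p i j| <= rho.
  move=> ij; have far : gap / 2 <= `|al 0 i - v 0 j|.
    have := near j; rewrite ler_norml => /andP[n1 n2].
    have [lt|lt|eq] := ltngtP i (sg j).
    - have := gapP _ _ lt => h; apply: le_trans (ler_norm _); lra.
    - have := gapP _ _ lt => h; rewrite distrC; apply: le_trans (ler_norm _); lra.
    - by move/eqP: ij => /(_ (val_inj eq)).
  have := ent i j; rewrite normrM => h.
  have h2 : gap / 2 * `|p i j| <= de by apply: le_trans h; rewrite ler_wpM2r.
  rewrite -(@ler_pM2l _ (gap / 2)) ?divr_gt0//; apply: le_trans h2 _.
  by rewrite /de mulrAC.
have rest j (F : 'I_K -> R) : (forall i, i != sg j -> `|F i| <= rho ^+ 2) ->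
    `|\sum_(i | i != sg j) F i| <= th / 2.
  move=> hF; apply: le_trans (ler_norm_sum _ _ _) _; apply: le_trans rho2.
  apply: (@le_trans _ _ (\sum_(i : 'I_K) rho ^+ 2)); last first.
    by rewrite sumr_const card_ord -mulr_natl.
  rewrite big_mkcond; apply: ler_sum => i _.
  by case: ifP => [/hF//|_]; exact: sqr_ge0.
(* Two columns sharing their large row would have an inner product of size at least ka^2 - th/2,
   against near orthogonality. *)
have sg_inj : injective sg.
  move=> j j' jj; apply/eqP/negPn/negP => nj.
  have := col j j'; rewrite (negbTE nj) subr0 (bigD1 (sg j))//= => h.
  have h1 : `|\sum_(i | i != sg j) p i j * p i j'| <= th / 2.
    by apply: rest => i ij; rewrite normrM expr2 ler_pM// off// -jj.
  have h2 : ka ^+ 2 <= `|p (sg j) j * p (sg j) j'|.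
    by rewrite normrM expr2 ler_pM ?(ltW ka0)// {1}jj.
  set x := p _ _ * _ in h h2; set y := \sum_(_ | _) _ in h h1.
  have : `|x| <= `|x + y| + `|y| by rewrite -{1}(addrK y x); exact: ler_normB.
  lra.
have sgE := inj_le_id sg_inj sg_le.
have diag j : `| `|p j j| - 1| <= th.
  have := colsq j; rewrite (bigD1 j)//= => h.
  have h1 : `|\sum_(i | i != j) p i j ^+ 2| <= th / 2.
    have := @rest j (fun i => p i j ^+ 2); rewrite sgE; apply => i ij.
    by rewrite normrX ler_pXn2r ?nnegrE ?(ltW rho0)// off// sgE.
  have h2 : `|p j j ^+ 2 - 1| <= th.
    set y := \sum_(_ | _) _ in h h1; set x := p j j ^+ 2 in h *.
    have : `|x - 1| <= `|x + y - 1| + `|y|.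
      have -> : x - 1 = (x + y - 1) - y by ring.
      exact: ler_normB.
    lra.
  apply: le_trans h2; rewrite -[p j j ^+ 2]real_normK ?num_real//.
  have -> : `|p j j| ^+ 2 - 1 = (`|p j j| - 1) * (`|p j j| + 1) by ring.
  by rewrite normrM ler_peMr// ger0_norm ?addr_ge0// lerDr.
pose D := diag_mx (sign_mx E q).
have pD i j : `|(p *m D - 1%:M) i j| <= th.
  have sE : sign_mx E q 0 j = if 0 <= p j j then 1 else -1 by rewrite mxE.
  have -> : (p *m D - 1%:M) i j = p i j * sign_mx E q 0 j - (i == j)%:R.
    by rewrite mxE [X in _ + X]mxE [X in _ - X]mxE /D mul_mx_diag [X in X - _]mxE.
  rewrite sE; have [<-|ij] := eqVneq i j; last first.
    rewrite subr0 normrM (@le_trans _ _ `|p i j|)//.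
      by case: (0 <= _); rewrite ?normrN normr1 mulr1.
    by apply: le_trans (off i j _) _; [rewrite sgE|lra].
  apply: le_trans (diag i); have [p0|p0] := leP 0 (p i i).
    by rewrite mulr1 (ger0_norm p0).
  by rewrite mulrN1 (ltr0_norm p0).
move=> i j; have -> : q *m D - E = E *m (p *m D - 1%:M).
  by rewrite mulmxBr mulmx1 /p !mulmxA EE' mul1mx.
rewrite mxE; apply: le_trans (ler_norm_sum _ _ _) _.
apply: (@le_trans _ _ (\sum_(l : 'I_K) th)); last first.
  rewrite sumr_const card_ord -mulr_natl -/k (@le_trans _ _ (k * et))//.
    by rewrite ler_pM2l//; lra.
  by rewrite /et mulrCA divff ?mulr1//; lra.
apply: ler_sum => l _; rewrite normrM -[leRHS]mul1r ler_pM ?pD//.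
have h : \sum_j0 E i j0 ^+ 2 = 1.
  have := congr1 (fun M : 'M[R]_K => M i i) EE'; rewrite mxE [RHS]mxE eqxx mulr1n => <-.
  by apply: eq_bigr => a _; rewrite mxE expr2.
rewrite -(@ler_pXn2r _ 2) ?nnegrE// expr1n real_normK ?num_real// -h.
rewrite (bigD1 l)//= lerDl; apply: sumr_ge0 => a _; exact: sqr_ge0.
Qed.

End eigenvector_selection.

(** * Estimation errors of one panel *)

Section random_matrix_algebra.
Context {R : realType} {d : measure_display} {Om : measurableType d}.

Lemma random_cst m n (A : 'M[R]_(m, n)) : random_mx (fun _ : Om => A).
Proof. by move=> i j; exact: measurable_cst. Qed.

Lemma random_mxD m n (A B : Om -> 'M[R]_(m, n)) : random_mx A -> random_mx B ->
  random_mx (fun w => A w + B w).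
Proof.
move=> mA mB i j; under [X in measurable_fun _ X]funext do rewrite mxE.
exact: measurable_funD.
Qed.

Lemma random_mxN m n (A : Om -> 'M[R]_(m, n)) : random_mx A ->
  random_mx (fun w => - A w).
Proof.
move=> mA i j; under [X in measurable_fun _ X]funext do rewrite mxE.
exact: measurable_funN.
Qed.

Lemma random_mxZ m n (c : R) (A : Om -> 'M[R]_(m, n)) : random_mx A ->
  random_mx (fun w => c *: A w).
Proof.
move=> mA i j; under [X in measurable_fun _ X]funext do rewrite mxE.
exact: measurable_funM.
Qed.

Lemma random_mx_tr m n (A : Om -> 'M[R]_(m, n)) : random_mx A ->
  random_mx (fun w => (A w)^T).
Proof.
move=> mA i j; under [X in measurable_fun _ X]funext do rewrite mxE.
exact: mA.
Qed.

Lemma random_mxM m n p (A : Om -> 'M[R]_(m, n)) (B : Om -> 'M[R]_(n, p)) :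
  random_mx A -> random_mx B -> random_mx (fun w => A w *m B w).
Proof.
move=> mA mB i j; under [X in measurable_fun _ X]funext do rewrite mxE.
by apply: measurable_sum => k; exact: measurable_funM.
Qed.

Lemma random_mx_sum m n I (s : seq I) (A : I -> Om -> 'M[R]_(m, n)) :
  (forall i, random_mx (A i)) -> random_mx (fun w => \sum_(i <- s) A i w).
Proof.
move=> mA i j; under [X in measurable_fun _ X]funext do rewrite summxE.
by apply: measurable_sum => k; exact: mA.
Qed.

Lemma random_diag n (v : Om -> 'rV[R]_n) : random_mx v -> random_mx (fun w => diag_mx (v w)).
Proof.
move=> mv i j; rewrite (_ : (fun w => _) = fun w => v w 0 i *+ (i == j)).
  by case: (i == j) => /=; [exact: mv|exact: measurable_cst].
by apply/funext => w; rewrite mxE.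
Qed.

Lemma measurable_det n (A : Om -> 'M[R]_n) : random_mx A ->
  measurable_fun [set: Om] (fun w => \det (A w)).
Proof.
move=> mA; apply: measurable_sum => s; apply: measurable_funM => //.
by apply: measurable_prod => i _; exact: mA.
Qed.

Lemma measurable_neq0 (X : Om -> R) : measurable_fun [set: Om] X ->
  measurable_fun [set: Om] (fun w => X w != 0).
Proof. by move=> mX; apply: measurable_neg; exact: measurable_fun_eqr. Qed.

Lemma measurable_unitmx n (A : Om -> 'M[R]_n) : random_mx A ->
  measurable_fun [set: Om] (fun w => A w \in unitmx).
Proof.
move=> mA; under [X in measurable_fun _ X]funext do rewrite unitmxE unitfE.
by apply: measurable_neq0; exact: measurable_det.
Qed.

Lemma random_mx_if m n (b : Om -> bool) (A B : Om -> 'M[R]_(m, n)) :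
  measurable_fun [set: Om] b -> random_mx A -> random_mx B ->
  random_mx (fun w => if b w then A w else B w).
Proof.
move=> mb mA mB i j.
rewrite (_ : (fun w => _) = fun w => if b w then A w i j else B w i j).
  exact: measurable_fun_ifT.
by apply/funext => w; case: (b w).
Qed.

(** Writing 1/x as x times the power -1 of x^2 reduces to a real power and stays correct at 0, where
    both sides vanish. *)
Lemma measurable_inv (X : Om -> R) : measurable_fun [set: Om] X ->
  measurable_fun [set: Om] (fun w => (X w)^-1).
Proof.
move=> mX; rewrite (_ : (fun w => _) = fun w => X w * (X w ^+ 2) `^ (-1)).
  apply: measurable_funM => //; apply: (measurableT_comp (measurable_powR _)).
  exact: measurable_funX.
apply/funext => w; rewrite powR_inv1 ?sqr_ge0//.
have [->|X0] := eqVneq (X w) 0; first by rewrite invr0 mul0r.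
by field.
Qed.

(** [invmx] is the adjugate over the determinant on invertible matrices and returns its argument
    elsewhere; both branches and the test are measurable. *)
Lemma random_invmx n (A : Om -> 'M[R]_n) : random_mx A -> random_mx (fun w => invmx (A w)).
Proof.
move=> mA; apply: random_mx_if => //; first exact: measurable_unitmx.
move=> i j; rewrite (_ : (fun w => _) = fun w => (\det (A w))^-1 * cofactor (A w) j i).
  apply: measurable_funM; first exact/measurable_inv/measurable_det.
  apply: measurable_funM => //; apply: measurable_det => a b.
  rewrite (_ : (fun w => _) = fun w => A w (lift j a) (lift i b)); first exact: mA.
  by apply/funext => w; rewrite !mxE.
by apply/funext => w; rewrite !mxE.
Qed.

Lemma measurable_frob2 m n (A : Om -> 'M[R]_(m, n)) : random_mx A ->
  measurable_fun [set: Om] (fun w => frob2 (A w)).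
Proof.
move=> mA; apply: measurable_sum => i; apply: measurable_sum => j.
exact: measurable_funX.
Qed.

Lemma measurable_sqrtr (X : Om -> R) : measurable_fun [set: Om] X ->
  measurable_fun [set: Om] (fun w => Num.sqrt (X w)).
Proof.
move=> mX; apply: (measurableT_comp _ mX).
by apply: continuous_measurable_fun; exact: sqrt_continuous.
Qed.

Lemma measurable_nf m n (A : Om -> 'M[R]_(m, n)) : random_mx A ->
  measurable_fun [set: Om] (fun w => nf (A w)).
Proof. by move=> mA; apply: measurable_sqrtr; exact: measurable_frob2. Qed.

End random_matrix_algebra.

Lemma scale_mul_tr (R : comNzRingType) m n (c : R) (X : 'M[R]_(m, n)) :
  (c *: X) *m (c *: X)^T = (c * c) *: (X *m X^T).
Proof. by rewrite [(_ *: _)^T]linearZ/= -scalemxAl -scalemxAr scalerA. Qed.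

Lemma scale_mul3 (R : comNzRingType) m n p q (a b c : R) (X : 'M[R]_(m, n))
    (Y : 'M[R]_(n, p)) (Z : 'M[R]_(p, q)) :
  (a *: X) *m (b *: Y) *m (c *: Z) = (a * b * c) *: (X *m Y *m Z).
Proof.
by rewrite -!scalemxAl -!scalemxAr -!scalemxAl !scalerA [c * b]mulrC mulrA.
Qed.

Section regular_panels.
Context {R : realType} {d : measure_display} {Om : measurableType d}.
Variable P : probability Om R.
Variables (k0 : nat) (g C1 C2 S b0 : R).

(* The hypotheses on one panel, with constants that do not depend on [N]. *)
Record regular_panel N K (m : panel R Om N K) : Prop := RegularPanel {
  rp_K : (0 < K)%N;
  rp_N : (0 < N)%N;
  rp_g : 2 < g;
  rp_model : spatial_factor_model P m;
  rp_unit : Smx m \in unitmx;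
  rp_sums : abs_sums_le C2 (invmx (Smx m));
  rp_C2 : 1 <= C2;
  rp_factor : forall t j,
    ('E_P[fun w => (`|factor m t w j 0| `^ (2 * g))%R] < C1%:E)%E;
  rp_noise : forall t i,
    ('E_P[fun w => (`|noise m t w i 0| `^ (2 * g))%R] < C1%:E)%E;
  rp_stat : strictly_stationary P (joint m);
  rp_mix : forall l,
    \sum_(0 <= i < l) alphaR P (joint m) i.+1 `^ (1 - 2 / g) <= S;
  rp_orth : forall (t : int) (j : nat), (0 < j)%N ->
          covmx P (obs m (t - j%:Z)) (noise m t) = 0;
  rp_noise0 : forall t, mean_zero P (noise m t);
  rp_load : (Lam m)^T *m Lam m = N%:R%:M;
  rp_b0 : 0 < b0;
  rp_eig : exists s, [/\ spectrum (Mmx P k0 m) s, count (fun x => x != 0) s = K &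
          forall x, x \in s -> x != 0 -> b0 * N%:R ^+ 2 <= x] }.

Variables (N K : nat) (m : panel R Om N K).
Hypothesis rp : regular_panel m.

Let A := mom_cst g C1 C2.
Let NR : 0 < N%:R :> R. Proof. by rewrite ltr0n (rp_N rp). Qed.
Let sN : R := Num.sqrt N%:R.
Let sN0 : 0 < sN. Proof. by rewrite sqrtr_gt0. Qed.
Let sN2 : sN ^+ 2 = N%:R. Proof. by rewrite sqr_sqrtr// ltW. Qed.

(** A bound on the squared norm is turned into one on the norm by x <= 1 + x^2. *)
Definition c_bound : R := 1 + (1 + A) ^+ 2 * (2 + 2 * K%:R ^+ 2) * K%:R.

Lemma c_bound_ge0 : 0 <= c_bound.
Proof.
rewrite /c_bound addr_ge0// mulr_ge0// mulr_ge0 ?sqr_ge0//.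
Qed.

(* With these normalisations, [Sigma_y_hat / N = Psi gg + ee] and
   [Mmx / N^2 = Psi amx Psi^T]. *)
Definition Psi : 'M[R]_(N, K) := sN^-1 *: Lam m.
Definition cc (k : nat) : 'M[R]_(K, N) := sN^-1 *: Ck P m k.
Definition gg (T k : nat) (w : Om) : 'M[R]_(K, N) := sN^-1 *: G1 m T k w.
Definition ee (T k : nat) (w : Om) : 'M[R]_N := N%:R^-1 *: Ek m T k w.
Definition amx : 'M[R]_K := \sum_(1 <= k < k0.+1) cc k *m (cc k)^T.

(** One variable dominating all the errors e_k and g_k - c_k at once; its root is the [de] of the
    perturbation bounds. *)
Definition sq_err (T : nat) (w : Om) : R :=
  \sum_(1 <= k < k0.+1) (frob2 (ee T k w) + frob2 (gg T k w - cc k)).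
Definition err_nf (T : nat) (w : Om) : R := Num.sqrt (sq_err T w).

Definition sq_err_cst : R :=
  \sum_(1 <= k < k0.+1) @err_cst R K g C1 C2 S k * (1 + K%:R).

Lemma sq_err_ge0 T w : 0 <= sq_err T w.
Proof. by apply: sumr_ge0 => k _; rewrite addr_ge0// frob2_ge0. Qed.

Lemma frob2Z p q (c : R) (X : 'M[R]_(p, q)) : frob2 (c *: X) = c ^+ 2 * frob2 X.
Proof. by rewrite -!nf_sqr nfZ exprMn real_normK ?num_real. Qed.

Lemma Lam_Psi : Lam m = sN *: Psi.
Proof. by rewrite /Psi scalerA divff ?scale1r// gt_eqF. Qed.

Lemma Psi_orthonormal : Psi^T *m Psi = 1%:M.
Proof.
rewrite /Psi [(_ *: _)^T]linearZ/= -scalemxAl -scalemxAr (rp_load rp) scalerA scale_scalar_mx.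
by congr (_%:M); rewrite -sN2; field; rewrite gt_eqF.
Qed.

Lemma Ex_sq_err T : (0 < T)%N ->
  ig P (sq_err T) /\ Ex P (sq_err T) <= sq_err_cst / T%:R.
Proof.
move=> T0; have TR : 0 < T%:R :> R by rewrite ltr0n.
(* The moment bound on E_k asks for a positive lag; the guard makes every summand integrable, as the
   exchange of sum and expectation requires. *)
pose F k w := if (0 < k)%N then frob2 (ee T k w) + frob2 (gg T k w - cc k) else 0.
have FE : sq_err T = fun w => \sum_(1 <= k < k0.+1) F k w.
  by apply/funext => w; apply: eq_big_nat => k /andP[k1 _]; rewrite /F k1.
have eE k : (fun w => frob2 (ee T k w)) = fun w => N%:R^-1 ^+ 2 * frob2 (Ek m T k w).
  by apply/funext => w; rewrite frob2Z.
have gE k : (fun w => frob2 (gg T k w - cc k)) =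
    fun w => sN^-1 ^+ 2 * frob2 (G1 m T k w - Ck P m k).
  by apply/funext => w; rewrite -scalerBr frob2Z.
have h k : ig P (F k) /\ ((0 < k)%N ->
    Ex P (F k) <= @err_cst R K g C1 C2 S k * (1 + K%:R) / T%:R).
  rewrite /F; case: k => [|k] /=; first by split=> //; exact: ig_cst.
  have [i1 E1] := Ex_frob2_Ek (rp_g rp) (rp_K rp) (rp_model rp) (rp_unit rp)
    (rp_sums rp) (rp_C2 rp) (rp_factor rp) (rp_noise rp) (rp_stat rp) (rp_mix rp)
    (rp_orth rp) (rp_noise0 rp) (rp_load rp) T0 (isT : (0 < k.+1)%N).
  have [i2 E2] := Ex_frob2_G1 (rp_g rp) (rp_K rp) (rp_model rp) (rp_unit rp)
    (rp_sums rp) (rp_C2 rp) (rp_factor rp) (rp_noise rp) (rp_stat rp) (rp_mix rp)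
    (rp_load rp) k.+1 T0.
  have i1' := igZ (N%:R^-1 ^+ 2) i1; have i2' := igZ (sN^-1 ^+ 2) i2.
  rewrite -eE in i1'; rewrite -gE in i2'.
  split; first exact: igD.
  move=> _; rewrite ExD// eE gE !ExZ// mulrDr mulr1 mulrDl; apply: lerD.
    apply: le_trans (ler_wpM2l (sqr_ge0 _) E1) _.
    by rewrite le_eqVlt; apply/orP; left; apply/eqP; field; rewrite !gt_eqF.
  apply: le_trans (ler_wpM2l (sqr_ge0 _) E2) _.
  rewrite exprVn sN2 le_eqVlt; apply/orP; left; apply/eqP; field.
  by rewrite !gt_eqF.
rewrite FE; split; first by apply: ig_sum => k; case: (h k).
rewrite Ex_sum; last by move=> k; case: (h k).
rewrite /sq_err_cst mulr_suml; apply: ler_sum_nat => k /andP[k1 _].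
by case: (h k) => _; apply.
Qed.

Lemma measurable_err_nf T : (0 < T)%N -> measurable_fun [set: Om] (err_nf T).
Proof. by move=> T0; apply: measurable_sqrtr; have [/ig_meas] := Ex_sq_err T0. Qed.

Lemma err_nf_tail T (x : R) : (0 < T)%N -> 0 < x ->
  (P [set w | (x < err_nf T w)%R] <= (sq_err_cst / (T%:R * x ^+ 2))%:E)%E.
Proof.
move=> T0 x0; have [i1 E1] := Ex_sq_err T0.
have TR : 0 < T%:R :> R by rewrite ltr0n.
have x2 : 0 < x ^+ 2 by rewrite exprn_gt0.
rewrite (_ : [set w | _] = [set w | x ^+ 2 < sq_err T w]); last first.
  have h w : (x < err_nf T w) = (x ^+ 2 < sq_err T w).
    by rewrite -[sq_err T w]sqr_sqrtr ?sq_err_ge0// ltr_pXn2r ?nnegrE ?sqrtr_ge0 ?(ltW x0).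
  by apply/seteqP; split=> w /=; rewrite h.
apply: le_trans (prob_gt_le i1 (sq_err_ge0 T) x2) _.
rewrite lee_fin ler_pdivrMr// (le_trans E1)//.
by rewrite le_eqVlt; apply/orP; left; apply/eqP; field; rewrite !gt_eqF.
Qed.

Lemma Sigma_y_hat_scaled T k w :
  Sigma_y_hat m T k w = N%:R *: (Psi *m gg T k w + ee T k w).
Proof.
rewrite (Sigma_y_hatE (rp_model rp) (rp_unit rp)) scalerDr; congr (_ + _).
  have -> : Psi *m gg T k w = sN^-1 *: (Psi *m G1 m T k w) by exact/esym/scalemxAr.
  have -> : Lam m *m G1 m T k w = sN *: (Psi *m G1 m T k w).
    by rewrite Lam_Psi; exact/esym/scalemxAl.
  rewrite scalerA; congr (_ *: _); rewrite -sN2.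
  by field; rewrite gt_eqF.
by rewrite /ee scalerA divff ?scale1r// gt_eqF.
Qed.

Lemma Mhat_scaled T w : Mhat k0 m T w = N%:R ^+ 2 *:
  \sum_(1 <= k < k0.+1) (Psi *m gg T k w + ee T k w) *m (Psi *m gg T k w + ee T k w)^T.
Proof.
rewrite /Mhat scaler_sumr; apply: eq_bigr => k _.
by rewrite Sigma_y_hat_scaled [(_ *: _)^T]linearZ/= -scalemxAl -scalemxAr scalerA expr2.
Qed.

Lemma Mmx_scaled : Mmx P k0 m = N%:R ^+ 2 *: (Psi *m amx *m Psi^T).
Proof.
rewrite /Mmx /amx mulmx_sumr mulmx_suml scaler_sumr; apply: eq_big_nat => k /andP[k1 _].
rewrite (Sigma_yE (rp_g rp) (rp_K rp) (rp_model rp) (rp_unit rp) (rp_sums rp)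
  (rp_C2 rp) (rp_factor rp) (rp_noise rp) (rp_orth rp) (rp_noise0 rp) k1).
have -> : Ck P m k = sN *: cc k by rewrite /cc scalerA divff ?scale1r// gt_eqF.
have -> : Lam m *m (sN *: cc k) = N%:R *: (Psi *m cc k).
  by rewrite Lam_Psi -scalemxAl -scalemxAr scalerA -expr2 sN2.
rewrite [(_ *: _)^T]linearZ/= -scalemxAl -scalemxAr scalerA expr2 trmx_mul.
by rewrite !mulmxA.
Qed.

Lemma amx_sym : amx^T = amx.
Proof.
by rewrite /amx linear_sum/=; apply: eq_bigr => k _; rewrite trmx_mul trmxK.
Qed.

Lemma amx_quad z : b0 * frob2 z <= quad amx z.
Proof.
have [s [sM cK sb]] := rp_eig rp.
have ME : Mmx P k0 m = Psi *m (N%:R ^+ 2 *: amx) *m Psi^T.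
  have -> : Psi *m (N%:R ^+ 2 *: amx) = N%:R ^+ 2 *: (Psi *m amx) by exact/esym/scalemxAr.
  by rewrite Mmx_scaled; exact: scalemxAl.
have Ms : (Mmx P k0 m)^T = Mmx P k0 m.
  by rewrite ME !trmx_mul trmxK [(_ *: _)^T]linearZ/= amx_sym mulmxA.
have := nonzero_eigenvalues_quad Psi_orthonormal ME Ms sM cK sb z.
have N2 : 0 < N%:R ^+ 2 :> R by rewrite exprn_gt0.
by rewrite quadZ -[in X in _ -> X](ler_pM2l N2) [in X in _ -> X]mulrA [N%:R ^+ 2 * b0]mulrC.
Qed.

Lemma nf_cc k : nf (cc k) <= c_bound.
Proof.
have h := frob2_Ck (rp_g rp) (rp_K rp) (rp_model rp) (rp_unit rp) (rp_sums rp)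
  (rp_C2 rp) (rp_factor rp) (rp_noise rp) (rp_load rp) k.
have h2 : frob2 (cc k) <= c_bound - 1.
  rewrite /cc frob2Z exprVn sN2 ler_pdivrMl// (le_trans h)//.
  by rewrite /c_bound -/A le_eqVlt; apply/orP; left; apply/eqP; ring.
move: (nf_sqr (cc k)) (nf_ge0 (cc k)) (sqr_ge0 (nf (cc k) - 1)) h2 => h3 h4 h5 h2.
by rewrite -h3 in h2; move: (nf (cc k)) h2 h4 h5 => x h2 h4 h5; nra.
Qed.

Lemma nf_ee T w : forall k, (0 < k <= k0)%N -> nf (ee T k w) <= err_nf T w.
Proof.
move=> k kk; rewrite /err_nf ler_sqrt ?sq_err_ge0// /sq_err.
rewrite (big_rem k) ?mem_index_iota ?ltnS//= -addrA lerDl addr_ge0 ?frob2_ge0//.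
by apply: sumr_ge0 => l _; rewrite addr_ge0 ?frob2_ge0.
Qed.

Lemma nf_gg T w : forall k, (0 < k <= k0)%N -> nf (gg T k w - cc k) <= err_nf T w.
Proof.
move=> k kk; rewrite /err_nf ler_sqrt ?sq_err_ge0// /sq_err.
rewrite (big_rem k) ?mem_index_iota ?ltnS//= [frob2 (ee T k w) + _]addrC -addrA lerDl addr_ge0 ?frob2_ge0//.
by apply: sumr_ge0 => l _; rewrite addr_ge0 ?frob2_ge0.
Qed.

Section good_event.
Variables (T : nat) (w : Om) (L : 'M[R]_(N, K)) (v : 'rV[R]_K).
Hypothesis top : top_eigenpairs (Mhat k0 m T w) v L.
Let de := err_nf T w.

Definition qmx : 'M[R]_K := N%:R^-1 *: ((Lam m)^T *m L).
Definition resid : 'M[R]_(N, K) := sN^-1 *: (L - Lam m *m qmx).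

Lemma Lhat_split : L = Lam m *m qmx + sN *: resid.
Proof. by rewrite /resid scalerA divff ?gt_eqF// scale1r addrC subrK. Qed.

Let U := sN^-1 *: L.

Lemma scaled_orthonormal : U^T *m U = 1%:M.
Proof.
have [_ [U0 [LE UU _]]] := top.
by rewrite /U LE scalerA mulVf ?gt_eqF// scale1r.
Qed.

Lemma qmxE : qmx = Psi^T *m U.
Proof.
rewrite /qmx /Psi /U [(_ *: _)^T]linearZ/= -scalemxAl -scalemxAr scalerA; congr (_ *: _).
by rewrite -sN2; field; rewrite gt_eqF.
Qed.

Lemma residE : resid = U - Psi *m qmx.
Proof. by rewrite /resid scalerBr /U /Psi -scalemxAl. Qed.

Let Nv := N%:R^-1 ^+ 2 *: v.

Let cst := pcst K k0 c_bound b0.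
Hypothesis de1 : cst * de <= 1.

Let NN : 0 < N%:R ^+ 2 :> R. Proof. by rewrite exprn_gt0. Qed.

Let hyp : exists s, [/\ spectrum (N%:R ^+ 2 *:
   \sum_(1 <= k < k0.+1) (Psi *m gg T k w + ee T k w) *m (Psi *m gg T k w + ee T k w)^T) s,
   sorted >=%R s & forall j : 'I_K, Nv 0 j = (N%:R ^+ 2)^-1 * s`_j].
Proof.
have [[s [sM srt vs]] _] := top; exists s; split=> //.
  by rewrite -Mhat_scaled.
by move=> j; rewrite /Nv mxE vs exprVn.
Qed.

Let eigU : (\sum_(1 <= k < k0.+1) (Psi *m gg T k w + ee T k w) *m (Psi *m gg T k w + ee T k w)^T) *m U
  = U *m diag_mx Nv.
Proof.
have [_ [U0 [LE UU MU]]] := top.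
have UE : U = U0 by rewrite /U LE scalerA mulVf ?gt_eqF// scale1r.
rewrite UE; move: MU; rewrite Mhat_scaled -scalemxAl => MU.
apply: (@scalerI _ _ (N%:R ^+ 2)); first by rewrite gt_eqF.
rewrite MU /Nv linearZ/= -scalemxAr scalerA exprVn divff ?scale1r// gt_eqF//.
Qed.

Lemma good_values (j : 'I_K) : b0 / 2 * N%:R ^+ 2 <= v 0 j.
Proof.
have [s [h1 h2 h3]] := hyp.
have := eigenvalue_half c_bound_ge0 (rp_b0 rp) Psi_orthonormal NN h1 h2 h3
  amx_quad (sqrtr_ge0 _) de1 (fun k _ => nf_cc k) (nf_ee T w) (nf_gg T w) j.
by rewrite /Nv mxE exprVn ler_pdivlMl// mulrC.
Qed.

Lemma good_resid : nf resid <= pc2 K k0 c_bound b0 * de.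
Proof.
have [s [h1 h2 h3]] := hyp; rewrite residE qmxE.
exact: (nf_resid c_bound_ge0 (rp_b0 rp) Psi_orthonormal scaled_orthonormal NN h1 h2 h3
  eigU amx_quad (sqrtr_ge0 _) de1 (fun k _ => nf_cc k) (nf_ee T w) (nf_gg T w)).
Qed.

Lemma good_eigen : nf (amx *m qmx - qmx *m diag_mx Nv) <= K%:R * pc1 k0 c_bound * de.
Proof.
have [s [h1 h2 h3]] := hyp; rewrite qmxE.
exact: (nf_approx_eigen c_bound_ge0 (rp_b0 rp) Psi_orthonormal scaled_orthonormal
  eigU (sqrtr_ge0 _) de1 (fun k _ => nf_cc k) (nf_ee T w) (nf_gg T w)).
Qed.

Lemma good_qq : nf (qmx^T *m qmx - 1%:M) <= pc2 K k0 c_bound b0 ^+ 2 * de.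
Proof.
have [s [h1 h2 h3]] := hyp; rewrite qmxE.
exact: (nf_qq_sub c_bound_ge0 (rp_b0 rp) Psi_orthonormal scaled_orthonormal NN h1 h2 h3
  eigU amx_quad (sqrtr_ge0 _) de1 (fun k _ => nf_cc k) (nf_ee T w) (nf_gg T w)).
Qed.

Lemma good_unit : pc2 K k0 c_bound b0 * de < 1 -> qmx \in unitmx.
Proof.
have [s [h1 h2 h3]] := hyp; rewrite qmxE.
exact: (q_unit c_bound_ge0 (rp_b0 rp) Psi_orthonormal scaled_orthonormal NN h1 h2 h3
  eigU amx_quad (sqrtr_ge0 _) de1 (fun k _ => nf_cc k) (nf_ee T w) (nf_gg T w)).
Qed.

Lemma good_lower j (F : 'M[R]_(K, j.+1)) (b : R) (jK : (j < K)%N) :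
  F^T *m F = 1%:M -> (forall z, b * frob2 z <= quad amx (z *m F^T)) ->
  b - pc1 k0 c_bound * de <= Nv 0 (Ordinal jK).
Proof.
have [s [h1 h2 h3]] := hyp.
exact: (eigenvalue_lower c_bound_ge0 (rp_b0 rp) Psi_orthonormal NN h1 h2 h3
  (sqrtr_ge0 _) de1 (fun k _ => nf_cc k) (nf_ee T w) (nf_gg T w)).
Qed.

(** The factors 1/N, 1/N and N^2 coming from the Gram matrices of [gg], from [qmx] and from the
    inverse scaled eigenvalues cancel, so the unscaled [HNT] is exactly the product in the
    perturbation bound. *)
Lemma good_rotation : nf ((HNT k0 m T v L w)^T - qmx) <= pc3 K k0 c_bound b0 * de.
Proof.
have [s [h1 h2 h3]] := hyp.
have := nf_rotation_sub c_bound_ge0 (rp_b0 rp) Psi_orthonormal scaled_orthonormal NN h1 h2 h3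
  eigU amx_quad (sqrtr_ge0 _) de1 (fun k _ => nf_cc k) (nf_ee T w) (nf_gg T w).
rewrite -qmxE; congr (nf (_ - _) <= _).
have v0 j : v 0 j != 0.
  by rewrite gt_eqF// (lt_le_trans _ (good_values j))// mulr_gt0// divr_gt0// (rp_b0 rp).
rewrite /HNT trmxK !mulmx_suml; apply: eq_bigr => k _.
rewrite invmx_diag => [|j]; last by rewrite mxE mulf_neq0// expf_neq0// invr_eq0 gt_eqF.
rewrite invmx_diag//.
have -> : diag_mx (\row_j (Nv 0 j)^-1) = N%:R ^+ 2 *: diag_mx (\row_j (v 0 j)^-1).
  apply/matrixP => i j; rewrite !mxE mulrnAr; congr (_ *+ _).
  by rewrite invfM exprVn invrK.
rewrite /gg scale_mul_tr /qmx scale_mul3 !mulmxA.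
rewrite (_ : _ * _ = 1) ?scale1r//.
by rewrite -sN2; field; rewrite gt_eqF.
Qed.

End good_event.

End regular_panels.

(** * Uniform rate of the estimated factors *)

Section probability_bounds.
Context {R : realType} {d : measure_display} {Om : measurableType d}.
Variable P : probability Om R.

Definition pr (A : set Om) : R := fine (P A).

Lemma prE A : measurable A -> P A = (pr A)%:E.
Proof. by move=> mA; rewrite /pr fineK// fin_num_measure. Qed.

Lemma pr_ge0 A : 0 <= pr A.
Proof. by rewrite /pr fine_ge0. Qed.

Lemma pr_le A (e : R) : measurable A -> (P A <= e%:E)%E = (pr A <= e).
Proof. by move=> mA; rewrite prE// lee_fin. Qed.

Lemma pr_union_bound (I : eqType) (s : seq I) (A : I -> set Om) (B : set Om) :
  measurable B -> (forall i, i \in s -> measurable (A i)) ->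
  (forall w, B w -> exists2 i, i \in s & A i w) ->
  pr B <= \sum_(i <- s) pr (A i).
Proof.
move=> mB mA BA; pose A' i := if i \in s then A i else set0.
have mA' i : measurable (A' i) by rewrite /A'; case: ifP => // /mA.
have -> : \sum_(i <- s) pr (A i) = \sum_(i <- s) pr (A' i).
  by rewrite big_seq [RHS]big_seq; apply: eq_bigr => i is_; rewrite /A' is_.
rewrite /pr -Ex_indic//; under eq_bigr do rewrite -Ex_indic//.
rewrite -Ex_sum; last by move=> i; exact: ig_indic.
apply: Ex_le; first exact: ig_indic.
  by apply: ig_sum => i; exact: ig_indic.
move=> w; rewrite indicE; case: (boolP (w \in B)) => [|_].
  rewrite inE => /BA[i is_ Aw].
  rewrite (big_rem i)//= indicE mem_set ?lerDl ?sumr_ge0//; last by rewrite /A' is_.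
by apply: sumr_ge0 => i _; rewrite indicE.
Qed.

Lemma pr_union_bound4 A1 A2 A3 A4 B : measurable A1 -> measurable A2 ->
  measurable A3 -> measurable A4 -> measurable B ->
  (forall w, B w -> [\/ A1 w, A2 w, A3 w | A4 w]) ->
  pr B <= pr A1 + pr A2 + pr A3 + pr A4.
Proof.
move=> m1 m2 m3 m4 mB BA.
have := @pr_union_bound nat [:: 0; 1; 2; 3]%N (nth set0 [:: A1; A2; A3; A4]) B mB.
rewrite !big_cons big_nil /= addr0 !addrA; apply.
  by move=> i; rewrite !inE => /or4P[] /eqP ->.
by move=> w /BA[h|h|h|h]; [exists 0%N|exists 1%N|exists 2%N|exists 3%N].
Qed.

Lemma pr_mono A B : measurable A -> measurable B -> A `<=` B -> pr A <= pr B.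
Proof.
by move=> mA mB AB; rewrite -lee_fin -!prE//; apply: le_measure; rewrite ?inE.
Qed.

Lemma norm2_nf n (v : 'cV[R]_n) : norm2 v = nf v.
Proof. by congr Num.sqrt; apply: eq_bigr => i _; rewrite big_ord1. Qed.

Lemma measurable_bigmax (s : seq nat) (F : nat -> Om -> R) :
  (forall t, measurable_fun [set: Om] (F t)) ->
  measurable_fun [set: Om] (fun w => \big[Num.max/0]_(t <- s) F t w).
Proof.
move=> mF; elim: s => [|t s ih].
  by under [X in measurable_fun _ X]funext do rewrite big_nil; exact: measurable_cst.
under [X in measurable_fun _ X]funext do rewrite big_cons.
exact: measurable_maxr.
Qed.

(* Truncation at level [B]: the tail second moment is at most a Cauchy-Schwarz
   (here AM-GM) product of the fourth moment and the tail probability. *)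
Lemma tail_second_moment (X : Om -> R) (A4 D c B : R) :
  measurable_fun [set: Om] X -> ig P (fun w => X w ^+ 4) ->
  Ex P (fun w => X w ^+ 4) <= A4 ->
  pr [set w | B < `|X w|] <= D * expR (- (c * B)) ->
  let Y w := X w ^+ 2 * \1_[set w | B < `|X w|] w in
  ig P Y /\ Ex P Y <= (A4 + D) * expR (- (c * B / 2)).
Proof.
move=> mX i4 E4 tail Y; pose la := expR (- (c * B / 2)).
have la0 : 0 < la by exact: expR_gt0.
have mA : measurable [set w | B < `|X w|].
  by apply: measurable_gt; exact: measurableT_comp.
pose Z w := la * X w ^+ 4 + la^-1 * (\1_[set w | B < `|X w|] w : R).
have iZ : ig P Z by apply: igD; apply: igZ => //; exact: ig_indic.
have YZ w : 0 <= Y w <= Z w.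
  rewrite /Y /Z; set b := \1_ _ w.
  have b01 : b = 0 \/ b = 1 by rewrite /b indicE; case: (_ \in _); [right|left].
  have x4 : 0 <= X w ^+ 4 by rewrite exprn_even_ge0.
  have iv : 0 < la^-1 by rewrite invr_gt0.
  have bge0 : 0 <= b by case: b01 => ->.
  rewrite mulr_ge0 ?sqr_ge0//=.
  case: b01 => ->; rewrite ?mulr0 ?addr0 ?mulr1; first by rewrite mulr_ge0// ltW.
  have -> : X w ^+ 4 = (X w ^+ 2) ^+ 2 by rewrite -exprM.
  move: (X w ^+ 2) (sqr_ge0 (X w)) => x x0.
  have : 0 <= la^-1 * (la * x - 1) ^+ 2 by rewrite mulr_ge0 ?sqr_ge0// ltW.
  have -> : la^-1 * (la * x - 1) ^+ 2 = la * x ^+ 2 - 2 * x + la^-1 by field; rewrite gt_eqF.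
  by lra.
have iY : ig P Y.
  apply: ig_le iZ _; last by move=> w; have /andP[y0 yz] := YZ w; rewrite ger0_norm.
  by apply: measurable_funM; [exact: measurable_funX|exact: measurable_indic].
split=> //; apply: le_trans (Ex_le iY iZ (fun w => (andP (YZ w)).2)) _.
rewrite ExD; [|exact: igZ|by apply: igZ; exact: ig_indic].
rewrite !ExZ//; last exact: ig_indic.
rewrite Ex_indic// -/(pr _) mulrDl lerD//.
  by rewrite mulrC ler_wpM2r// ltW.
rewrite ler_pdivrMl// (le_trans tail)// mulrCA ler_wpM2l//; last first.
  by rewrite /la -expRD; rewrite ler_expR; lra.
have := le_trans (pr_ge0 _) tail; rewrite pmulr_lge0// expR_gt0//.
Qed.

End probability_bounds.

Section subexponential_tails.
Context {R : realType} {d : measure_display} {Om : measurableType d}.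
Variable P : probability Om R.
Variables (n : nat) (eps : Om -> 'cV[R]_n) (D c : R).
Hypothesis meps : random_mx eps.
Hypothesis D0 : 0 < D.
Hypothesis tail : forall (v : 'cV[R]_n) (x : R), 0 < x -> norm2 v = 1 ->
  (P [set w | (x < `|(v^T *m eps w) 0 0|)%R] <= (D * expR (- (c * x)))%:E)%E.

Lemma measurable_lin (a : 'rV[R]_n) : measurable_fun [set: Om] (fun w => (a *m eps w) 0 0).
Proof. by apply: random_mxM => //; exact: random_cst. Qed.

Lemma measurable_lin_gt (a : 'rV[R]_n) (x : R) :
  measurable [set w | x < `|(a *m eps w) 0 0|].
Proof. by apply: measurable_gt; apply: measurableT_comp => //; exact: measurable_lin. Qed.

(** The tail hypothesis concerns unit vectors, so the form is normalised; a zero form never exceeds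
    the nonnegative level. *)
Lemma subexp_lin (a : 'rV[R]_n) (nu x : R) : nf a <= nu -> 0 < x ->
  pr P [set w | nu * x < `|(a *m eps w) 0 0|] <= D * expR (- (c * x)).
Proof.
move=> anu x0; have := nf_ge0 a; rewrite le_eqVlt => /predU1P[a0|a0].
  have {}a0 : a = 0 by apply/eqP; rewrite -frob2_eq0 -nf_sqr -a0 expr0n.
  rewrite (_ : [set w | _] = set0).
    by rewrite /pr measure0 mulr_ge0 ?expR_ge0// ltW.
  apply/seteqP; split=> // w /=; rewrite a0 mul0mx mxE normr0 ltNge.
  by rewrite mulr_ge0 ?(ltW x0)// (le_trans _ anu)// nf_ge0.
pose v := ((nf a)^-1 *: a)^T.
have nv : norm2 v = 1.
  by rewrite norm2_nf /v nf_tr nfZ gtr0_norm ?invr_gt0// mulVf// gt_eqF.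
have := tail x0 nv; rewrite pr_le; last first.
  by rewrite /v trmxK; exact: measurable_lin_gt.
apply: le_trans; rewrite /v trmxK; apply: pr_mono.
- exact: measurable_lin_gt.
- exact: measurable_lin_gt.
- move=> w /= h; rewrite -scalemxAl mxE normrM gtr0_norm ?invr_gt0//.
  rewrite ltr_pdivlMl// (le_lt_trans _ h)// ler_wpM2r// ltW//.
Qed.

End subexponential_tails.

(* Schur's test *)
Lemma nf_row_abs_sums (R : realType) n (C : R) (M : 'M[R]_n) (a : 'rV[R]_n) : 0 <= C ->
  abs_sums_le C M -> nf (a *m M) <= C * nf a.
Proof.
move=> C0 MC; rewrite frob2_le ?mulr_ge0 ?nf_ge0// exprMn nf_sqr !frob2_rowE.
apply: (@le_trans _ _ (\sum_j C * \sum_i `|M i j| * a 0 i ^+ 2)).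
  apply: ler_sum => j _; rewrite mxE.
  have -> : \sum_i a 0 i * M i j = \sum_i Num.sqrt `|M i j| * (Num.sg (M i j) * Num.sqrt `|M i j| * a 0 i).
    apply: eq_bigr => i _; rewrite {1}[M i j]numEsg.
    by rewrite -{1}[`|M i j|]sqr_sqrtr//; ring.
  apply: le_trans (sum_cauchy_schwarz _ _ _) _; apply: ler_pM.
  - by apply: sumr_ge0 => i _; exact: sqr_ge0.
  - by apply: sumr_ge0 => i _; exact: sqr_ge0.
  - by under eq_bigr do rewrite sqr_sqrtr//; have [] := MC j.
  - apply: ler_sum => i _; rewrite !exprMn sqr_sqrtr// ler_wpM2r ?sqr_ge0// ler_piMl//.
    by rewrite -real_normK ?num_real// normr_sg; case: (_ != 0); rewrite ?expr1n ?expr0n.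
rewrite -mulr_sumr expr2 -mulrA ler_wpM2l// exchange_big/= mulr_sumr.
apply: ler_sum => i _; rewrite -mulr_suml ler_wpM2r ?sqr_ge0//.
by have [] := MC i.
Qed.

Section uniform_error.
Context {R : realType} {d : measure_display} {Om : measurableType d}.
Variable P : probability Om R.
Variables (k0 : nat) (g C1 C2 S b0 : R) (N K : nat) (m : panel R Om N K).
Hypothesis rp : regular_panel P k0 g C1 C2 S b0 m.

Let NR : 0 < N%:R :> R. Proof. by rewrite ltr0n (rp_N rp). Qed.
Let sN : R := Num.sqrt N%:R.
Let sN0 : 0 < sN. Proof. by rewrite sqrtr_gt0. Qed.
Let sN2 : sN ^+ 2 = N%:R. Proof. by rewrite sqr_sqrtr// ltW. Qed.
Let C20 : 0 < C2. Proof. exact: lt_le_trans (rp_C2 rp). Qed.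

Let mnoise t : random_mx (noise m t). Proof. by have [/(_ t)[]] := rp_model rp. Qed.

Lemma random_Lxi t : random_mx (fun w => (Lam m)^T *m xi m t w).
Proof. by apply: random_mxM; [exact: random_cst|exact: (random_xi (rp_model rp))]. Qed.

Section tails.
Variables (D c : R).
Hypothesis D0 : 0 < D.
Hypothesis tail : forall t (v : 'cV[R]_N) (x : R), 0 < x -> norm2 v = 1 ->
  (P [set w | (x < `|(v^T *m noise m t w) 0 0|)%R] <= (D * expR (- (c * x)))%:E)%E.

Lemma xi_entry_tail t i x : 0 < x ->
  pr P [set w | C2 * x < `|xi m t w i 0|] <= D * expR (- (c * x)).
Proof.
move=> x0; pose a : 'rV[R]_N := delta_mx 0 i *m invmx (Smx m).
have aE w : xi m t w i 0 = (a *m noise m t w) 0 0.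
  by rewrite /a -mulmxA -rowE [RHS]mxE.
have na : nf a <= C2.
  rewrite -[leRHS]mulr1 -[X in _ <= _ * X](_ : nf (delta_mx 0 i : 'rV[R]_N) = 1).
    exact: nf_row_abs_sums (ltW C20) (rp_sums rp).
  rewrite /nf frob2_rowE (bigD1 i)//= mxE !eqxx expr1n big1 ?addr0 ?sqrtr1// => j ji.
  by rewrite mxE (negbTE ji) andbF expr0n.
under [X in pr P X]eq_fun do rewrite aE.
exact: (subexp_lin (@mnoise t) D0 (tail t) na x0).
Qed.

(** Each column of the loading matrix has norm sqrt N, and Schur's test bounds the effect of the
    inverse of [Smx] by [C2]. *)
Lemma Lxi_entry_tail t k x : 0 < x ->
  pr P [set w | C2 * sN * x < `|((Lam m)^T *m xi m t w) k 0|] <= D * expR (- (c * x)).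
Proof.
move=> x0; pose a : 'rV[R]_N := row k (Lam m)^T *m invmx (Smx m).
have aE w : ((Lam m)^T *m xi m t w) k 0 = (a *m noise m t w) 0 0.
  by rewrite /a -mulmxA -row_mul [RHS]mxE.
have na : nf a <= C2 * sN.
  apply: le_trans (nf_row_abs_sums _ (ltW C20) (rp_sums rp)) _.
  rewrite ler_wpM2l ?(ltW C20)// frob2_le ?(ltW sN0)// sN2 frob2_rowE.
  have /matrixP/(_ k k) := rp_load rp; rewrite mxE [RHS]mxE eqxx mulr1n => <-.
  by rewrite le_eqVlt; apply/orP; left; apply/eqP; apply: eq_bigr => j _; rewrite !mxE expr2.
under [X in pr P X]eq_fun do rewrite aE.
exact: (subexp_lin (@mnoise t) D0 (tail t) na x0).
Qed.

Let A4 := 1 + mom_cst g C1 C2.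

(** A union bound over coordinates would bring in a factor N. Instead, entries below the level
    contribute at most its square each, and Markov's inequality is applied to the sum of the
    truncated squares, whose mean is at most N times an exponentially small quantity. *)
Lemma xi_norm_tail t x : 1 <= x -> 0 < c ->
  pr P [set w | 2 * (C2 * x) ^+ 2 * N%:R < frob2 (xi m t w)] <=
    (A4 + D) * expR (- (c * x / 2)).
Proof.
move=> x1 c0; have x0 : 0 < x by exact: lt_le_trans x1.
pose B := C2 * x; have B1 : 1 <= B by rewrite /B; apply: le_trans x1 _; rewrite ler_peMl ?(rp_C2 rp)// ltW.
have B0 : 0 < B by exact: lt_le_trans B1.
have mx i : measurable_fun [set: Om] (fun w => xi m t w i 0) by exact: (random_xi (rp_model rp)).
have h i : ig P (fun w => xi m t w i 0 ^+ 2 * \1_[set w | B < `|xi m t w i 0|] w) /\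
    Ex P (fun w => xi m t w i 0 ^+ 2 * \1_[set w | B < `|xi m t w i 0|] w) <=
    (A4 + D) * expR (- (c * x / 2)).
  have [i4 E4] := Ex_xi_pow4 (rp_g rp) (rp_K rp) (rp_model rp) (rp_sums rp)
    (rp_C2 rp) (rp_factor rp) (rp_noise rp) i t.
  have tl : pr P [set w | B < `|xi m t w i 0|] <= D * expR (- (c / C2 * B)).
    have -> : c / C2 * B = c * x by rewrite /B; field; rewrite gt_eqF.
    exact: xi_entry_tail.
  have := tail_second_moment (mx i) i4 E4 tl.
  by have -> : c / C2 * B / 2 = c * x / 2 by rewrite /B; field; rewrite gt_eqF.
pose Y w := \sum_i xi m t w i 0 ^+ 2 * (\1_[set w | B < `|xi m t w i 0|] w : R).
have iY : ig P Y by apply: ig_sum => i; case: (h i).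
have Y0 w : 0 <= Y w.
  by apply: sumr_ge0 => i _; rewrite mulr_ge0 ?sqr_ge0// indicE.
have EY : Ex P Y <= N%:R * ((A4 + D) * expR (- (c * x / 2))).
  rewrite Ex_sum; last by move=> i; case: (h i).
  have -> : N%:R * ((A4 + D) * expR (- (c * x / 2))) =
      \sum_(i < N) ((A4 + D) * expR (- (c * x / 2))).
    by rewrite sumr_const card_ord mulr_natl.
  by apply: ler_sum => i _; exact: (h i).2.
have BN : 0 < B ^+ 2 * N%:R by rewrite mulr_gt0// exprn_gt0.
have mxi : measurable_fun [set: Om] (fun w => frob2 (xi m t w)).
  by apply: measurable_frob2; exact: (random_xi (rp_model rp)).
apply: (@le_trans _ _ (pr P [set w | B ^+ 2 * N%:R < Y w])).
  apply: pr_mono; [exact: measurable_gt|by apply: measurable_gt; exact: (ig_meas iY)|].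
  move=> w /=; rewrite -/B => hw.
  have : frob2 (xi m t w) <= B ^+ 2 * N%:R + Y w.
    rewrite (_ : B ^+ 2 * N%:R = \sum_(i < N) B ^+ 2); last first.
      by rewrite sumr_const card_ord mulr_natr.
    rewrite -big_split/= /frob2; apply: ler_sum => i _; rewrite big_ord1.
    rewrite indicE; case: (boolP (w \in _)) => [_|]; first by rewrite mulr1 lerDr sqr_ge0.
    rewrite notin_setE/= => /negP; rewrite -leNgt mulr0 addr0 => xb.
    by rewrite -real_normK ?num_real// ler_pXn2r ?nnegrE ?(ltW B0).
  by lra.
rewrite -(pr_le P) //; last by apply: measurable_gt; exact: (ig_meas iY).
apply: le_trans (prob_gt_le iY Y0 BN) _; rewrite lee_fin ler_pdivrMr//.
apply: le_trans EY _; rewrite [leRHS]mulrC -[leRHS]mulrA ler_peMl//.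
  rewrite mulr_ge0// mulr_ge0 ?expR_ge0// /A4.
  have := mom_cst_ge0 C2 (rp_K rp) (rp_model rp) (rp_factor rp).
  by move: D0 => D0'; lra.
by rewrite exprn_ege1.
Qed.

End tails.

Section factor_error.
Variables (T : nat) (w : Om) (L : 'M[R]_(N, K)) (v : 'rV[R]_K) (t : int).

Lemma fhat_sub : fhat m L t w - (qmx m L)^T *m factor m t w =
  N%:R^-1 *: ((qmx m L)^T *m ((Lam m)^T *m xi m t w)) + sN^-1 *: ((resid m L)^T *m xi m t w).
Proof.
have -> : fhat m L t w = N%:R^-1 *: (L^T *m (Lam m *m factor m t w + xi m t w)).
  by rewrite /fhat (obsE (rp_model rp) (rp_unit rp)).
rewrite mulmxDr scalerDr.
have -> : N%:R^-1 *: (L^T *m (Lam m *m factor m t w)) = (qmx m L)^T *m factor m t w.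
  by rewrite /qmx [(_ *: _)^T]linearZ/= trmx_mul trmxK mulmxA -scalemxAl.
rewrite addrAC subrr add0r {1}(Lhat_split rp L).
have -> : (Lam m *m qmx m L + Num.sqrt N%:R *: resid m L)^T =
    (qmx m L)^T *m (Lam m)^T + sN *: (resid m L)^T.
  rewrite [(_ + _)^T]linearD/= trmx_mul; congr (_ + _); exact: linearZ.
rewrite mulmxDl scalerDr -mulmxA; congr (_ + _).
rewrite -[in LHS]scalemxAl scalerA; congr (_ *: _).
by rewrite -sN2; field; rewrite gt_eqF.
Qed.

Hypothesis top : top_eigenpairs (Mhat k0 m T w) v L.

Lemma nf_qmx : nf (qmx m L) <= K%:R.
Proof.
rewrite (qmxE rp).
apply: le_trans (nfM _ _) _; rewrite nf_tr (nf_orthonormal_cols (scaled_orthonormal rp top)).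
by rewrite (nf_orthonormal_cols (Psi_orthonormal rp)) -expr2 sqr_sqrtr.
Qed.

End factor_error.

End uniform_error.

Section uniform_bound.
Context {R : realType} {d : measure_display} {Om : measurableType d}.
Variable P : probability Om R.
Variables (k0 : nat) (g C1 C2 S b0 : R) (N K : nat) (m : panel R Om N K).
Hypothesis rp : regular_panel P k0 g C1 C2 S b0 m.
Variables (L : nat -> Om -> 'M[R]_(N, K)) (V : nat -> Om -> 'rV[R]_K).
Hypothesis est : forall T, random_mx (L T) /\
  forall w, top_eigenpairs (Mhat k0 m T w) (V T w) (L T w).

Let NR : 0 < N%:R :> R. Proof. by rewrite ltr0n (rp_N rp). Qed.
Let sN : R := Num.sqrt N%:R.
Let sN0 : 0 < sN. Proof. by rewrite sqrtr_gt0. Qed.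
Let sN2 : sN ^+ 2 = N%:R. Proof. by rewrite sqr_sqrtr// ltW. Qed.
Let C20 : 0 < C2. Proof. exact: lt_le_trans (rp_C2 rp). Qed.

(** The identity is a default for outcomes where q is singular, so that the rotation is invertible
    everywhere. *)
Definition rotation (Lh : 'M[R]_(N, K)) : 'M[R]_K :=
  if qmx m Lh \in unitmx then (qmx m Lh)^T else 1%:M.

Lemma random_qmx T : random_mx (fun w => qmx m (L T w)).
Proof.
apply: random_mxZ; apply: random_mxM; first exact: random_cst.
by have [] := est T.
Qed.

Lemma random_rotation T : random_mx (fun w => rotation (L T w)).
Proof.
apply: random_mx_if.
- by apply: measurable_unitmx; exact: random_qmx.
- by apply: random_mx_tr; exact: random_qmx.
- exact: random_cst.
Qed.

Lemma rotation_unit Lh : rotation Lh \in unitmx.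
Proof. by rewrite /rotation; case: ifP => // h; rewrite ?unitmx_tr ?unitmx1. Qed.

Lemma random_obs t : random_mx (obs m t).
Proof. by have [/(_ t)[]] := rp_model rp. Qed.

Lemma random_factor t : random_mx (factor m t).
Proof. by have [/(_ t)[]] := rp_model rp. Qed.

Lemma random_fhat T t : random_mx (fun w => fhat m (L T w) t w).
Proof.
apply: random_mxZ; apply: random_mxM; last exact: random_obs.
by apply: random_mx_tr; have [] := est T.
Qed.

Definition factor_err (T : nat) (t : int) (w : Om) : 'cV[R]_K :=
  fhat m (L T w) t w - rotation (L T w) *m factor m t w.

Lemma random_factor_err T t : random_mx (factor_err T t).
Proof.
apply: random_mxD; first exact: random_fhat.
by apply: random_mxN; apply: random_mxM; [exact: random_rotation|exact: random_factor].
Qed.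

Let cb := c_bound g C1 C2 K.
Let q2 := pc2 K k0 cb b0.
Let q0 := pcst K k0 cb b0.
Let CF := sq_err_cst k0 g C1 C2 S K.

Let q0_gt0 : 0 < q0. Proof. exact: (pcst_gt0 _ _ (c_bound_ge0 _ _ _ _) (rp_b0 rp)). Qed.
Let q2_ge0 : 0 <= q2.
Proof. by have [] := pc_ge0 K k0 (c_bound_ge0 g C1 C2 K) (rp_b0 rp). Qed.

Lemma rotationE T w : q0 * err_nf P k0 m T w <= 1 -> rotation (L T w) = (qmx m (L T w))^T.
Proof.
move=> h; rewrite /rotation (good_unit rp ((est T).2 w) h)//.
exact: (pc2_lt1 (c_bound_ge0 _ _ _ _) (rp_b0 rp) (sqrtr_ge0 _) h).
Qed.

Lemma nf_col_le n (x : 'cV[R]_n) (b : R) : (forall i, `|x i 0| <= b) -> nf x <= n%:R * b.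
Proof.
case: n x => [|n] x xb.
  by rewrite mul0r /nf /frob2 big_ord0 sqrtr0.
have b0' : 0 <= b by exact: le_trans (xb 0).
rewrite frob2_le ?mulr_ge0// /frob2 exprMn.
apply: (@le_trans _ _ (\sum_(i < n.+1) b ^+ 2)).
  apply: ler_sum => i _; rewrite big_ord1 -real_normK ?num_real//.
  by rewrite ler_pXn2r ?nnegrE.
rewrite sumr_const card_ord -[leLHS]mulr_natl ler_wpM2r ?sqr_ge0//.
by rewrite expr2 ler_peMl// ler1n.
Qed.

(** A deterministic bound: [x] is the noise level, later a multiple of log T, and [y] the level of
    the estimation error, later of order 1/sqrt T. *)
Lemma factor_err_le T w t (x y : R) : q0 * err_nf P k0 m T w <= 1 ->
  (forall k, `|((Lam m)^T *m xi m t w) k 0| <= C2 * sN * x) ->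
  frob2 (xi m t w) <= 2 * (C2 * x) ^+ 2 * N%:R -> 0 <= x -> err_nf P k0 m T w <= y ->
  norm2 (factor_err T t w) <= K%:R ^+ 2 * C2 * x / sN + 2 * q2 * C2 * x * y.
Proof.
move=> h lx fx x0 ey; rewrite norm2_nf /factor_err rotationE// (fhat_sub rp).
apply: le_trans (nfD _ _) _; rewrite !nfZ !gtr0_norm ?invr_gt0//; apply: lerD.
  rewrite ler_pdivrMl//; apply: le_trans (nfM _ _) _; rewrite nf_tr.
  apply: (@le_trans _ _ (K%:R * (K%:R * (C2 * sN * x)))).
    by rewrite ler_pM ?nf_ge0 ?(nf_qmx rp ((est T).2 w))// nf_col_le.
  by rewrite -sN2 le_eqVlt; apply/orP; left; apply/eqP; field; rewrite gt_eqF.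
rewrite ler_pdivrMl//; apply: le_trans (nfM _ _) _; rewrite nf_tr.
have e0 : 0 <= err_nf P k0 m T w by exact: sqrtr_ge0.
have nx : nf (xi m t w) <= 2 * (C2 * x) * sN.
  rewrite frob2_le; last by rewrite !mulr_ge0// ltW.
  apply: le_trans fx _; rewrite -sN2 !exprMn ler_wpM2r ?sqr_ge0//.
  have two : 2 <= 2 ^+ 2 :> R by rewrite -natrX ler_nat.
  by apply: ler_wpM2r => //; rewrite mulr_ge0 ?sqr_ge0.
apply: (@le_trans _ _ ((q2 * y) * (2 * (C2 * x) * sN))).
  rewrite ler_pM ?nf_ge0//; apply: le_trans (good_resid rp ((est T).2 w) h) _.
  by rewrite ler_wpM2l.
by rewrite -/sN le_eqVlt; apply/orP; left; apply/eqP; ring.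
Qed.

Section union.
Variables (D c : R).
Hypothesis D0 : 0 < D.
Hypothesis c0 : 0 < c.
Hypothesis tail : forall t (v : 'cV[R]_N) (x : R), 0 < x -> norm2 v = 1 ->
  (P [set w | (x < `|(v^T *m noise m t w) 0 0|)%R] <= (D * expR (- (c * x)))%:E)%E.

Definition max_err T w : R := \big[Num.max/0]_(1 <= t < T.+1) norm2 (factor_err T t%:Z w).

Lemma measurable_max_err T : measurable_fun [set: Om] (max_err T).
Proof.
apply: measurable_bigmax => t; under [X in measurable_fun _ X]funext do rewrite norm2_nf.
by apply: measurable_nf; exact: random_factor_err.
Qed.

(** Four exceptional events: an estimation error above M/sqrt T, one above 1/q0, beyond which the
    perturbation bounds do not apply, and, for some t, a large xi_t or a large Lam' xi_t. Only the
    last two need a union over t, at the price of a factor T. *)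
Lemma max_err_tail T x M : (0 < T)%N -> 1 <= x -> 0 < M ->
  pr P [set w | K%:R ^+ 2 * C2 * x / sN + 2 * q2 * C2 * x * (M / Num.sqrt T%:R) < max_err T w]
  <= CF / M ^+ 2 + CF * q0 ^+ 2 / T%:R
     + T%:R * ((1 + mom_cst g C1 C2 + D) * expR (- (c * x / 2)))
     + T%:R * (K%:R * (D * expR (- (c * x)))).
Proof.
move=> T0 x1 M0; have x0 : 0 < x by exact: lt_le_trans x1.
have TR : 0 < T%:R :> R by rewrite ltr0n.
have sT0 : 0 < Num.sqrt T%:R :> R by rewrite sqrtr_gt0.
have sT2 : Num.sqrt T%:R ^+ 2 = T%:R :> R by rewrite sqr_sqrtr// ltW.
have me := measurable_err_nf rp T0.
have mxi t : random_mx (xi m t) by exact: (random_xi (rp_model rp)).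
have mL t : random_mx (fun w => (Lam m)^T *m xi m t w) by exact: (random_Lxi rp).
pose A1 := [set w | M / Num.sqrt T%:R < err_nf P k0 m T w].
pose A2 := [set w | q0^-1 < err_nf P k0 m T w].
pose a3 (i : 'I_T) := [set w | 2 * (C2 * x) ^+ 2 * N%:R < frob2 (xi m i.+1%:Z w)].
pose a4 (i : 'I_T) k := [set w | C2 * sN * x < `|((Lam m)^T *m xi m i.+1%:Z w) k 0|].
pose b4 (i : 'I_T) := [set w | exists k, a4 i k w].
have m3 i : measurable (a3 i) by apply: measurable_gt; exact: measurable_frob2.
have m4 i k : measurable (a4 i k).
  by apply: measurable_gt; apply: measurableT_comp => //; exact: mL.
have mb4 i : measurable (b4 i) by exact: measurable_exists_fin.
pose A3 := [set w | exists i, a3 i w]; pose A4 := [set w | exists i, b4 i w].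
have mA3 : measurable A3 by exact: measurable_exists_fin.
have mA4 : measurable A4 by exact: measurable_exists_fin.
have mA1 : measurable A1 by exact: measurable_gt.
have mA2 : measurable A2 by exact: measurable_gt.
have p1 : pr P A1 <= CF / M ^+ 2.
  rewrite -(pr_le P) //; apply: le_trans (err_nf_tail rp T0 _) _; first exact: divr_gt0.
  rewrite lee_fin expr_div_n sT2 le_eqVlt; apply/orP; left; apply/eqP; congr (_ / _).
  by field; rewrite gt_eqF.
have p2 : pr P A2 <= CF * q0 ^+ 2 / T%:R.
  rewrite -(pr_le P) //; apply: le_trans (err_nf_tail rp T0 _) _; first by rewrite invr_gt0.
  rewrite lee_fin -/CF le_eqVlt; apply/orP; left; apply/eqP.
  by field; rewrite !gt_eqF.
have p3 : pr P A3 <= T%:R * ((1 + mom_cst g C1 C2 + D) * expR (- (c * x / 2))).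
  apply: (@le_trans _ _ (\sum_i pr P (a3 i))).
    apply: pr_union_bound => // w [i ai]; exists i => //; exact: mem_index_enum.
  rewrite mulr_natl -[T in leRHS](card_ord T) -sumr_const.
  by apply: ler_sum => i _; exact: (xi_norm_tail rp D0 tail).
have p4 : pr P A4 <= T%:R * (K%:R * (D * expR (- (c * x)))).
  apply: (@le_trans _ _ (\sum_i pr P (b4 i))).
    apply: pr_union_bound => // w [i ai]; exists i => //; exact: mem_index_enum.
  rewrite mulr_natl -[T in leRHS](card_ord T) -sumr_const.
  apply: ler_sum => i _; apply: (@le_trans _ _ (\sum_k pr P (a4 i k))).
    apply: pr_union_bound => // w [k ak]; exists k => //; exact: mem_index_enum.
  rewrite mulr_natl -[K in leRHS](card_ord K) -sumr_const.
  by apply: ler_sum => k _; exact: (Lxi_entry_tail rp D0 tail).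
set B := [set w | _].
have mB : measurable B by apply: measurable_gt; exact: measurable_max_err.
apply: (@le_trans _ _ (pr P A1 + pr P A2 + pr P A3 + pr P A4)); last by rewrite !lerD.
apply: pr_union_bound4 => // w Bw; apply: contrapT => nA.
have n1 : ~ A1 w by move=> h; apply: nA; constructor 1.
have n2 : ~ A2 w by move=> h; apply: nA; constructor 2.
have n3 : ~ A3 w by move=> h; apply: nA; constructor 3.
have n4 : ~ A4 w by move=> h; apply: nA; constructor 4.
move: Bw; rewrite /B /= ltNge => /negP; apply.
have e1 : err_nf P k0 m T w <= M / Num.sqrt T%:R by rewrite leNgt; apply/negP.
have e2 : q0 * err_nf P k0 m T w <= 1.
  by rewrite -ler_pdivlMl// mulr1 leNgt; apply/negP.
have M1 : 0 <= M / Num.sqrt T%:R by rewrite divr_ge0// ltW.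
rewrite /max_err big_nat; apply: bigmax_le => [|t /andP[t1 tT]].
  have x0' := ltW x0; have C20' := ltW C20; have sN0' := ltW sN0.
  by apply: addr_ge0; repeat first [apply: divr_ge0 => //|apply: mulr_ge0 => //].
case: t t1 tT => // t _; rewrite ltnS => tT.
apply: factor_err_le => //; last exact: ltW.
- move=> k; rewrite leNgt; apply/negP => h; apply: n4.
  by exists (Ordinal tT); exists k.
- by rewrite leNgt; apply/negP => h; apply: n3; exists (Ordinal tT).
Qed.

End union.

End uniform_bound.

Section assumptions_to_panels.
Context {R : realType} {d : measure_display} {Om : measurableType d} {K : nat}.
Variables (P : probability Om R) (k0 : nat) (gamma : R).
Variable m : forall N, panel R Om N K.

Lemma mixing_sums n (J : int -> Om -> 'cV[R]_n) (th C : R) :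
  (forall t, random_mx (J t)) ->
  (\sum_(1 <= k <oo) alpha_coef P J k `^ th <= C%:E)%E ->
  forall l, \sum_(0 <= i < l) alphaR P J i.+1 `^ th <= C.
Proof.
move=> mJ le l; rewrite -lee_fin; apply: le_trans le.
have := @nneseries_lim_ge R (fun k => alpha_coef P J k `^ th)%E xpredT 1%N l.+1.
move=> h; apply: le_trans (h _); last by move=> k _ _; exact: poweR_ge0.
rewrite big_add1/= -sumEFin; apply: lee_sum => i _.
by rewrite (alphaRE _ _ mJ) poweR_EFin.
Qed.

Lemma regular_panels : (0 < K)%N -> 2 < gamma ->
  (forall N, (K <= N)%N -> spatial_factor_model P (m N)) ->
  eigenvalue_condition P k0 m -> mixing_condition P gamma m ->
  weight_condition m -> noise_condition P m -> loading_condition m ->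
  moment_condition P gamma m ->
  exists C1 C2 S b0, forall N, (K <= N)%N ->
    regular_panel P k0 gamma C1 C2 S b0 (m N).
Proof.
move=> K0 g2 model [b0 b00 eig] [stat [S mix]] [unitS [C2 sums]] nc lc [C1 mom].
(* The maximum provides the lower bound 1 that [rp_C2] asks for. *)
exists C1, (Num.max C2 1), S, b0 => N KN.
have [_ uS] := unitS N KN; have [_ sS] := sums N KN.
have [[n0 _ _] nobs _] := nc N KN; have [_ ld] := lc N KN.
have N0 : (0 < N)%N by exact: leq_trans KN.
have NR : N%:R != 0 :> R by rewrite pnatr_eq0 -lt0n.
apply: RegularPanel => //.
- exact: model.
- move=> i; have [s1 s2] := sS i.
  by split; rewrite le_max ?s1 ?s2.
- by rewrite le_max lexx orbT.
- by move=> t j; have [h _] := mom N KN t; exact: h.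
- by move=> t i; have [_ h] := mom N KN t; exact: h.
- exact: stat.
- by apply: mixing_sums; [exact: (random_joint (model N KN))|exact: mix].
- have -> : (Lam (m N))^T *m Lam (m N) =
      (load (m N))^T *m invmx (Smx (m N))^T *m invmx (Smx (m N)) *m load (m N).
    by rewrite /Lam trmx_mul trmx_inv !mulmxA.
  have := congr1 (fun M => N%:R *: M) ld.
  by rewrite /= scalerA divff// scale1r scalemx1.
- by have [s h] := eig N KN; exists s.
Qed.

End assumptions_to_panels.

Lemma nat_threshold (R : realType) (a e : R) : 0 < e ->
  exists t0 : nat, forall T, (t0 <= T)%N -> a <= e * T%:R.
Proof.
move=> e0; exists (Num.truncn (a / e)).+1 => T tT.
rewrite mulrC -ler_pdivrMr// ltW// (lt_le_trans (truncnS_gt _))// ler_nat//.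
Qed.

Lemma oo_filterP (A : set (nat * nat)) (n0 t0 : nat) :
  (forall N T, (n0 <= N)%N -> (t0 <= T)%N -> A (N, T)) -> oo_filter A.
Proof.
move=> h; exists ([set N | (n0 <= N)%N], [set T | (t0 <= T)%N]).
  by split; exact: nbhs_infty_ge.
by move=> [N T] [/= hN hT]; exact: h.
Qed.

Section uniform_consistency.
Context {R : realType} {d : measure_display} {Om : measurableType d} {K : nat}.
Variables (P : probability Om R) (k0 : nat) (gamma : R).
Variable m : forall N, panel R Om N K.
Variables (Lhat : forall N, nat -> Om -> 'M[R]_(N, K)) (Vhat : nat -> nat -> Om -> 'rV[R]_K).
Variables (C1 C2 S b0 : R).
Hypothesis K0 : (0 < K)%N.
Hypothesis est : eigen_estimator k0 m Lhat Vhat.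
Hypothesis rp : forall N, (K <= N)%N -> regular_panel P k0 gamma C1 C2 S b0 (m N).

Lemma uniform_factor_rate : subexponential_condition P m ->
  exists KNT : nat * nat -> Om -> 'M[R]_K,
     [/\ forall NT, random_mx (KNT NT),
         forall NT w, KNT NT w \in unitmx &
         bigO_prob P oo_filter
           (fun NT w => \big[Num.max/0]_(1 <= t < NT.2.+1)
              norm2 (fhat (m NT.1) (Lhat NT.1 NT.2 w) t%:Z w
                     - KNT NT w *m factor (m NT.1) t%:Z w))
           (fun NT => ((Num.sqrt NT.1%:R)^-1 + (Num.sqrt NT.2%:R)^-1)
                      * ln NT.2%:R)].
Proof.
move=> [D [c [D0 c0 tail]]].
pose KNT (NT : nat * nat) w : 'M[R]_K :=
  if (K <= NT.1)%N then rotation (m NT.1) (Lhat NT.1 NT.2 w) else 1%:M.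
exists KNT; split.
- move=> [N T]; rewrite /KNT /=; have [KN|_] := boolP (K <= N)%N; last exact: random_cst.
  exact: (random_rotation (V := Vhat N) (fun T => @est N T KN) T).
- by move=> [N T] w; rewrite /KNT /=; case: ifP => _; rewrite ?unitmx1 ?rotation_unit.
move=> e e0.
have rK := rp (leqnn K).
have C20 : 0 < C2 := lt_le_trans ltr01 (rp_C2 rK).
pose cb := c_bound gamma C1 C2 K.
pose q2 := pc2 K k0 cb b0; pose q0 := pcst K k0 cb b0.
have q20 : 0 <= q2 by have [] := pc_ge0 K k0 (c_bound_ge0 gamma C1 C2 K) (rp_b0 rK).
pose CF := sq_err_cst k0 gamma C1 C2 S K.
pose E0 := 1 + mom_cst gamma C1 C2 + D.
have E00 : 0 <= E0.
  have := mom_cst_ge0 C2 K0 (rp_model rK) (rp_factor rK).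
  by rewrite /E0; move: D0 => D0'; lra.
(* With x = l ln T, exp(-c x/2) is at most T^-2, so a union over T dates still leaves 1/T. *)
pose l := 1 + 4 / c; have l1 : 1 <= l by rewrite lerDl divr_ge0// ltW.
have e4 : 0 < e / 4 by lra.
pose M := Num.sqrt (4 * `|CF| / e) + 1.
have M0 : 0 < M by rewrite ltr_wpDl ?sqrtr_ge0.
have MCF : CF / M ^+ 2 <= e / 4.
  rewrite ler_pdivrMr ?(exprn_gt0 _ M0)//.
  have s0 : 0 <= 4 * `|CF| / e by rewrite divr_ge0 ?(ltW e0)// mulr_ge0.
  have : 4 * `|CF| / e <= M ^+ 2.
    rewrite -{1}(sqr_sqrtr s0) ler_pXn2r ?nnegrE ?sqrtr_ge0 ?(ltW M0)//.
    by rewrite /M lerDl.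
  rewrite ler_pdivrMr// => h; have := ler_norm CF; lra.
have [t1 ht1] := nat_threshold (CF * q0 ^+ 2) e4.
have [t2 ht2] := nat_threshold E0 e4.
have [t3 ht3] := nat_threshold (K%:R * D) e4.
(* From T >= exp 1 on, ln T >= 1, which gives the x >= 1 required by the tail bound. *)
have [t4 ht4] := nat_threshold (expR 1) (ltr01 : 0 < 1 :> R).
pose C := K%:R ^+ 2 * C2 * l + 2 * q2 * C2 * l * M + 1.
have C20' := ltW C20; have M0' := ltW M0; have l0 : 0 <= l by exact: le_trans l1.
have Ca : 0 <= K%:R ^+ 2 * C2 * l by repeat apply: mulr_ge0 => //.
have Cb : 0 <= 2 * q2 * C2 * l * M by repeat apply: mulr_ge0 => //.
exists C; first by rewrite /C; lra.
apply: (@oo_filterP _ K (maxn (maxn t1 t2) (maxn (maxn t3 t4) 1))) => N T KN.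
rewrite !geq_max => /andP[/andP[T1 T2] /andP[/andP[T3 T4] T0]] /=.
have TR : 0 < T%:R :> R by rewrite ltr0n.
have lnT : 1 <= ln T%:R :> R.
  rewrite -[leLHS]expRK ler_ln ?posrE ?expR_gt0// -[leRHS]mul1r; exact: ht4.
pose x := l * ln T%:R.
have L0 : 0 <= ln T%:R :> R by exact: le_trans lnT.
have x1 : 1 <= x by rewrite /x; apply: le_trans lnT _; rewrite ler_peMl.
have ex2 : expR (- (c * x / 2)) <= T%:R^-1 * T%:R^-1 :> R.
  have -> : T%:R^-1 * T%:R^-1 = expR (- (ln T%:R + ln T%:R)) :> R.
    by rewrite expRN expRD lnK ?posrE// invfM.
  rewrite ler_expR lerN2.
  have : c * x / 2 = c * ln T%:R / 2 + 2 * ln T%:R by rewrite /x /l; field; rewrite gt_eqF.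
  have : 0 <= c * ln T%:R by rewrite mulr_ge0 ?(ltW c0).
  lra.
have ex1 : expR (- (c * x)) <= T%:R^-1 * T%:R^-1 :> R.
  apply: le_trans ex2; rewrite ler_expR lerN2.
  have : 0 <= c * x by rewrite mulr_ge0 ?(ltW c0)// (le_trans ler01).
  by lra.
have estN := fun T => @est N T KN.
have tl t (v : 'cV[R]_N) (x' : R) : 0 < x' -> norm2 v = 1 ->
    (P [set w | (x' < `|(v^T *m noise (m N) t w) 0 0|)%R] <= (D * expR (- (c * x')))%:E)%E.
  by move=> x'0 nv; have [_ h] := tail N KN t x' x'0; exact: h.
have main := max_err_tail (rp KN) (V := Vhat N) estN D0 c0 tl T0 x1 M0.
have mX := measurable_max_err (rp KN) (V := Vhat N) estN T.
pose r : R := ((Num.sqrt N%:R)^-1 + (Num.sqrt T%:R)^-1) * ln T%:R.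
rewrite (_ : [set w | _] = [set w | C * r < `|max_err (m N) (Lhat N) T w|]); last first.
  rewrite /KNT /= KN; done.
rewrite pr_le; last first.
  by apply: measurable_gt; exact: measurableT_comp.
apply: (@le_trans _ _ (e / 4 + e / 4 + e / 4 + e / 4)); last by lra.
apply: le_trans (_ : _ <= CF / M ^+ 2 + CF * q0 ^+ 2 / T%:R + T%:R * (E0 * expR (- (c * x / 2)))
     + T%:R * (K%:R * (D * expR (- (c * x))))) _.
  apply: le_trans main; apply: pr_mono.
  - by apply: measurable_gt; exact: measurableT_comp.
  - exact: measurable_gt.
  move=> w /= h; have X0 : 0 <= max_err (m N) (Lhat N) T w by exact: bigmax_ge_id.
  rewrite ger0_norm// in h; apply: le_lt_trans h; rewrite /r.
  set sN := (Num.sqrt N%:R)^-1; set sT := (Num.sqrt T%:R)^-1.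
  have sN0 : 0 <= sN by rewrite invr_ge0 sqrtr_ge0.
  have sT0 : 0 <= sT by rewrite invr_ge0 sqrtr_ge0.
  rewrite /x /C -/cb -/q2.
  have h1 : 0 <= K%:R ^+ 2 * C2 * l * (sT * ln T%:R) by rewrite mulr_ge0// mulr_ge0.
  have h2 : 0 <= 2 * q2 * C2 * l * M * (sN * ln T%:R) by rewrite mulr_ge0// mulr_ge0.
  have h3 : 0 <= (sN + sT) * ln T%:R by rewrite mulr_ge0// addr_ge0.
  by lra.
rewrite !lerD//.
- by rewrite ler_pdivrMr//; exact: ht1.
- apply: (@le_trans _ _ (T%:R * (E0 * (T%:R^-1 * T%:R^-1)))).
    by rewrite ler_wpM2l// ler_wpM2l.
  rewrite (_ : _ * _ = E0 / T%:R); last by field; rewrite gt_eqF.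
  by rewrite ler_pdivrMr//; exact: ht2.
- apply: (@le_trans _ _ (T%:R * (K%:R * (D * (T%:R^-1 * T%:R^-1))))).
    by rewrite ler_wpM2l// ler_wpM2l// ler_wpM2l// ltW.
  rewrite (_ : _ * _ = K%:R * D / T%:R); last by field; rewrite gt_eqF.
  by rewrite ler_pdivrMr//; exact: ht3.
Qed.

End uniform_consistency.

Lemma sorted_diagonalization (R : realType) K (A : 'M[R]_K) (s : seq R) :
  A^T = A -> spectrum A s -> uniq s ->
  exists (al : 'rV[R]_K) (E : 'M[R]_K), [/\ E^T *m E = 1%:M,
    A = E *m diag_mx al *m E^T & forall i j : 'I_K, (i < j)%N -> al 0 j < al 0 i].
Proof.
move=> As sA us; pose s' := sort >=%R s.
have sA' : spectrum A s'.
  by rewrite /spectrum sA; apply: perm_big; rewrite perm_sym perm_sort.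
have us' : uniq s' by rewrite sort_uniq.
have srt : sorted >=%R s' by apply: sort_sorted => x y; exact: ge_total.
have [sz [E EE AE]] := spectral_theorem As sA'.
exists (\row_j s'`_j), E; split=> // i j ij; rewrite !mxE.
rewrite lt_neqAle nth_uniq ?sz// (gtn_eqF ij)/=.
have tr : transitive (>=%R : rel R) by move=> y x z xy yz; exact: le_trans xy.
by have := sorted_ltn_nth tr 0 srt; apply; rewrite ?inE ?sz.
Qed.

(** * Limit of the rotation *)

Section signs.
Context {R : realType}.

Lemma sign_mxP K (E q : 'M[R]_K) j : sign_mx E q 0 j = 1 \/ sign_mx E q 0 j = -1.
Proof. by rewrite mxE; case: ifP; [left|right]. Qed.

Lemma diag_signK K (sg : 'rV[R]_K) : (forall j, sg 0 j = 1 \/ sg 0 j = -1) ->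
  diag_mx sg *m diag_mx sg = 1%:M.
Proof.
move=> h; rewrite mulmx_diag; apply/matrixP => i j; rewrite !mxE.
by case: (h i) => ->; rewrite ?mulr1 ?mulrNN ?mulr1.
Qed.

Lemma top_eigenpairs_sign N K (A : 'M[R]_N) v (L : 'M[R]_(N, K)) (sg : 'rV[R]_K) :
  (forall j, sg 0 j = 1 \/ sg 0 j = -1) ->
  top_eigenpairs A v L -> top_eigenpairs A v (L *m diag_mx sg).
Proof.
move=> h [h1 [U [-> UU AU]]]; split=> //; exists (U *m diag_mx sg); split.
- exact/esym/scalemxAl.
- rewrite trmx_mul tr_diag_mx mulmxA -[_ *m U^T *m U]mulmxA UU mulmx1.
  exact: diag_signK.
- by rewrite mulmxA AU -!mulmxA diag_mxC.
Qed.

End signs.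

Section selection.
Context {R : realType} {d : measure_display} {Om : measurableType d}.
Variable P : probability Om R.
Variables (k0 : nat) (g C1 C2 S b0 : R) (K : nat).
Hypothesis b00 : 0 < b0.
Variables (A E : 'M[R]_K) (al : 'rV[R]_K).
Hypothesis EE : E^T *m E = 1%:M.
Hypothesis AE : A = E *m diag_mx al *m E^T.
Hypothesis al_dec : forall i j : 'I_K, (i < j)%N -> al 0 j < al 0 i.
Let cb := c_bound g C1 C2 K.
Let q0 := pcst K k0 cb b0.

Lemma quad_lead_proj j (jK : (j < K)%N) (z : 'rV[R]_j.+1) :
  al 0 (Ordinal jK) * frob2 z <= quad A (z *m (E *m lead_proj K j)^T).
Proof.
rewrite AE quad_conj trmx_mul -!mulmxA EE mulmx1 quad_diag.
have -> : frob2 z = frob2 (z *m (lead_proj K j)^T).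
  by rewrite frob2_row_orthonormal// trmxK lead_proj_orthonormal.
rewrite frob2_rowE mulr_sumr; apply: ler_sum => i _.
have [ij|ji] := leqP i j.
  rewrite ler_wpM2r ?sqr_ge0//; move: ij; rewrite leq_eqVlt => /predU1P[ij|ij].
    by rewrite (_ : Ordinal jK = i)//; apply: val_inj.
  by apply/ltW/al_dec.
rewrite (_ : (z *m _) 0 i = 0) ?expr0n ?mulr0//.
rewrite mxE big1// => l _; rewrite !mxE.
by rewrite gtn_eqF ?mulr0// (leq_ltn_trans _ ji)// -ltnS.
Qed.

(** Deterministic: when the population matrix is near its limit and the estimation error is small,
    the approximate eigenvector equation and the lower bounds on the eigenvalues pass from [amx] to
    [A], whose distinct eigenvalues allow [eigenvector_selection]. *)
Lemma panel_selection (eta : R) : 0 < eta ->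
  exists2 de : R, 0 < de & forall N (m : panel R Om N K) T w L v,
    regular_panel P k0 g C1 C2 S b0 m -> top_eigenpairs (Mhat k0 m T w) v L ->
    nf (amx P k0 m - A) <= de -> err_nf P k0 m T w <= de ->
    let L' := L *m diag_mx (sign_mx E (qmx m L)) in
    [/\ q0 * err_nf P k0 m T w <= 1,
        forall i j, `|(qmx m L' - E) i j| <= eta &
        forall i j, `|((HNT k0 m T v L' w)^T - E) i j| <= eta].
Proof.
move=> eta0; have eta2 : 0 < eta / 2 by lra.
have [de1 de10 sel] := eigenvector_selection EE AE al_dec eta2.
have cb0 : 0 <= cb by exact: c_bound_ge0.
have q00 : 0 < q0 by exact: pcst_gt0.
have K0 : 0 <= K%:R :> R by [].
pose mn := Num.min 1 (Num.min de1 (eta / 2)).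
have mn0 : 0 < mn by rewrite !lt_min ltr01 de10 eta2.
have mn1 : mn <= 1 by rewrite ge_min lexx.
have mnd : mn <= de1 by rewrite !ge_min lexx orbT.
have mne : mn <= eta / 2 by rewrite !ge_min lexx !orbT.
(* K comes from (amx - A) q, 1 from the quadratic form of amx - A, and [q0] from the perturbation
   bounds. *)
pose s := K%:R + 1 + q0; have s0 : 0 < s by rewrite /s; lra.
exists (mn / s); first by rewrite divr_gt0.
move=> N m T w L v rp top; set de := mn / s => ad ed L'.
have de0 : 0 < de by rewrite divr_gt0.
have deE : de * (K%:R + 1 + q0) = mn by rewrite /de -/s divfK// gt_eqF.
have e0 : 0 <= err_nf P k0 m T w by exact: sqrtr_ge0.
have Kd : 0 <= K%:R * de by rewrite mulr_ge0// ltW.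
have qd : 0 <= q0 * de by rewrite mulr_ge0// ltW.
have qde : q0 * err_nf P k0 m T w <= q0 * de by rewrite ler_wpM2l// ltW.
have q1 : q0 * err_nf P k0 m T w <= 1 by lra.
have pw p : p <= q0 -> p * err_nf P k0 m T w <= q0 * de.
  by move=> pq; apply: le_trans qde; rewrite ler_wpM2r.
have [p1 p2 p3] := pc_ge0 K k0 cb0 b00.
have K1 : 0 <= K%:R * pc1 k0 cb by rewrite mulr_ge0.
have p22 : 0 <= pc2 K k0 cb b0 ^+ 2 by rewrite sqr_ge0.
have b2 : 0 <= 2 / b0 * pc1 k0 cb by rewrite mulr_ge0// divr_ge0// ltW.
have q0E : q0 = 1 + 2 / b0 * pc1 k0 cb + pc1 k0 cb + K%:R * pc1 k0 cb + pc2 K k0 cb b0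
  + pc2 K k0 cb b0 ^+ 2 + pc3 K k0 cb b0 by [].
have selq : forall i j, `|(qmx m L' - E) i j| <= eta / 2.
  have -> : qmx m L' = qmx m L *m diag_mx (sign_mx E (qmx m L)).
    by rewrite /qmx /L' mulmxA; exact: scalemxAl.
  apply: (sel _ (N%:R^-1 ^+ 2 *: v)).
  - have -> : A = amx P k0 m - (amx P k0 m - A) by rewrite opprB addrC subrK.
    rewrite mulmxBl addrAC; apply: le_trans (nfB _ _) _.
    apply: le_trans (lerD (good_eigen rp top q1) (nfM _ _)) _.
    apply: le_trans (lerD (pw _ _) (ler_pM (nf_ge0 _) (nf_ge0 _) ad (nf_qmx rp top))) _.
      by rewrite q0E; lra.
    by lra.
  - apply: le_trans (good_qq rp top q1) _; apply: le_trans (pw _ _) _; last by lra.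
    by rewrite q0E; lra.
  - move=> [j jK].
    have FF : (E *m lead_proj K j)^T *m (E *m lead_proj K j) = 1%:M.
      by rewrite trmx_mul mulmxA -[_ *m E^T *m E]mulmxA EE mulmx1 lead_proj_orthonormal.
    apply: le_trans (good_lower rp top q1 jK FF (b := al 0 (Ordinal jK) - de) _).
      have := pw (pc1 k0 cb); rewrite q0E -/cb => /(_ _) h.
      have {}h : pc1 k0 cb * err_nf P k0 m T w <= q0 * de by apply: pw; rewrite q0E; lra.
      by lra.
    move=> z; have -> : amx P k0 m = A + (amx P k0 m - A) by rewrite addrC subrK.
    rewrite quadD mulrBl; apply: lerD; first exact: quad_lead_proj.
    have fz : frob2 (z *m (E *m lead_proj K j)^T) = frob2 z.
      by rewrite frob2_row_orthonormal// trmxK.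
    have := quad_nf (amx P k0 m - A) (z *m (E *m lead_proj K j)^T).
    rewrite fz ler_norml => /andP[h _]; apply: le_trans h; rewrite lerN2.
    by rewrite ler_wpM2r// frob2_ge0.
split=> //.
  by move=> i j; apply: le_trans (selq i j) _; lra.
(* Sign flips preserve an eigenvector system, so the bound on the rotation also holds for the signed
   loadings. *)
move=> i j; have top' := top_eigenpairs_sign (sign_mxP E (qmx m L)) top.
rewrite -[X in X - E](subrK (qmx m L')) -addrA mxE.
apply: le_trans (ler_normD _ _) _.
have h1 : `|((HNT k0 m T v L' w)^T - qmx m L') i j| <= q0 * de.
  apply: le_trans (entry_le_nf _ _ _) _; apply: le_trans (good_rotation rp top' q1) _.
  by apply: pw; rewrite q0E; lra.
by have := selq i j; lra.
Qed.

End selection.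

Lemma nf_entries_le (R : realType) p q (X : 'M[R]_(p, q)) (b : R) :
  (forall i j, `|X i j| <= b) -> nf X <= Num.sqrt (p * q)%:R * b.
Proof.
case: p q X => [|p] [|q] X Xb; try by
  rewrite ?(mul0n, muln0) sqrtr0 mul0r /nf /frob2 ?big_ord0 ?sqrtr0// big1 ?sqrtr0// => i _; rewrite big_ord0.
have b0 : 0 <= b by exact: le_trans (Xb 0 0).
rewrite frob2_le ?mulr_ge0 ?sqrtr_ge0// exprMn sqr_sqrtr// /frob2.
apply: (@le_trans _ _ (\sum_(i < p.+1) \sum_(j < q.+1) b ^+ 2)).
  apply: ler_sum => i _; apply: ler_sum => j _.
  by rewrite -real_normK ?num_real// ler_pXn2r ?nnegrE.
by rewrite !sumr_const !card_ord -mulrnA mulr_natl mulnC.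
Qed.

Lemma cvg_mx_nf (R : realType) p q (X : nat -> 'M[R]_(p, q)) (A : 'M[R]_(p, q)) :
  X @ \oo --> A -> forall e : R, 0 < e ->
  exists n0, forall n, (n0 <= n)%N -> nf (X n - A) <= e.
Proof.
move=> XA e e0; pose s : R := Num.sqrt (p * q)%:R + 1.
have s0 : 0 < s by rewrite ltr_wpDl ?sqrtr_ge0.
have [n0 _ h] := cvg_ball XA (divr_gt0 e0 s0).
exists n0 => n /h hn; apply: le_trans (_ : Num.sqrt (p * q)%:R * (e / s) <= _).
  apply: nf_entries_le => i j; have : ball (A i j) (e / s) (X n i j) by exact: (proj2 hn).
  rewrite -ball_normE /= !mxE distrC.
  exact: ltW.
by rewrite mulrCA ger_pMr// ler_pdivrMr// mul1r /s lerDl.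
Qed.

Section convergence_in_probability.
Context {R : realType} {d : measure_display} {Om : measurableType d}.
Variable P : probability Om R.

Lemma cvg_prob_oT p q (X : nat * nat -> Om -> 'M[R]_(p, q)) (L : 'M[R]_(p, q)) :
  (forall e eta : R, 0 < e -> 0 < eta -> exists c : nat, forall N T,
     (c <= N)%N -> (c * N <= T)%N -> random_mx (X (N, T)) /\
     exists2 B : set Om, measurable B & pr P B <= eta /\
       forall w, ~ B w -> forall i j, `|X (N, T) w i j - L i j| <= e) ->
  cvg_prob P oT_filter X L.
Proof.
move=> h e e0; pose S (NT : nat * nat) := [set w | exists i j, e < `|X NT w i j - L i j|].
have SB eta : 0 < eta -> exists c : nat, forall N T, (c <= N)%N -> (c * N <= T)%N ->
    measurable (S (N, T)) /\ pr P (S (N, T)) <= eta.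
  move=> eta0; have [c hc] := h e eta e0 eta0.
  exists c => N T cN cT; have [mX [B mB [PB nB]]] := hc N T cN cT.
  have mS : measurable (S (N, T)).
    rewrite (_ : S _ = [set w | exists ij : 'I_p * 'I_q,
        [set w | e < `|X (N, T) w ij.1 ij.2 - L ij.1 ij.2|] w]).
      apply: measurable_exists_fin => ij; apply: measurable_gt.
      by apply: measurableT_comp => //; apply: measurable_funB.
    by apply/seteqP; split=> w /=; [case=> i [j ij]; exists (i, j)|case=> -[i j] ij; exists i, j].
  split=> //; apply: le_trans PB; apply: pr_mono => // w [i [j]] eij.
  by apply: contrapT => /nB /(_ i j); rewrite leNgt eij.
apply/fine_cvgP; split.
  have [c hc] := SB 1 ltr01; exists c => N T cN cT /=.
  by have [mS _] := hc N T cN cT; rewrite -/(S _) prE.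
apply/cvgrPdist_le => eta eta0; have [c hc] := SB eta eta0; exists c => N T cN cT /=.
have [mS le] := hc N T cN cT.
by rewrite sub0r normrN ger0_norm ?(pr_ge0 P (S (N, T))).
Qed.

End convergence_in_probability.

Section eigenvalue_limit.
Context {R : realType} {d : measure_display} {Om : measurableType d}.
Variables (P : probability Om R) (k0 : nat) (g C1 C2 S b0 : R).

(** Identifies [amx] with the matrix whose limit is given by [eigen_limit_condition]. *)
Lemma amxE N K (m : panel R Om N K) : regular_panel P k0 g C1 C2 S b0 m ->
  amx P k0 m = (N%:R^-1 ^+ 3) *: ((Lam m)^T *m Mmx P k0 m *m Lam m).
Proof.
move=> rp; have NR : 0 < N%:R :> R by rewrite ltr0n (rp_N rp).
have s0 : 0 < Num.sqrt N%:R :> R by rewrite sqrtr_gt0.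
rewrite (Mmx_scaled rp) (Lam_Psi rp) [(_ *: _)^T]linearZ/=.
set Ps := Psi m; have PP : Ps^T *m Ps = 1%:M by exact: (Psi_orthonormal rp).
rewrite scale_mul3.
rewrite !mulmxA PP mul1mx -mulmxA PP mulmx1 scalerA.
have s2 : Num.sqrt N%:R ^+ 2 = N%:R :> R by rewrite sqr_sqrtr// ltW.
rewrite (_ : _ * _ = 1) ?scale1r//.
have -> : Num.sqrt N%:R * N%:R ^+ 2 * Num.sqrt N%:R = N%:R ^+ 3 :> R.
  by rewrite mulrAC -expr2 s2 -exprS.
by rewrite -exprMn mulVf ?expr1n// gt_eqF.
Qed.

End eigenvalue_limit.

Section rotation_limit.
Context {R : realType} {d : measure_display} {Om : measurableType d} {K : nat}.
Variables (P : probability Om R) (k0 : nat) (gamma : R).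
Variable m : forall N, panel R Om N K.
Variables (Lhat : forall N, nat -> Om -> 'M[R]_(N, K)) (Vhat : nat -> nat -> Om -> 'rV[R]_K).
Variables (C1 C2 S b0 : R).
Hypothesis K0 : (0 < K)%N.
Hypothesis est : eigen_estimator k0 m Lhat Vhat.
Hypothesis rp : forall N, (K <= N)%N -> regular_panel P k0 gamma C1 C2 S b0 (m N).
Variables (A E : 'M[R]_K) (al : 'rV[R]_K).
Hypothesis EE : E^T *m E = 1%:M.
Hypothesis AE : A = E *m diag_mx al *m E^T.
Hypothesis al_dec : forall i j : 'I_K, (i < j)%N -> al 0 j < al 0 i.
Hypothesis amx_cvg : forall e : R, 0 < e -> exists n0, forall N, (n0 <= N)%N ->
  nf (amx P k0 (m N) - A) <= e.

(** The hypotheses on the panels start at N = K; below, a constant sign is used. *)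
Definition sgn (NT : nat * nat) (w : Om) : 'rV[R]_K :=
  if (K <= NT.1)%N then sign_mx E (qmx (m NT.1) (Lhat NT.1 NT.2 w)) else const_mx 1.
Definition signed_L N (T : nat) (w : Om) : 'M[R]_(N, K) :=
  Lhat N T w *m diag_mx (sgn (N, T) w).
Definition KNT (NT : nat * nat) (w : Om) : 'M[R]_K :=
  if (K <= NT.1)%N then rotation (m NT.1) (signed_L NT.1 NT.2 w) else 1%:M.

Lemma sgnP NT w j : sgn NT w 0 j = 1 \/ sgn NT w 0 j = -1.
Proof. by rewrite /sgn; case: ifP => _; [exact: sign_mxP|left; rewrite mxE]. Qed.

Lemma random_sgn NT : random_mx (sgn NT).
Proof.
case: NT => N T; rewrite /sgn /=.
have [KN|_] := boolP (K <= N)%N; last exact: random_cst.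
have rq := @random_qmx _ _ _ k0 _ _ (m N) _ (Vhat N) (fun T => @est N T KN) T.
move=> i j; under [X in measurable_fun _ X]funext do rewrite mxE.
apply: measurable_fun_ifT => //.
apply: measurable_fun_ler => //.
exact: (random_mxM (random_cst _) rq).
Qed.

Lemma signed_est N (KN : (K <= N)%N) T : random_mx (signed_L N T) /\
  forall w, top_eigenpairs (Mhat k0 (m N) T w) (Vhat N T w) (signed_L N T w).
Proof.
have [rL top] := est T KN; split.
  by apply: random_mxM => //; apply: random_diag; exact: random_sgn.
by move=> w; apply: top_eigenpairs_sign => //; exact: sgnP.
Qed.

Lemma random_KNT NT : random_mx (KNT NT).
Proof.
case: NT => N T; rewrite /KNT /=.
have [KN|_] := boolP (K <= N)%N; last exact: random_cst.
exact: (random_rotation (V := Vhat N) (signed_est KN) T).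
Qed.

Lemma KNT_unit NT w : KNT NT w \in unitmx.
Proof. by rewrite /KNT; case: ifP => _; rewrite ?unitmx1 ?rotation_unit. Qed.

(** Measurability is assumed of the loadings; the eigenvalues inherit it as the diagonal of L' Mhat
    L / N. *)
Lemma random_Vhat N T : (K <= N)%N -> random_mx (Vhat N T).
Proof.
move=> KN; have [rL top] := est T KN; have rK := rp KN.
have NR : 0 < N%:R :> R by rewrite ltr0n (rp_N rK).
have rM : random_mx (Mhat k0 (m N) T).
  apply: random_mx_sum => k; apply: random_mxM; last apply: random_mx_tr.
    apply: random_mxZ; apply: random_mx_sum => t.
    by apply: random_mxM; last apply: random_mx_tr; exact: (random_obs rK).
  apply: random_mxZ; apply: random_mx_sum => t.
  by apply: random_mxM; last apply: random_mx_tr; exact: (random_obs rK).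
have rX : random_mx (fun w => N%:R^-1 *: ((Lhat N T w)^T *m (Mhat k0 (m N) T w *m Lhat N T w))).
  by apply: random_mxZ; apply: random_mxM; [exact: random_mx_tr|exact: random_mxM].
move=> i j; have := rX j j; congr measurable_fun; apply/funext => w.
have [_ [U [LE UU MU]]] := top w; rewrite (ord1 i).
have -> : (Lhat N T w)^T *m (Mhat k0 (m N) T w *m Lhat N T w) = N%:R *: diag_mx (Vhat N T w).
  rewrite LE [(_ *: _)^T]linearZ/= -scalemxAr -scalemxAl -scalemxAr MU scalerA mulmxA UU mul1mx.
  by rewrite -expr2 sqr_sqrtr// ltW.
by rewrite scalerA mulVf ?gt_eqF// scale1r mxE eqxx mulr1n.
Qed.

Lemma random_HNT N T : (K <= N)%N ->
  random_mx (fun w => HNT k0 (m N) T (Vhat N T w) (signed_L N T w) w).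
Proof.
move=> KN; have rK := rp KN; have [rL _] := signed_est KN T.
have rf t := random_factor rK t.
have rx t : random_mx (xi (m N) t) by exact: (random_xi (rp_model rK)).
apply: random_mx_tr; apply: random_mx_sum => k.
have rG : random_mx (G1 (m N) T k).
  apply: random_mxZ; apply: random_mx_sum => t; apply: random_mxD; apply: random_mxM.
  - by apply: random_mxM => //; exact: random_mx_tr.
  - exact: random_cst.
  - exact: rf.
  - exact: random_mx_tr.
apply: random_mxM; last first.
  by apply: random_invmx; apply: random_diag; exact: random_Vhat.
apply: random_mxM => //; apply: random_mxM; last exact: random_cst.
by apply: random_mxM => //; exact: random_mx_tr.
Qed.

Lemma small_err_event (de eta : R) : 0 < de -> 0 < eta ->
  exists c : nat, forall N T, (c <= N)%N -> (c * N <= T)%N ->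
  [/\ (K <= N)%N, (0 < T)%N, nf (amx P k0 (m N) - A) <= de &
      pr P [set w | de < err_nf P k0 (m N) T w] <= eta].
Proof.
move=> de0 eta0; have [n0 hn] := amx_cvg de0.
have ed0 : 0 < eta * de ^+ 2 by rewrite mulr_gt0// exprn_gt0.
have [t0 ht] := nat_threshold (sq_err_cst k0 gamma C1 C2 S K) ed0.
(* As N >= 1, T >= c N >= c, so c >= t0 makes T large as well. *)
exists (maxn (maxn n0 t0) (maxn K 1)) => N T.
rewrite !geq_max => /andP[/andP[nN tN] /andP[KN N0]] cT.
have T1 : (t0 <= T)%N.
  apply: leq_trans cT; apply: (@leq_trans (maxn (maxn n0 t0) (maxn K 1))); last by rewrite leq_pmulr.
  by rewrite !leq_max leqnn orbT.
have T0 : (0 < T)%N.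
  by apply: leq_trans cT; rewrite muln_gt0 N0 andbT !leq_max leqnn !orbT.
split=> //; first exact: hn.
have TR : 0 < T%:R :> R by rewrite ltr0n.
have mE := measurable_err_nf (rp KN) T0.
rewrite -pr_le; last exact: measurable_gt.
apply: le_trans (err_nf_tail (rp KN) T0 de0) _; rewrite lee_fin.
rewrite ler_pdivrMr ?mulr_gt0 ?exprn_gt0// [T%:R * _]mulrC mulrA; exact: ht.
Qed.

Lemma rotation_event (e eta : R) : 0 < e -> 0 < eta ->
  exists c : nat, forall N T, (c <= N)%N -> (c * N <= T)%N ->
  [/\ (K <= N)%N, (0 < T)%N & exists2 B : set Om, measurable B & pr P B <= eta /\
   forall w, ~ B w -> let L := signed_L N T w in
    [/\ pcst K k0 (c_bound gamma C1 C2 K) b0 * err_nf P k0 (m N) T w <= 1,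
        forall i j, `|(qmx (m N) L - E) i j| <= e &
        forall i j, `|((HNT k0 (m N) T (Vhat N T w) L w)^T - E) i j| <= e]].
Proof.
move=> e0 eta0.
have b00 : 0 < b0 by exact: (rp_b0 (rp (leqnn K))).
have [de de0 sel] := panel_selection P k0 gamma C1 C2 S b00 EE AE al_dec e0.
have [c hc] := small_err_event de0 eta0; exists c => N T cN cT.
have [KN T0 ad pe] := hc N T cN cT; split=> //.
exists [set w | de < err_nf P k0 (m N) T w].
  by apply: measurable_gt; exact: (measurable_err_nf (rp KN)).
split=> // w /negP; rewrite -leNgt => ew.
have [_ top] := est T KN.
have := sel N (m N) T w _ _ (rp KN) (top w) ad ew.
by rewrite /signed_L /sgn /= KN.
Qed.

Lemma KNT_cvg : cvg_prob P oT_filter KNT E^T.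
Proof.
apply: cvg_prob_oT => e eta e0 eta0.
have [c hc] := rotation_event e0 eta0; exists c => N T cN cT.
have [KN T0 [B mB [PB nB]]] := hc N T cN cT; split; first exact: random_KNT.
exists B => //; split=> // w /nB [h1 h2 _] i j.
rewrite /KNT /= KN (rotationE (rp KN) (signed_est KN) h1).
by have := h2 j i; rewrite !mxE.
Qed.

Lemma HNT_cvg : cvg_prob P oT_filter (fun NT w =>
  HNT k0 (m NT.1) NT.2 (Vhat NT.1 NT.2 w) (Lhat NT.1 NT.2 w *m diag_mx (sgn NT w)) w) E^T.
Proof.
apply: cvg_prob_oT => e eta e0 eta0.
have [c hc] := rotation_event e0 eta0; exists c => N T cN cT.
have [KN T0 [B mB [PB nB]]] := hc N T cN cT; split; first exact: random_HNT.
exists B => //; split=> // w /nB [_ _ h] i j.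
by have := h j i; rewrite /signed_L !mxE /=.
Qed.

End rotation_limit.

(** * Asymptotic normality *)

Section score_moments.
Context {R : realType} {d : measure_display} {Om : measurableType d}.
Variable P : probability Om R.
Variables (k0 : nat) (g C1 C2 S b0 : R) (N K : nat) (m : panel R Om N K).
Hypothesis rp : regular_panel P k0 g C1 C2 S b0 m.

Let NR : 0 < N%:R :> R. Proof. by rewrite ltr0n (rp_N rp). Qed.
Let sN : R := Num.sqrt N%:R.
Let sN2 : sN ^+ 2 = N%:R. Proof. by rewrite sqr_sqrtr// ltW. Qed.

Lemma scoreE t w : score m t w = sN^-1 *: ((Lam m)^T *m xi m t w).
Proof.
congr (_ *: _); rewrite /xi mulmxA; apply/colP => k; rewrite summxE mxE.
by apply: eq_bigr => i _; rewrite !mxE mulrC.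
Qed.

Lemma random_score t : random_mx (score m t).
Proof.
have h : random_mx (fun w => sN^-1 *: ((Lam m)^T *m xi m t w)).
  by apply: random_mxZ; exact: (random_Lxi rp).
by move=> i j; under [X in measurable_fun _ X]funext do rewrite scoreE; exact: h.
Qed.

Lemma random_noise t : random_mx (noise m t).
Proof. by have [/(_ t) [] _ _ ? _ _ _] := rp_model rp. Qed.

(** Since these second moments are exactly the diagonal of [score_var], convergence of the latter
    yields tightness of the scores. *)
Lemma Ex_score_sqr t k : ig P (fun w => score m t w k 0 ^+ 2) /\
  Ex P (fun w => score m t w k 0 ^+ 2) = score_var P m t k k.
Proof.
pose e i w := noise m t w i 0; pose p (i : 'I_N) : R := pvec m i k 0.
have sq i : ig P (fun w => e i w ^+ 2) by exact: (sqr_noise (rp_g rp) (rp_model rp) (rp_noise rp)).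
have me i : measurable_fun [set: Om] (e i) by exact: random_noise.
have iij i j : ig P (fun w => e i w * e j w) by exact: ig_mul_sqr.
have E w : score m t w k 0 ^+ 2 =
    N%:R^-1 * \sum_(i < N) \sum_(j < N) p i * p j * (e i w * e j w).
  rewrite /score mxE summxE exprMn exprVn sqr_sqrtr ?(ltW NR)//; congr (_ * _).
  have -> : \sum_(i < N) (noise m t w i 0 *: pvec m i) k 0 = \sum_(i < N) e i w * p i.
    by apply: eq_bigr => i _; rewrite [LHS]mxE.
  rewrite expr2 mulr_suml; apply: eq_bigr => i _; rewrite mulr_sumr.
  by apply: eq_bigr => j _; ring.
under eq_Ex do rewrite E; under [X in ig _ X]funext do rewrite E.
have iS : ig P (fun w => \sum_(i < N) \sum_(j < N) p i * p j * (e i w * e j w)).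
  by apply: ig_sum => i; apply: ig_sum => j; exact: igZ.
split; first exact: igZ.
rewrite ExZ// Ex_sum => [|i]; last by apply: ig_sum => j; exact: igZ.
rewrite [RHS]mxE; congr (_ * _); rewrite summxE; apply: eq_bigr => i _.
rewrite Ex_sum => [|j]; last exact: igZ.
rewrite summxE; apply: eq_bigr => j _; rewrite ExZ// [RHS]mxE mulrC; congr (_ * _).
by rewrite [RHS]mxE big_ord1; congr (_ * _); rewrite [RHS]mxE.
Qed.

Lemma score_tail t (x : R) : 0 < x ->
  pr P [set w | x < frob2 (score m t w)] <= \tr (score_var P m t) / x.
Proof.
move=> x0; have fE w : frob2 (score m t w) = \sum_k score m t w k 0 ^+ 2.
  by apply: eq_bigr => k _; rewrite big_ord1.
have iS : ig P (fun w => frob2 (score m t w)).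
  under [X in ig _ X]funext do rewrite fE.
  by apply: ig_sum => k; have [] := Ex_score_sqr t k.
rewrite -pr_le; last by apply: measurable_gt; exact: ig_meas iS.
apply: le_trans (prob_gt_le iS (fun w => frob2_ge0 _) x0) _.
rewrite lee_fin le_eqVlt; apply/orP; left; apply/eqP; congr (_ / _).
under eq_Ex do rewrite fE.
rewrite Ex_sum => [|k]; last by have [] := Ex_score_sqr t k.
by apply: eq_bigr => k _; have [] := Ex_score_sqr t k.
Qed.

Lemma xi_sqr_tail t (x : R) : 0 < x ->
  pr P [set w | x * N%:R < frob2 (xi m t w)] <= (1 + mom_cst g C1 C2) / x.
Proof.
move=> x0; have fE w : frob2 (xi m t w) = \sum_k xi m t w k 0 ^+ 2.
  by apply: eq_bigr => k _; rewrite big_ord1.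
have ik k : ig P (fun w => xi m t w k 0 ^+ 2).
  exact: (sqr_xi (rp_g rp) (rp_K rp) (rp_model rp) (rp_sums rp) (rp_C2 rp)
    (rp_factor rp) (rp_noise rp)).
have iS : ig P (fun w => frob2 (xi m t w)).
  by under [X in ig _ X]funext do rewrite fE; exact: ig_sum.
rewrite -pr_le; last by apply: measurable_gt; exact: ig_meas iS.
apply: le_trans (prob_gt_le iS (fun w => frob2_ge0 _) (mulr_gt0 x0 NR)) _.
rewrite lee_fin; under eq_Ex do rewrite fE.
rewrite Ex_sum//; apply: (@le_trans _ _ (((1 + mom_cst g C1 C2) * N%:R) / (x * N%:R))).
  rewrite ler_wpM2r ?invr_ge0 ?mulr_ge0 ?(ltW x0)//.
  apply: (@le_trans _ _ (\sum_(k < N) (1 + mom_cst g C1 C2))); last first.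
    by rewrite sumr_const card_ord mulr_natr.
  apply: ler_sum => k _; exact: (Ex_xi_sqr (rp_g rp) (rp_K rp) (rp_model rp) (rp_sums rp)
    (rp_C2 rp) (rp_factor rp) (rp_noise rp)).
by rewrite le_eqVlt; apply/orP; left; apply/eqP; field; rewrite !gt_eqF.
Qed.

Lemma scaled_err_sub (E : 'M[R]_K) (L : 'M[R]_(N, K)) t w :
  sN *: (fhat m L t w - (qmx m L)^T *m factor m t w) - E^T *m score m t w =
  (qmx m L - E)^T *m score m t w + (resid m L)^T *m xi m t w.
Proof.
have s0 : sN != 0 by rewrite gt_eqF// sqrtr_gt0.
rewrite (fhat_sub rp) scalerDr !scalerA mulfV// scale1r.
have -> : (sN * N%:R^-1) *: ((qmx m L)^T *m ((Lam m)^T *m xi m t w)) = (qmx m L)^T *m score m t w.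
  rewrite scoreE -sN2 (_ : sN * (sN ^+ 2)^-1 = sN^-1); last by field.
  exact: scalemxAr.
by rewrite [(_ - _)^T]linearB/= mulmxBl addrAC.
Qed.

End score_moments.

Section error_limit.
Context {R : realType} {d : measure_display} {Om : measurableType d} {K : nat}.
Variables (P : probability Om R) (k0 : nat) (gamma : R).
Variable m : forall N, panel R Om N K.
Variables (Lhat : forall N, nat -> Om -> 'M[R]_(N, K)) (Vhat : nat -> nat -> Om -> 'rV[R]_K).
Variables (C1 C2 S b0 : R).
Hypothesis K0 : (0 < K)%N.
Hypothesis est : eigen_estimator k0 m Lhat Vhat.
Hypothesis rp : forall N, (K <= N)%N -> regular_panel P k0 gamma C1 C2 S b0 (m N).
Variables (A E : 'M[R]_K) (al : 'rV[R]_K).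
Hypothesis EE : E^T *m E = 1%:M.
Hypothesis AE : A = E *m diag_mx al *m E^T.
Hypothesis al_dec : forall i j : 'I_K, (i < j)%N -> al 0 j < al 0 i.
Hypothesis amx_cvg : forall e : R, 0 < e -> exists n0, forall N, (n0 <= N)%N ->
  nf (amx P k0 (m N) - A) <= e.

Definition scaled_err (t : int) (NT : nat * nat) (w : Om) : 'cV[R]_K :=
  Num.sqrt NT.1%:R *: (fhat (m NT.1) (Lhat NT.1 NT.2 w *m diag_mx (sgn m Lhat E NT w)) t w
     - KNT m Lhat E NT w *m factor (m NT.1) t w).

Lemma random_scaled_err t N T : (K <= N)%N -> random_mx (scaled_err t (N, T)).
Proof.
move=> KN; apply: random_mxZ; apply: random_mxD.
  exact: (random_fhat (rp KN) (V := Vhat N) (signed_est est E KN) T t).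
apply: random_mxN; apply: random_mxM; last exact: (random_factor (rp KN)).
exact: (random_KNT est).
Qed.

Lemma score_bounded t (G : 'M[R]_K) : score_var P (m N) t @[N --> \oo] --> G ->
  exists2 V : R, 0 < V & exists n0, forall N, (n0 <= N)%N -> \tr (score_var P (m N) t) <= V.
Proof.
move=> cG; exists (`|\tr G| + K%:R + 1); first by rewrite ltr_wpDl// addr_ge0.
have [n0 h] := cvg_mx_nf cG ltr01; exists n0 => N /h hN.
have -> : score_var P (m N) t = (score_var P (m N) t - G) + G by rewrite subrK.
rewrite mxtraceD.
have : \tr (score_var P (m N) t - G) <= \sum_(k < K) 1.
  apply: ler_sum => k _; apply: le_trans (ler_norm _) _.
  by apply: le_trans (entry_le_nf _ _ _) hN.
by rewrite sumr_const card_ord => h2; have := ler_norm (\tr G); lra.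
Qed.

(** The difference is (q - E)' score + r' xi on the good event. The first term vanishes by tightness
    of the score; the second is of order sqrt(N/T), and this is where N = o(T) enters. *)
Lemma scaled_err_cvg t (G : 'M[R]_K) : score_var P (m N) t @[N --> \oo] --> G ->
  cvg_prob P oT_filter (fun NT w => scaled_err t NT w - E^T *m score (m NT.1) t w) 0.
Proof.
move=> cG; apply: cvg_prob_oT => e eta e0 eta0.
have e4 : 0 < eta / 4 by lra.
have e2 : 0 < e / 2 by lra.
have rK := rp (leqnn K).
have [V V0 [n0 Vn]] := score_bounded cG.
pose mo := 1 + mom_cst gamma C1 C2.
have mo0 : 0 < mo.
  by have := mom_cst_ge0 C2 K0 (rp_model rK) (rp_factor rK); rewrite /mo; lra.
(* Markov levels: [x] for the score, [y] for xi and [z] for the estimation error each fail with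
   probability at most eta/4; the rotation event takes the last quarter. *)
pose x := V / (eta / 4); have x0 : 0 < x by rewrite divr_gt0.
pose y := mo / (eta / 4); have y0 : 0 < y by rewrite divr_gt0.
pose CF := sq_err_cst k0 gamma C1 C2 S K.
pose z := Num.sqrt (`|CF| / (eta / 4)) + 1.
have z0 : 0 < z by rewrite ltr_wpDl ?sqrtr_ge0.
have CFz : CF / z ^+ 2 <= eta / 4.
  rewrite ler_pdivrMr ?(exprn_gt0 _ z0)// -ler_pdivrMl// mulrC.
  have s0 : 0 <= `|CF| / (eta / 4) by rewrite divr_ge0 ?(ltW e4).
  apply: (@le_trans _ _ (`|CF| / (eta / 4))).
    by rewrite ler_wpM2r ?ler_norm// invr_ge0 ltW.
  rewrite -{1}(sqr_sqrtr s0) ler_pXn2r ?nnegrE ?sqrtr_ge0 ?(ltW z0)//.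
  by rewrite /z lerDl.
pose q2 := pc2 K k0 (c_bound gamma C1 C2 K) b0.
have q20 : 0 <= q2 by have [] := pc_ge0 K k0 (c_bound_ge0 gamma C1 C2 K) (rp_b0 rK).
pose s : R := Num.sqrt (K * K)%:R; have s0 : 0 <= s by exact: sqrtr_ge0.
pose e' := e / 2 / ((s + 1) * (Num.sqrt x + 1)).
have sx0 : 0 <= Num.sqrt x by exact: sqrtr_ge0.
have den0 : 0 < (s + 1) * (Num.sqrt x + 1) by rewrite mulr_gt0// ltr_wpDl.
have e'0 : 0 < e' by rewrite divr_gt0.
have [c1 hc] := rotation_event est rp EE AE al_dec amx_cvg e'0 e4.
have e22 : 0 < (e / 2) ^+ 2 by rewrite exprn_gt0.
(* With T >= c N and c >= c2, the squared bound (q2 z)^2 y N / T is at most (e/2)^2. *)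
have [c2 hc2] := nat_threshold ((q2 * z) ^+ 2 * y) e22.
exists (maxn (maxn c1 c2) n0) => N T; set c := maxn _ n0 => cN cT.
have c1c : (c1 <= c)%N by rewrite !leq_max leqnn.
have c2c : (c2 <= c)%N by rewrite !leq_max leqnn orbT.
have n0c : (n0 <= c)%N by rewrite !leq_max leqnn orbT.
have [KN T0 [B1 mB1 [PB1 nB1]]] := hc N T (leq_trans c1c cN) (leq_trans (leq_mul c1c (leqnn N)) cT).
have rN := rp KN.
have NR : 0 < N%:R :> R by rewrite ltr0n (rp_N rN).
have TR : 0 < T%:R :> R by rewrite ltr0n.
have rs := random_score rN t.
split.
  apply: random_mxD; first exact: random_scaled_err.
  by apply: random_mxN; apply: random_mxM; [exact: random_cst|exact: rs].
pose B2 := [set w | x < frob2 (score (m N) t w)].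
pose B3 := [set w | y * N%:R < frob2 (xi (m N) t w)].
pose B4 := [set w | z / Num.sqrt T%:R < err_nf P k0 (m N) T w].
have mB2 : measurable B2 by apply: measurable_gt; exact: measurable_frob2.
have mB3 : measurable B3.
  by apply: measurable_gt; apply: measurable_frob2; exact: (random_xi (rp_model rN)).
have mB4 : measurable B4 by apply: measurable_gt; exact: (measurable_err_nf rN).
have PB2 : pr P B2 <= eta / 4.
  apply: le_trans (score_tail rN t x0) _; rewrite ler_pdivrMr//.
  by rewrite /x [leRHS]mulrC divfK ?gt_eqF// Vn// (leq_trans n0c cN).
have PB3 : pr P B3 <= eta / 4.
  apply: le_trans (xi_sqr_tail rN t y0) _; rewrite ler_pdivrMr//.
  by rewrite /y [leRHS]mulrC divfK ?gt_eqF.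
have zT0 : 0 < z / Num.sqrt T%:R by rewrite divr_gt0// sqrtr_gt0.
have PB4 : pr P B4 <= eta / 4.
  rewrite -pr_le//; apply: le_trans (err_nf_tail rN T0 zT0) _; rewrite lee_fin.
  rewrite expr_div_n sqr_sqrtr ?(ltW TR)// [X in _ / X]mulrC divfK ?gt_eqF//.
exists (B1 `|` B2 `|` B3 `|` B4); first by do 3 apply: measurableU => //.
split.
  have h : forall w, (B1 `|` B2 `|` B3 `|` B4) w -> [\/ B1 w, B2 w, B3 w | B4 w].
    by move=> w [[[]|]|]; [constructor 1|constructor 2|constructor 3|constructor 4].
  have mB : measurable (B1 `|` B2 `|` B3 `|` B4) by do 3 apply: measurableU => //.
  have := pr_union_bound4 P mB1 mB2 mB3 mB4 mB h.
  by move: PB1 PB2 PB3 PB4; lra.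
move=> w nB i j; have -> : (0 : 'cV[R]_K) i j = 0 by rewrite mxE.
rewrite subr0.
have [nw1 nw2 nw3 nw4] : [/\ ~ B1 w, ~ B2 w, ~ B3 w & ~ B4 w].
  by split=> h; apply: nB; [left; left; left|left; left; right|left; right|right].
have [h1 h2 _] := nB1 w nw1.
have hs : nf (score (m N) t w) <= Num.sqrt x.
  by move/negP: nw2; rewrite -leNgt => h; rewrite frob2_le// sqr_sqrtr// ltW.
have hx : nf (xi (m N) t w) <= Num.sqrt (y * N%:R).
  have yN : 0 <= y * N%:R by rewrite mulr_ge0// ltW.
  by move/negP: nw3; rewrite -leNgt => h; rewrite frob2_le ?sqrtr_ge0// sqr_sqrtr.
have he : err_nf P k0 (m N) T w <= z / Num.sqrt T%:R by move/negP: nw4; rewrite -leNgt.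
have -> : (scaled_err t (N, T) w - E^T *m score (m N) t w : 'cV[R]_K) =
   (qmx (m N) (signed_L m Lhat E N T w) - E)^T *m score (m N) t w +
   (resid (m N) (signed_L m Lhat E N T w))^T *m xi (m N) t w.
  rewrite -(scaled_err_sub rN) /scaled_err /KNT /= KN.
  by rewrite (rotationE rN (signed_est est E KN) h1).
apply: le_trans (entry_le_nf _ _ _) _; apply: le_trans (nfD _ _) _.
rewrite [leRHS](_ : e = e / 2 + e / 2); last by lra.
apply: lerD; apply: le_trans (nfM _ _) _; rewrite nf_tr.
  apply: (@le_trans _ _ (s * e' * Num.sqrt x)).
    by rewrite ler_pM ?nf_ge0// nf_entries_le.
  rewrite /e' mulrAC mulrA ler_pdivrMr// mulrC ler_wpM2l ?(ltW e2)//.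
  by rewrite ler_pM ?lerDl.
apply: (@le_trans _ _ (q2 * (z / Num.sqrt T%:R) * Num.sqrt (y * N%:R))).
  rewrite ler_pM ?nf_ge0//; apply: le_trans (good_resid rN ((signed_est est E KN T).2 w) h1) _.
  by rewrite ler_wpM2l.
clearbody q2 y z.
rewrite -ler_sqr ?nnegrE ?(ltW e2)//; last first.
  apply: mulr_ge0; last exact: sqrtr_ge0.
  by apply: mulr_ge0 => //; exact: ltW.
rewrite !exprMn exprVn !sqr_sqrtr ?(ltW TR) ?mulr_ge0 ?(ltW y0)//.
have hT : (q2 * z) ^+ 2 * y * N%:R <= (e / 2) ^+ 2 * T%:R.
  apply: le_trans (ler_wpM2r (ltW NR) (hc2 c c2c)) _.
  by rewrite -mulrA -natrM ler_wpM2l ?(ltW e22)// ler_nat.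
  rewrite [leLHS](_ : _ = (q2 * z) ^+ 2 * y * N%:R / T%:R); last by field; rewrite gt_eqF.
by rewrite ler_pdivrMr// -exprMn.
Qed.

End error_limit.

(** * Uniform continuity, linear images and Slutsky's lemma *)

Section uniform_continuity.
Context {R : realType}.

Lemma trmx_continuous n : continuous (fun x : 'rV[R]_n => x^T).
Proof.
move=> x U /nbhs_ballP[e /= e0 eU]; apply/nbhs_ballP; exists e => // y [_ xy].
by apply: eU; split=> // i j; rewrite !mxE; exact: xy.
Qed.

(* Heine's theorem, in the form of the near-covering property of compact boxes. *)
Lemma uniform_continuity_ball n (g : 'cV[R]_n -> R) (B e : R) : continuous g -> 0 < e ->
  exists2 de : R, 0 < de & forall x y : 'cV[R]_n, nf x <= B -> (forall i, `|x i 0 - y i 0| <= de) ->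
    `|g x - g y| <= e.
Proof.
(* Columns are transposed because [rV_compact] gives compact boxes of rows. *)
move=> cg e0; pose h (x : 'rV[R]_n) := g x^T.
have ch : continuous h by move=> x U gU; exact: (@trmx_continuous n x _ (cg x^T U gU)).
pose A := [set v : 'rV[R]_n | forall i, `[-B, B]%classic (v ord0 i)].
have cA : compact A.
  by apply: (@rV_compact _ _ (fun=> `[-B, B]%classic)) => i; exact: segment_compact.
pose Q (de : R) (x : 'rV[R]_n) := forall y : 'rV[R]_n, (forall i, `|x 0 i - y 0 i| <= de) ->
  `|h x - h y| <= e.
have e2 : 0 < e / 2 by rewrite divr_gt0.
have loc x : A x -> \forall x' \near x & de \near (0 : R)^'+, Q de x'.
  move=> _; have /cvgrPdist_le /(_ _ e2) /nbhs_ballP[r /= r0 hr] := ch x.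
  have r2 : 0 < r / 2 by rewrite divr_gt0.
  exists (ball x (r / 2), [set de : R | de < r / 2]) => /=.
    by split; [exact: nbhsx_ballx|exact: nbhs_right_lt].
  move=> [x' de] [/= [_ xx'] der] y xy.
  have hx' : `|h x - h x'| <= e / 2.
    apply: hr; split=> // i j; rewrite -ball_normE /=.
    have := xx' i j; rewrite -ball_normE /= => /lt_trans; apply.
    by rewrite ltr_pdivrMr// mulr_natr mulr2n ltrDl.
  have hy : `|h x - h y| <= e / 2.
    apply: hr; split=> // i j; rewrite -ball_normE /=.
    have := xx' i j; rewrite -ball_normE /= (ord1 i) => h1; have h2 := xy j.
    rewrite -[X in `|X|](subrKA (x' 0 j)); apply: le_lt_trans (ler_normD _ _) _.
    by lra.
  rewrite -[X in `|X|](subrKA (h x)); apply: le_trans (ler_normD _ _) _.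
  by rewrite [X in X + _]distrC; lra.
have := (compact_near_coveringP A).1 cA _ _ Q _ loc => near_Q.
have [r /= r0 hr] := near_Q.
exists (r / 2); first by rewrite divr_gt0.
move=> x y xB xy.
have -> : x = (x^T)^T by rewrite trmxK.
have -> : y = (y^T)^T by rewrite trmxK.
apply: (hr (r / 2)) => /=.
- by rewrite sub0r normrN gtr0_norm ?divr_gt0// ltr_pdivrMr// mulr_natr mulr2n ltrDl.
- by rewrite divr_gt0.
- move=> i; rewrite /= in_itv /= -ler_norml mxE; apply: le_trans xB.
  exact: entry_le_nf.
- by move=> i; rewrite !mxE.
Qed.

End uniform_continuity.

Section linear_image.
Context {R : realType} {n p : nat}.
Variable H : 'M[R]_(n, p).

Definition linear_image (x : borel_mx p 1) : borel_mx n 1 := H *m (x : 'cV[R]_p).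

Lemma random_borel_id : random_mx (fun x : borel_mx p 1 => (x : 'cV[R]_p)).
Proof. by move=> i j; apply: continuous_borel_measurable; exact: coord_mx_continuous. Qed.

Lemma measurable_linear_image : measurable_fun [set: borel_mx p 1] linear_image.
Proof.
exact: random_mx_measurable (random_mxM (random_cst H) random_borel_id).
Qed.

HB.instance Definition _ :=
  isMeasurableFun.Build _ _ _ _ linear_image measurable_linear_image.

(** The linear form u of the image is the form H' u of the original vector. *)
Lemma mvnormal0_linear_image (G : 'M[R]_p) (mu : probability (borel_mx p 1) R) :
  is_mvnormal0 G mu -> is_mvnormal0 (H *m G *m H^T) (distribution mu linear_image).
Proof.
move=> hmu u A mA.
have -> : u^T *m (H *m G *m H^T) *m u = (H^T *m u)^T *m G *m (H^T *m u).
  by rewrite trmx_mul trmxK !mulmxA.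
rewrite -hmu//; congr (mu _).
by apply/seteqP; split=> x; rewrite /= /linear_image trmx_mul trmxK mulmxA.
Qed.

Lemma continuous_linear_image (g : 'cV[R]_n -> R) : continuous g ->
  continuous (fun x : 'cV[R]_p => g (H *m x)).
Proof.
suff ch : continuous (fun x : 'cV[R]_p => H *m x).
  by move=> cg x U gU; exact: (ch x _ (cg (H *m x) U gU)).
move=> x U /nbhs_ballP[e /= e0 eU]; apply/nbhs_ballP.
pose s : R := nf H * Num.sqrt (p * 1)%:R; have s0 : 0 <= s by rewrite mulr_ge0 ?nf_ge0 ?sqrtr_ge0.
have s1 : 0 < s + 1 by lra.
have es : 0 < e / (s + 1) by rewrite divr_gt0.
exists (e / (s + 1)) => // y [_ xy]; apply: eU; split=> // i j.
rewrite -ball_normE /= (_ : _ - _ = (H *m (x - y)) i j); last by rewrite mulmxBr !mxE.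
apply: le_lt_trans (entry_le_nf _ _ _) _; apply: le_lt_trans (nfM _ _) _.
apply: (@le_lt_trans _ _ (s * (e / (s + 1)))).
  rewrite /s -mulrA ler_wpM2l ?nf_ge0// nf_entries_le// => k l.
  have := xy k l; rewrite -ball_normE /= => h; rewrite !mxE; exact: ltW.
by rewrite mulrCA gtr_pMr// ltr_pdivrMr// mul1r ltrDl.
Qed.

End linear_image.

Section slutsky.
Context {R : realType} {d : measure_display} {Om : measurableType d}.
Variable P : probability Om R.

Lemma bounded_continuous_ig n (g : 'cV[R]_n -> R) (M : R) (X : Om -> 'cV[R]_n) :
  continuous g -> (forall x, `|g x| <= M) -> random_mx X -> ig P (fun w => g (X w)).
Proof.
move=> cg gM rX; apply: (@ig_le _ _ _ _ _ (fun=> M)) => //; last exact: ig_cst.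
exact: (measurableT_comp (continuous_borel_measurable cg) (random_mx_measurable rX)).
Qed.

Lemma cvg_prob_small I (F : set_system I) {FF : Filter F} p q
    (X : I -> Om -> 'M[R]_(p, q)) (L : 'M[R]_(p, q)) (e eta : R) :
  cvg_prob P F X L -> 0 < e -> 0 < eta ->
  \forall x \near F, pr P [set w | exists i j, e < `|X x w i j - L i j|] <= eta.
Proof.
move=> cX e0 eta0; have /fine_cvgP[_ /cvgrPdist_le /(_ _ eta0)] := cX e e0.
apply: filterS => x /=; rewrite sub0r normrN ger0_norm ?fine_ge0 ?measure_ge0//.
Qed.

(** Tightness confines [Z] to a bounded set, near which the test function is uniformly continuous,
    so X and H Z give nearly equal values when they are close; otherwise the difference is at most
    2M, on events of small probability. *)
Lemma slutsky n p (X : nat * nat -> Om -> 'cV[R]_n) (Z : nat -> Om -> 'cV[R]_p)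
    (H : 'M[R]_(n, p)) (G : 'M[R]_p) (n0 : nat) :
  (forall N T, (n0 <= N)%N -> random_mx (X (N, T))) ->
  (forall N, (n0 <= N)%N -> random_mx (Z N)) ->
  (forall eta : R, 0 < eta -> exists (B : R) (n1 : nat), forall N, (n1 <= N)%N ->
     pr P [set w | B < nf (Z N w)] <= eta) ->
  cvg_prob P oT_filter (fun NT w => X NT w - H *m Z NT.1 w) 0 ->
  cvg_dist_normal P \oo Z G ->
  cvg_dist_normal P oT_filter X (H *m G *m H^T).
Proof.
move=> rX rZ tight XZ [mu muG muZ].
exists (distribution mu (linear_image H : {mfun _ >-> _})); first exact: mvnormal0_linear_image.
move=> g cg [M gM]; have M0 : 0 <= M by exact: le_trans (gM 0).
pose h (x : 'cV[R]_p) := g (H *m x).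
have ch : continuous h by exact: continuous_linear_image.
have hM x : `|h x| <= M by exact: gM.
have mh := continuous_borel_measurable ch.
have ih : mu.-integrable [set: borel_mx p 1] (EFin \o (h : borel_mx p 1 -> R)).
  apply: (@ig_le _ _ _ mu _ (fun=> M)) => //; exact: ig_cst.
rewrite integral_distribution; last 2 first.
- by apply/measurable_EFinP; exact: continuous_borel_measurable.
- exact: ih.
have fin : (\int[mu]_x (h x)%:E)%E \is a fin_num by exact: (integrable_fin_num _ ih).
have := muZ h ch (ex_intro _ M hM).
rewrite (_ : (\int[mu]_x _)%E = (fine (\int[mu]_x (h x)%:E))%:E); last by rewrite fineK.
move=> /fine_cvgP[_ /cvgrPdist_le lim].
rewrite (_ : (\int[mu]_x _)%E = (fine (\int[mu]_x (h x)%:E))%:E); last by rewrite fineK.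
set l := fine _ in lim *.
have igX N T : (n0 <= N)%N -> ig P (fun w => g (X (N, T) w)).
  by move=> nN; apply: bounded_continuous_ig cg gM (rX N T nN).
have igZ' N : (n0 <= N)%N -> ig P (fun w => h (Z N w)).
  by move=> nN; apply: bounded_continuous_ig ch hM (rZ N nN).
apply/fine_cvgP; split.
  by exists n0 => N T nN _ /=; rewrite ExE//; exact: igX.
apply/cvgrPdist_le => e e0.
have e4 : 0 < e / 4 by lra.
(* The denominator is 2M + 1 since M may be zero. *)
pose eta := e / 4 / (2 * M + 1); have eta0 : 0 < eta by rewrite divr_gt0//; lra.
have eta2 : 0 < eta / 2 by lra.
have [B [n1 hB]] := tight _ eta2.
have [de de0 unif] := uniform_continuity_ball (nf H * B) cg e4.
have [c hc] := cvg_prob_small XZ de0 eta2.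
have [n2 _ hl] := lim _ e4.
exists (maxn (maxn n0 n1) (maxn n2 c)) => N T; rewrite !geq_max => /andP[/andP[nN0 nN1] /andP[nN2 cN]] cT.
have cT' : (c * N <= T)%N by apply: leq_trans cT; rewrite leq_mul2r !leq_max leqnn !orbT.
have iX := igX N T nN0; have iZ := igZ' N nN0.
have h1 : `|l - Ex P (fun w => h (Z N w))| <= e / 4 by exact: hl nN2.
pose B1 := [set w | exists i j, de < `|(X (N, T) w - H *m Z N w) i j - (0 : 'cV[R]_n) i j|].
pose B2 := [set w | B < nf (Z N w)].
have PB1 : pr P B1 <= eta / 2 by exact: hc cN cT'.
have PB2 : pr P B2 <= eta / 2 by exact: hB nN1.
have rD : random_mx (fun w => X (N, T) w - H *m Z N w).
  apply: random_mxD; first exact: rX.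
  by apply: random_mxN; apply: random_mxM; [exact: random_cst|exact: rZ].
have mB1 : measurable B1.
  rewrite (_ : B1 = [set w | exists ij : 'I_n * 'I_1, [set w |
     de < `|(X (N, T) w - H *m Z N w) ij.1 ij.2 - (0 : 'cV[R]_n) ij.1 ij.2|] w]).
    apply: measurable_exists_fin => ij; apply: measurable_gt.
    by apply: measurableT_comp => //; apply: measurable_funB => //; exact: rD.
  by apply/seteqP; split=> w /=; [case=> i [j ij]; exists (i, j)|case=> -[i j] ij; exists i, j].
have mB2 : measurable B2 by apply: measurable_gt; apply: measurable_nf; exact: rZ.
have bd w : `|g (X (N, T) w) - h (Z N w)| <= e / 4 + (2 * M) * (\1_B1 w + \1_B2 w).
  have i1 : 0 <= \1_B1 w :> R by rewrite indicE.
  have i2 : 0 <= \1_B2 w :> R by rewrite indicE.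
  have [nB|wB] := pselect (~ B1 w /\ ~ B2 w).
    apply: (@le_trans _ _ (e / 4)); last by rewrite lerDl mulr_ge0// ?addr_ge0// mulr_ge0.
    case: nB => nB1 nB2; rewrite distrC; apply: unif.
      apply: le_trans (nfM _ _) _; rewrite ler_wpM2l ?nf_ge0//.
      by move/negP: nB2; rewrite -leNgt.
    move=> i; rewrite leNgt; apply/negP => lt; apply: nB1; exists i, 0.
    by rewrite distrC in lt; apply: lt_le_trans lt _; rewrite !mxE subr0.
  have : `|g (X (N, T) w) - h (Z N w)| <= 2 * M.
    by apply: le_trans (ler_normB _ _) _; have := gM (X (N, T) w); have := hM (Z N w); lra.
  move=> le2; apply: le_trans le2 _.
  have i12 : 1 <= \1_B1 w + \1_B2 w :> R.
    have [b1|b1] := pselect (B1 w).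
      by move: i2; rewrite [\1_B1 w]indicE mem_set//=; lra.
    have b2 : B2 w by apply: contrapT => b2; apply: wB.
    by move: i1; rewrite [\1_B2 w]indicE mem_set//=; lra.
  apply: (@le_trans _ _ (2 * M * (\1_B1 w + \1_B2 w))); last by rewrite lerDr ltW.
  by rewrite ler_peMr// mulr_ge0.
have iI : ig P (fun w => e / 4 + (2 * M) * (\1_B1 w + \1_B2 w)).
  by apply: igD; [exact: ig_cst|apply: igZ; apply: igD; exact: ig_indic].
have iB : ig P (fun w => g (X (N, T) w) - h (Z N w)) by exact: igB.
have h2 : `|Ex P (fun w => g (X (N, T) w)) - Ex P (fun w => h (Z N w))| <= e / 4 + 2 * M * eta.
  rewrite -ExB//; apply: le_trans (Ex_norm_le iB) _.
  apply: le_trans (Ex_le (ig_norm iB) iI bd) _.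
  rewrite ExD ?ExZ ?ExD ?Ex_cst ?Ex_indic//; try exact: ig_indic; try exact: ig_cst.
  - rewrite lerD2l ler_wpM2l ?mulr_ge0//.
    have : pr P B1 + pr P B2 <= eta by lra.
    by [].
  - by apply: igD; exact: ig_indic.
  - by apply: igZ; apply: igD; exact: ig_indic.
have Me : 2 * M * eta <= e / 4.
  by rewrite /eta mulrCA ger_pMr// ler_pdivrMr; lra.
change (`|l - Ex P (fun w => g (X (N, T) w))| <= e).
rewrite -[X in `|X|](subrKA (Ex P (fun w => h (Z N w)))).
apply: le_trans (ler_normD _ _) _; rewrite [X in _ + X]distrC.
by move: h1 h2 Me; lra.
Qed.

End slutsky.

Section score_tightness.
Context {R : realType} {d : measure_display} {Om : measurableType d} {K : nat}.
Variables (P : probability Om R) (k0 : nat) (gamma : R).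
Variable m : forall N, panel R Om N K.
Variables (C1 C2 S b0 : R).
Hypothesis rp : forall N, (K <= N)%N -> regular_panel P k0 gamma C1 C2 S b0 (m N).

Lemma score_tight t (G : 'M[R]_K) (eta : R) :
  score_var P (m N) t @[N --> \oo] --> G -> 0 < eta ->
  exists (B : R) (n1 : nat), forall N, (n1 <= N)%N ->
    pr P [set w | B < nf (score (m N) t w)] <= eta.
Proof.
move=> cG eta0; have [V V0 [n0 hV]] := score_bounded cG.
have x0 : 0 < V / eta by rewrite divr_gt0.
exists (Num.sqrt (V / eta)), (maxn n0 K) => N; rewrite geq_max => /andP[nN KN].
rewrite (_ : [set w | _] = [set w | V / eta < frob2 (score (m N) t w)]); last first.
  apply/seteqP; split=> w /=; rewrite !ltNge frob2_le ?sqrtr_ge0// sqr_sqrtr// ltW//.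
apply: le_trans (score_tail (rp KN) t x0) _; rewrite ler_pdivrMr// mulrC divfK ?gt_eqF//.
exact: hV.
Qed.

(** The limit inherits symmetry from [amx], which opens the way to the real spectral theorem. *)
Lemma limit_symmetric (A : 'M[R]_K) :
  (forall e : R, 0 < e -> exists n0, forall N, (n0 <= N)%N -> nf (amx P k0 (m N) - A) <= e) ->
  A^T = A.
Proof.
move=> h; apply/esym/eqP; rewrite -subr_eq0 -frob2_eq0 -nf_sqr sqrf_eq0 eq_le nf_ge0 andbT.
apply/ler_addgt0Pr => e e0; rewrite add0r; have e2 : 0 < e / 2 by rewrite divr_gt0.
have [n0 /(_ _ (leq_maxl n0 K)) hN] := h _ e2.
have as_ := amx_sym P k0 (m (maxn n0 K)).
set a := amx _ _ _ in hN as_; rewrite (_ : A - A^T = (a - A)^T - (a - A)); last first.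
  by rewrite [(a - A)^T]linearB/= as_ opprB [RHS]addrC addrA subrK.
by apply: le_trans (nfB _ _) _; rewrite nf_tr; lra.
Qed.

End score_tightness.

Theorem theorem5 (R : realType) (d : measure_display) (Om : measurableType d)
    (P : probability Om R) (K k0 : nat) (gamma : R)
    (m : forall N, panel R Om N K)
    (Lhat : forall N, nat -> Om -> 'M[R]_(N, K))
    (Vhat : nat -> nat -> Om -> 'rV[R]_K) :
  (0 < K)%N -> (1 <= k0)%N -> 2 < gamma ->
  (forall N, (K <= N)%N -> spatial_factor_model P (m N)) ->
  eigen_estimator k0 m Lhat Vhat ->
  eigenvalue_condition P k0 m ->
  mixing_condition P gamma m ->
  weight_condition m ->
  noise_condition P m ->
  loading_condition m ->
  moment_condition P gamma m ->
  rank_condition P m ->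
  (subexponential_condition P m ->
   exists KNT : nat * nat -> Om -> 'M[R]_K,
     [/\ forall NT, random_mx (KNT NT),
         forall NT w, KNT NT w \in unitmx &
         bigO_prob P oo_filter
           (fun NT w => \big[Num.max/0]_(1 <= t < NT.2.+1)
              norm2 (fhat (m NT.1) (Lhat NT.1 NT.2 w) t%:Z w
                     - KNT NT w *m factor (m NT.1) t%:Z w))
           (fun NT => ((Num.sqrt NT.1%:R)^-1 + (Num.sqrt NT.2%:R)^-1)
                      * ln NT.2%:R)]) /\
  (forall Gamma : nat -> 'M[R]_K,
   score_clt P m Gamma ->
   eigen_limit_condition P k0 m ->
   exists (sgn : nat * nat -> Om -> 'rV[R]_K)
          (KNT : nat * nat -> Om -> 'M[R]_K) (H : 'M[R]_K),
     let L NT w := Lhat NT.1 NT.2 w *m diag_mx (sgn NT w) in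
     let err (t : nat) NT w :=
       Num.sqrt NT.1%:R *: (fhat (m NT.1) (L NT w) t%:Z w
                            - KNT NT w *m factor (m NT.1) t%:Z w) in
     [/\ forall NT, random_mx (sgn NT) /\
           forall w j, sgn NT w 0 j = 1 \/ sgn NT w 0 j = -1,
         forall NT, random_mx (KNT NT) /\ forall w, KNT NT w \in unitmx,
         cvg_prob P oT_filter KNT H,
         cvg_prob P oT_filter
           (fun NT w => HNT k0 (m NT.1) NT.2 (Vhat NT.1 NT.2 w) (L NT w) w) H &
         forall t : nat, (1 <= t)%N ->
           cvg_prob P oT_filter
             (fun NT w => err t NT w - H *m score (m NT.1) t%:Z w) 0 /\
           cvg_dist_normal P oT_filter (err t) (H *m Gamma t *m H^T)]).
Proof.
move=> K0 _ g2 model est eig mix wgt noi ld mom _.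
have [C1 [C2 [S [b0 rp]]]] := regular_panels K0 g2 model eig mix wgt noi ld mom.
split; first exact: (uniform_factor_rate K0 est rp).
move=> Gamma clt [A [cA [s sA us]]].
have amx_cvg (e : R) : 0 < e -> exists n0, forall N, (n0 <= N)%N -> nf (amx P k0 (m N) - A) <= e.
  move=> e0; have [n0 hn] := cvg_mx_nf cA e0.
  exists (maxn n0 K) => N; rewrite geq_max => /andP[nN KN].
  by rewrite (amxE (rp N KN)); exact: hn.
have [al [E [EE AE al_dec]]] := sorted_diagonalization (limit_symmetric amx_cvg) sA us.
exists (sgn m Lhat E), (KNT m Lhat E), E^T => L err; split.
- by move=> NT; split; [exact: (random_sgn est)|exact: sgnP].
- by move=> NT; split; [exact: (random_KNT est)|exact: KNT_unit].
- exact: (KNT_cvg est rp EE AE al_dec amx_cvg).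
- exact: (HNT_cvg est rp EE AE al_dec amx_cvg).
move=> t t1; have [cG cN] := clt t t1.
have errP := scaled_err_cvg K0 est rp EE AE al_dec amx_cvg cG.
split; first exact: errP.
(* The threshold is K because measurability is established for N >= K. *)
apply: (slutsky (n0 := K) _ _ _ errP cN).
- by move=> N T KN; exact: (random_scaled_err est rp E t%:Z T KN).
- by move=> N KN; exact: (random_score (rp N KN)).
- by move=> eta eta0; exact: (score_tight rp cG eta0).
Qed.
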